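(* Let $k\geq2$ be an integer and let $s\neq1+\frac1k$ be a positive real number. Let $\theta_{k,s}$ be the infimum of all $(k,s)$-admissible exponents and let $\Delta_k$ be the exponent defined in the context. Then $$\theta_{k,s}\leq\begin{cases}\left(\frac{k+1}{2}\right)\Delta_k & \text{if } s<1+\frac1k,\\ \left(\frac12+\frac{1}{2(s-1)}\right)\Delta_k & \text{if } 1+\frac1k<s<2,\\ \Delta_k & \text{if } s\geq2.\end{cases}$$
   Context: For an integer $k\ge 2$, $\mu_k(n)$ is the indicator function of the $k$-free integers, i.e. those divisible by no $k$th power of a prime. Write $e(\alpha)=e^{2\pi i\alpha}$, and for $1\le K\leq N$ set $$S_k(\alpha;K)=\sum_{N-K<n\leq N}\mu_k(n)e(n\alpha).$$ For $s>0$, $s\ne 1+\frac1k$, an exponent $\theta$ is called $(k,s)$-admissible if, whenever $N^{\theta}\ll K\leq N$, one has $$\int_0^1|S_k(\alpha;K)|^s\,d\alpha\asymp\begin{cases}K^{\frac{s}{k+1}} & \text{if } s<1+\frac1k,\\ K^{s-1} & \text{if } s>1+\frac1k,\end{cases}$$ where the implicit constants may depend on $k$, $s$ and $\theta$. Here $K\gg N^\theta$ means $K\ge cN^\theta$ for a fixed constant $c>0$ (on which the implicit constants may also depend), and the estimate is asserted for all sufficiently large $N$; $f\asymp g$ means $f\ll g$ and $g\ll f$. For a positive integer $n$ and real $y<z$ let $c_n(y,z)=\sum_{y<d\leq z,\ d^k\mid n}\mu(d)$, where $d$ runs over positive integers and $\mu$ is the Möbius function. $\Delta_k$ denotes the least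 real number such that for every $\epsilon>0$ one has $$\sum_{N-K<n\leq N}|c_n(y,z)|^2\ll Ky^{1-k}+N^{\epsilon}K^{\frac1k}+N^{\Delta_k+\epsilon}$$ for all $1\leq K\leq N$ and all $1\leq y<z$, with implicit constant depending at most on $k$ and $\epsilon$. *)

(* Defs.v *)
From mathcomp Require Import all_boot all_order all_algebra.
From mathcomp Require Import all_classical all_reals all_analysis.
From mathcomp Require Import complex.

Set Implicit Arguments.
Unset Strict Implicit.
Unset Printing Implicit Defensive.

Import Order.TTheory GRing.Theory Num.Theory.
Local Open Scope classical_set_scope.
Local Open Scope ring_scope.
Local Open Scope complex_scope.

Definition kfree (k : nat) : set nat :=
  [set n | forall p : nat, prime p -> ~~ (p ^ k %| n)%N].

Definition moebius (d : nat) : int :=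
  if (0 < d)%N && all (fun p => ~~ (p ^ 2 %| d)%N) (primes d)
  then (-1) ^+ size (primes d) else 0.

Definition e {R : realType} (a : R) : R[i] :=
  cos (2 * pi * a) +i* sin (2 * pi * a).

(* Throughout, N, K, y, z are real; for a natural number n and a real N >= 0,
   n < (truncn N).+1 holds exactly when n%:R <= N. *)
Definition expsum {R : realType} (k : nat) (N K a : R) : R[i] :=
  \sum_(1 <= n < (Num.truncn N).+1 | N - K < n%:R)
     (\1_(kfree k) n)%:C * e (n%:R * a).

(* complex.Re `|_| is the modulus as an element of R, since the norm of R[i]
   takes its values in R[i]. *)
Definition moment {R : realType} (k : nat) (s N K : R) : \bar R :=
  \int[lebesgue_measure]_(a in `[0%R, 1%R])
     ((complex.Re `|expsum k N K a|) `^ s)%:E.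

Definition moment_order {R : realType} (k : nat) (s K : R) : R :=
  if s < 1 + k%:R^-1 then K `^ (s / (k%:R + 1)) else K `^ (s - 1).

Definition admissible {R : realType} (k : nat) (s theta : R) : Prop :=
  forall c : R, 0 < c ->
  exists C1 C2 N0 : R, [/\ 0 < C1, 0 < C2 &
    forall N K : R, N0 <= N -> 1 <= K -> c * N `^ theta <= K -> K <= N ->
      ((C1 * moment_order k s K)%:E <= moment k s N K)%E /\
      (moment k s N K <= (C2 * moment_order k s K)%:E)%E].

(* The infimum is taken in \bar R, where it needs no side conditions. *)
Definition theta_inf {R : realType} (k : nat) (s : R) : \bar R :=
  ereal_inf [set theta%:E | theta in [set theta : R | admissible k s theta]].

Definition cdiv {R : realType} (k n : nat) (y z : R) : int :=
  \sum_(1 <= d < (Num.truncn z).+1 | (y < d%:R) && (d ^ k %| n)%N) moebius d.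

Definition variance_exponent {R : realType} (k : nat) (D : R) : Prop :=
  forall eps : R, 0 < eps ->
  exists C : R, forall N K y z : R,
    1 <= K -> K <= N -> 1 <= y -> y < z ->
    \sum_(1 <= n < (Num.truncn N).+1 | N - K < n%:R)
       `|(cdiv k n y z)%:~R : R| ^+ 2
    <= C * (K * y `^ (1 - k%:R) + N `^ eps * K `^ (k%:R^-1) + N `^ (D + eps)).

(* The least variance exponent.  For D <= 0 the term N `^ (D + eps) is dominated
   by N `^ eps * K `^ (k%:R^-1), so if some D <= 0 is a variance exponent then
   every real number is one and there is no least one; the exponent is then
   understood to be 0. *)
Definition Delta {R : realType} (k : nat) : R :=
  let E := [set D : R | variance_exponent k D] in xget 0 (E `&` lbound E).

(* Main.v *)
Require Import Defs.
From mathcomp Require Import all_boot all_order all_algebra.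
From mathcomp Require Import all_classical all_reals all_analysis.
From mathcomp Require Import measurable_realfun complex ring lra zify.

(** Write S for the exponential sum over the k-free integers n of ]N - K,
    N], and Y = K^(1/(k+1)). By Moebius inversion the indicator of the
    k-free integers is the sum of moebius d over the d with d^k dividing n,
    and S splits as f + g, where f collects the divisors d <= x and g those
    with d > x. By Parseval the mean square of g is the quantity which a
    variance exponent bounds, so that in the range K >= c N^theta the tail
    costs at most K x^(1-k) plus a small multiple of a power of K
    ([tail_L2]).

    Upper bounds. The part of f from a dyadic block ]D/2, D] would have L1
    norm O(D) if the cut-off of n at the ends of the interval were smooth:
    over the multiples of a single q = d^k a Lipschitz cut-off has bounded
    L1 norm ([smooth_L1]). The sharp cut-off is a telescoping sum of
    differences of trapezoids whose edges shrink dyadically. Each difference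
    lives on two short intervals; interpolating between its L1 norm and its
    mean square, which reflects the short support, gives bounds that decay
    geometrically ([block_moment]). Summing over the blocks bounds the
    moments of f for 1 < s < 2, s <> 1 + 1/k ([trunc_moment]). With x = Y
    and the mean square of g this is the upper bound in that range
    ([upper_12]); the range s <= 1 follows by interpolation, and s >= 2 from
    the trivial bound for S.

    Lower bounds for s > 1 + 1/k. The integers of the interval include a
    positive proportion of k-free ones ([kfree_count]), so S has size K on
    an interval of length about 1/K around 0 ([lower_major]).

    Lower bounds for s < 1 + 1/k. It suffices to show that the L1 norm of S
    is at least a multiple of Y ([L1_lower]): for the other s one
    interpolates, between the sth moment and an upper bound if s < 1
    ([lower_of_L1]). Take y a small multiple of Y and x a small multiple of
    y. For squarefree d in ]y, 2y], sum F(t + a/d^k) over the a mod d^k for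
    which gcd(a, d^k) is k-free. For F = S this multiplies S by moebius d,
    because the resulting weights are Ramanujan sums taking the value
    moebius d at the k-free integers ([twist_S]), whereas for F = f the sum
    nearly vanishes, because a divisor d' <= x is not divisible by d and the
    main terms cancel ([twist_f]). Hence, for t near 0 and each of the order
    of y values of d, the sum of |g| over the translates is of order K, and
    the integrals of |g| over windows of width about 1/K around the
    fractions a/d^k add up to at least a multiple of y ([Int_cover_tail]).
    The windows overlap little, by an elementary count of close fractions
    ([Int_cover2]), and on them f is small on average, so that S = f + g
    inherits this mass.

    Finally the least variance exponent exists, is nonnegative and is itself
    a variance exponent ([Delta_spec]), and the bounds above hold for every
    theta exceeding the claimed value. *)

Set Implicit Arguments.
Unset Strict Implicit.
Unset Printing Implicit Defensive.

Import Order.TTheory GRing.Theory Num.Theory.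
Import numFieldNormedType.Exports.
Local Open Scope classical_set_scope.
Local Open Scope ring_scope.
Local Open Scope complex_scope.

(** * Integrals of bounded measurable functions *)

Section Integrals.
Context {R : realType}.
Implicit Types f g : R -> R.

(** A class closed under all operations needed below, on which every integral
    over a bounded interval is finite. *)
Definition nice f : Prop :=
  measurable_fun setT f /\ exists M : R, forall x, `|f x| <= M.

Definition Int (a b : R) f : R :=
  \int[@lebesgue_measure R]_(x in `[a, b]) f x.

Lemma nice_cst c : nice (fun _ => c).
Proof. by split=> //; exists `|c|. Qed.

Lemma niceD f g : nice f -> nice g -> nice (fun x => f x + g x).
Proof.
move=> [mf [M Mf]] [mg [M' Mg]]; split; first exact: measurable_funD.
by exists (M + M') => x; rewrite (le_trans (ler_normD _ _))// lerD.
Qed.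

Lemma niceM f g : nice f -> nice g -> nice (fun x => f x * g x).
Proof.
move=> [mf [M Mf]] [mg [M' Mg]]; split; first exact: measurable_funM.
by exists (M * M') => x; rewrite normrM ler_pM.
Qed.

Lemma niceZ c f : nice f -> nice (fun x => c * f x).
Proof. by move=> nf; apply: niceM => //; exact: nice_cst. Qed.

Lemma nice_sum (T : Type) (r : seq T) (P : pred T) (F : T -> R -> R) :
  (forall i, P i -> nice (F i)) -> nice (fun x => \sum_(i <- r | P i) F i x).
Proof.
move=> nF; elim: r => [|i r IH].
  by under eq_fun do rewrite big_nil; exact: nice_cst.
case Pi : (P i); under eq_fun do rewrite big_cons Pi => //.
  by apply: niceD => //; exact: nF.
by [].
Qed.

Lemma nice_sqr f : nice f -> nice (fun x => f x ^+ 2).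
Proof. by move=> nf; under eq_fun do rewrite expr2; exact: niceM. Qed.

Lemma nice_powR f s : 0 <= s -> nice f -> nice (fun x => f x `^ s).
Proof.
move=> s0 [mf [M Mf]]; split.
  exact: (measurableT_comp (f := fun x => x `^ s) (measurable_powR s) mf).
exists (`|M| `^ s + 1) => x; rewrite ger0_norm ?powR_ge0//.
have [fx0|fx0] := leP 0 (f x).
  rewrite ler_wpDr// ge0_ler_powR ?nnegrE//.
  by rewrite (le_trans (ler_norm _))// (le_trans (Mf _))// ler_norm.
by rewrite lt0_powR1// ler_wpDl// powR_ge0.
Qed.

Lemma nice_continuous_bounded f M : continuous f -> (forall x, `|f x| <= M) ->
  nice f.
Proof. by move=> cf Mf; split; [exact: continuous_measurable_fun|exists M]. Qed.

Lemma nice_integrable a b f : nice f ->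
  (@lebesgue_measure R).-integrable `[a, b] (EFin \o f).
Proof.
move=> [mf [M Mf]]; apply: measurable_bounded_integrable => //.
- by have := lebesgue_measure_itv `[a, b] => /= ->; case: ifP => //; rewrite ltry.
- exact: measurable_funS mf.
- exists M; split; first exact: num_real.
  by move=> y My x _ /=; rewrite (le_trans (Mf _))// ltW.
Qed.

Lemma eq_Int a b f g : f =1 g -> Int a b f = Int a b g.
Proof. by move=> /funext ->. Qed.

Lemma Int_ge0 a b f : (forall x, 0 <= f x) -> 0 <= Int a b f.
Proof. by move=> f0; apply: Rintegral_ge0. Qed.

Lemma le_Int a b f g : nice f -> nice g -> (forall x, a <= x <= b -> f x <= g x) ->
  Int a b f <= Int a b g.
Proof.
move=> nf ng fg; apply: le_Rintegral; [by []|exact: nice_integrable|exact: nice_integrable|].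
by move=> x; rewrite /= in_itv/=; exact: fg.
Qed.

Lemma IntD a b f g : nice f -> nice g ->
  Int a b (fun x => f x + g x) = Int a b f + Int a b g.
Proof. by move=> nf ng; apply: RintegralD; [by []|exact: nice_integrable|exact: nice_integrable]. Qed.

Lemma IntZ a b c f : nice f -> Int a b (fun x => c * f x) = c * Int a b f.
Proof. by move=> nf; apply: RintegralZl; [by []|exact: nice_integrable]. Qed.

Lemma Int_cst a b c : a <= b -> Int a b (fun _ => c) = c * (b - a).
Proof.
move=> ab; rewrite /Int Rintegral_cst//; congr (_ * _).
suff E : lebesgue_measure (`[a, b] : set R) = (b - a)%:E.
  by rewrite -[RHS]/(fine (b - a)%:E) -E.
rewrite (lebesgue_measure_itv `[a, b])/= lte_fin.
by case: ltgtP ab => // -> _; rewrite subrr.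
Qed.

Lemma Int_sum a b (T : Type) (r : seq T) (P : pred T) (F : T -> R -> R) :
  (forall i, P i -> nice (F i)) ->
  Int a b (fun x => \sum_(i <- r | P i) F i x) =
  \sum_(i <- r | P i) Int a b (F i).
Proof.
move=> nF; elim: r => [|i r IH].
  rewrite big_nil -[RHS](mul0r (fine (lebesgue_measure `[a, b]))).
  rewrite /Int -Rintegral_cst//.
  by congr fine; apply: eq_integral => x _; rewrite big_nil.
rewrite big_cons; case: ifP => Pi.
  rewrite -IH -IntD; [|exact: nF|exact: nice_sum].
  by apply: eq_Int => x; rewrite big_cons Pi.
by rewrite -IH; apply: eq_Int => x; rewrite big_cons Pi.
Qed.

Lemma le_Int_itv a b a' b' f : nice f -> (forall x, 0 <= f x) ->
  a' <= a -> b <= b' -> Int a b f <= Int a' b' f.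
Proof.
move=> nf f0 aa bb; rewrite /Int /Rintegral fine_le//.
- by apply: integrable_fin_num => //; exact: nice_integrable.
- by apply: integrable_fin_num => //; exact: nice_integrable.
apply: ge0_subset_integral => //=.
- apply/measurable_EFinP; apply: measurable_funS (nf.1) => //.
- by move=> x _; rewrite lee_fin.
- apply: subset_itv; rewrite bnd_simp//.
Qed.

Lemma Int_shift a b c f : nice f -> continuous f -> a <= b ->
  Int (c + a) (c + b) f = Int a b (fun x => f (c + x)).
Proof.
move=> nf cf ab; rewrite /Int /Rintegral.
have dF : forall x : R, is_derive x 1 (fun x => c + x) 1.
  move=> x; rewrite -[X in is_derive _ _ _ X]add0r.
  exact: (is_deriveD (is_derive_cst c x 1) (is_derive_id x 1)).
have F' : derive1 (fun x : R => c + x) = (fun=> 1).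
  by apply/funext => x; rewrite derive1E; apply: derive_val.
have cF : continuous (fun x : R => c + x).
  by move=> x; apply: cvgD; [exact: cvg_cst|exact: cvg_id].
congr fine; rewrite (@integration_by_substitution_increasing _ (fun x => c + x) f)//.
- by apply: eq_integral => x _; rewrite F' /= mulr1.
- by move=> x y _ _; rewrite ltrD2l.
- by rewrite F' => x _; exact: cvg_cst.
- by rewrite F'; exact: is_cvg_cst.
- by rewrite F'; exact: is_cvg_cst.
- split.
  + by move=> x _; case: (dF x).
  + by apply: cvg_at_right_filter; exact: cF.
  + by apply: cvg_at_left_filter; exact: cF.
- exact: continuous_subspaceT.
Qed.

Lemma Int_indic a b a' b' f : nice f -> a <= a' -> b' <= b ->
  Int a b (fun x => f x * \1_(`[a', b']) x) = Int a' b' f.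
Proof.
move=> nf aa bb; rewrite /Int.
have -> : (fun x => f x * \1_(`[a', b']) x) = f \_ `[a', b'].
  apply/funext => x; rewrite patchE indicE; case: ifP => _; rewrite ?mulr1 ?mulr0//.
rewrite -Rintegral_mkcondr; congr (Rintegral _ _ _).
apply/seteqP; split => x /=; first by case.
rewrite !in_itv/= => /andP[x1 x2]; split; last by rewrite x1 x2.
by rewrite (le_trans aa x1) (le_trans x2 bb).
Qed.

Lemma nice_indic (A : set R) : measurable A -> nice (fun x => \1_A x).
Proof.
move=> mA; split; first exact: measurable_indic.
by exists 1 => x; rewrite indicE; case: (_ \in _); rewrite ?normr1 ?normr0.
Qed.

End Integrals.

(** * The modulus of a complex number *)

Section Modulus.
Context {R : realType}.
Implicit Types z w : R[i].

(** The modulus as an element of R; the norm of R[i] takes values in R[i]. *)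
Definition cabs z : R := complex.Re `|z|.

Lemma cabsE z : cabs z = Num.sqrt (complex.Re z ^+ 2 + complex.Im z ^+ 2).
Proof. by rewrite /cabs normc_def. Qed.

Lemma cabs_normr z : (cabs z)%:C = `|z|.
Proof. by rewrite cabsE normc_def. Qed.

Lemma cabs_ge0 z : 0 <= cabs z.
Proof. by rewrite cabsE sqrtr_ge0. Qed.

Lemma cabs_sqr z : cabs z ^+ 2 = complex.Re z ^+ 2 + complex.Im z ^+ 2.
Proof. by rewrite cabsE sqr_sqrtr// addr_ge0 ?sqr_ge0. Qed.

Lemma cabs0 : cabs 0 = 0. Proof. by rewrite /cabs normr0. Qed.

Lemma cabs1 : cabs 1 = 1. Proof. by rewrite /cabs normr1. Qed.

Lemma cabsX z m : cabs (z ^+ m) = cabs z ^+ m.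
Proof.
by apply: (@complexI R); rewrite rmorphXn/= !cabs_normr normrX.
Qed.

Lemma cabsN z : cabs (- z) = cabs z.
Proof. by rewrite /cabs normrN. Qed.

Lemma cabsB z w : cabs (z - w) = cabs (w - z).
Proof. by rewrite -cabsN opprB. Qed.

Lemma cabsM z w : cabs (z * w) = cabs z * cabs w.
Proof.
apply: (@complexI R).
by rewrite rmorphM/= !cabs_normr normrM.
Qed.

Lemma cabsD z w : cabs (z + w) <= cabs z + cabs w.
Proof.
by rewrite -lecR rmorphD/= !cabs_normr ler_normD.
Qed.

Lemma cabs_ge_sub z w : cabs z - cabs w <= cabs (z - w).
Proof. by rewrite lerBlDr (le_trans _ (cabsD _ _))// subrK. Qed.

Lemma cabs_real (x : R) : cabs x%:C = `|x|.
Proof. by rewrite cabsE /= expr0n/= addr0 sqrtr_sqr. Qed.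

Lemma cabs_sum (T : Type) (r : seq T) (P : pred T) (F : T -> R[i]) :
  cabs (\sum_(i <- r | P i) F i) <= \sum_(i <- r | P i) cabs (F i).
Proof.
elim/big_rec2: _ => [|i y1 y2 _ H]; first by rewrite cabs0.
by rewrite (le_trans (cabsD _ _))// lerD2l.
Qed.

Lemma Re_sum (T : Type) (r : seq T) (P : pred T) (F : T -> R[i]) :
  complex.Re (\sum_(i <- r | P i) F i) = \sum_(i <- r | P i) complex.Re (F i).
Proof. by elim/big_rec2: _ => [//|i y1 y2 _ <-]; case: (F i); case: y2. Qed.

Lemma Im_sum (T : Type) (r : seq T) (P : pred T) (F : T -> R[i]) :
  complex.Im (\sum_(i <- r | P i) F i) = \sum_(i <- r | P i) complex.Im (F i).
Proof. by elim/big_rec2: _ => [//|i y1 y2 _ <-]; case: (F i); case: y2. Qed.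

End Modulus.

(** * The exponential e *)

Section Exponential.
Context {R : realType}.
Implicit Types x y a : R.

Lemma eD x y : e (x + y) = e x * e y.
Proof.
rewrite /e mulrDr cosD sinD; apply/eqP; rewrite eq_complex/=.
by rewrite eqxx/= addrC eqxx.
Qed.

Lemma e0 : e (0 : R) = 1.
Proof. by rewrite /e mulr0 cos0 sin0. Qed.

Lemma cabs_e x : cabs (e x) = 1.
Proof. by rewrite cabsE /= cos2Dsin2 sqrtr1. Qed.

Lemma e_nat n : e (n%:R : R) = 1.
Proof.
elim: n => [|n IH]; first by rewrite e0.
rewrite -natr1 eD IH mul1r /e mulr1.
by rewrite mulr_natl cos2pi sin2pi.
Qed.

Lemma sin_le x : 0 <= x -> sin x <= x.
Proof.
rewrite le_eqVlt => /predU1P[<-|x0]; first by rewrite sin0.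
have [|c _] := @MVT_segment R sin cos 0 x (ltW x0).
  by apply: continuous_subspaceT; exact: continuous_sin.
rewrite sin0 !subr0 => ->.
by rewrite ger_pMl// cos_le1.
Qed.

Lemma norm_sin_le x : `|sin x| <= `|x|.
Proof.
wlog x0 : x / 0 <= x.
  move=> H; have [/H//|x0] := leP 0 x.
  by have := H (- x); rewrite sinN !normrN; apply; rewrite oppr_ge0 ltW.
rewrite [in X in _ <= X]ger0_norm// ler_norml sin_le// andbT.
have [x1|x1] := leP x 1; last by rewrite (le_trans _ (sin_geN1 x))// lerN2 ltW.
rewrite (@le_trans _ _ 0)// ?oppr_le0// sin_ge0_pi// x0 (le_trans x1)//.
by rewrite (le_trans _ (pi_ge2 R))// ler1n.
Qed.

Lemma pi_le4 : pi <= 4 :> R.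
Proof.
by have /andP[_] := (@pihalf_02 R); rewrite ltr_pdivrMr// -natrM => /ltW.
Qed.

(** The constant 8 is any bound for 2 pi, the Lipschitz constant of e. *)
Lemma cabs_e1 x : cabs (e x - 1) <= 8 * `|x|.
Proof.
rewrite -ler_sqr ?nnegrE ?cabs_ge0 ?mulr_ge0// cabs_sqr /=.
rewrite subr0 exprMn real_normK ?num_real//.
set t := 2 * pi * x.
have -> : (cos t - 1) ^+ 2 + sin t ^+ 2 = 4 * sin (pi * x) ^+ 2.
  have -> : t = (pi * x) *+ 2 by rewrite /t -mulrA mulr_natl.
  rewrite cos_mulr2n sin_mulr2n.
  have := cos2Dsin2 (pi * x); move: (cos _) (sin _) => c s H.
  have -> : (c * s *+ 2) ^+ 2 = 4 * c ^+ 2 * s ^+ 2 by ring.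
  have -> : c ^+ 2 = 1 - s ^+ 2 by rewrite -H addrK.
  by ring.
have : `|sin (pi * x)| ^+ 2 <= `|pi * x| ^+ 2 by rewrite ler_sqr ?nnegrE// norm_sin_le.
rewrite !real_normK ?num_real// => H.
rewrite (@le_trans _ _ (4 * (pi * x) ^+ 2))//; first by rewrite ler_pM2l.
rewrite exprMn mulrA ler_wpM2r ?sqr_ge0//.
have -> : 8 ^+ 2 = 4 * 4 ^+ 2 :> R by ring.
by rewrite ler_pM2l// ler_sqr ?nnegrE// ?pi_ge0// pi_le4.
Qed.

End Exponential.

(** * Trigonometric polynomials and Parseval *)

Section TrigPolynomials.
Context {R : realType}.
Implicit Types (a b : nat -> R) (x : R).

Definition tp (B : nat) a x : R[i] := \sum_(n < B) (a n)%:C * e (n%:R * x).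

Lemma eq_tp B a b x : (forall n, (n < B)%N -> a n = b n) -> tp B a x = tp B b x.
Proof. by move=> ab; apply: eq_bigr => n _; rewrite ab. Qed.

Lemma tpD B a b x : tp B (fun n => a n + b n) x = tp B a x + tp B b x.
Proof. by rewrite /tp -big_split/=; apply: eq_bigr => n _; rewrite rmorphD mulrDl. Qed.

Lemma tpB B a b x : tp B (fun n => a n - b n) x = tp B a x - tp B b x.
Proof. by rewrite /tp -sumrB; apply: eq_bigr => n _; rewrite rmorphB mulrBl. Qed.

Lemma tpZ B c a x : tp B (fun n => c * a n) x = c%:C * tp B a x.
Proof. by rewrite /tp mulr_sumr; apply: eq_bigr => n _; rewrite rmorphM mulrA. Qed.

Lemma tp_sum B (T : Type) (r : seq T) (P : pred T) (F : T -> nat -> R) x :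
  tp B (fun n => \sum_(i <- r | P i) F i n) x = \sum_(i <- r | P i) tp B (F i) x.
Proof.
rewrite /tp exchange_big/=; apply: eq_bigr => n _.
by rewrite rmorph_sum/= mulr_suml.
Qed.

Lemma tp_widen B B' a x : (B <= B')%N ->
  (forall n, (B <= n)%N -> a n = 0) -> tp B' a x = tp B a x.
Proof.
move=> BB a0; rewrite /tp (big_ord_widen _ (fun n => (a n)%:C * e (n%:R * x)) BB).
rewrite [RHS]big_mkcond/=; apply: eq_bigr => n _; case: ltnP => // Bn.
by rewrite a0// mul0r.
Qed.

Lemma cabs_tp_le B a x : cabs (tp B a x) <= \sum_(n < B) `|a n|.
Proof.
apply: le_trans (cabs_sum _ _ _) _; apply: ler_sum => n _.
by rewrite cabsM cabs_e mulr1 cabs_real.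
Qed.

Lemma Re_tp B a x :
  complex.Re (tp B a x) = \sum_(n < B) a n * cos (2 * pi * n%:R * x).
Proof. by rewrite Re_sum; apply: eq_bigr => n _ /=; rewrite mul0r subr0 !mulrA. Qed.

Lemma Im_tp B a x :
  complex.Im (tp B a x) = \sum_(n < B) a n * sin (2 * pi * n%:R * x).
Proof. by rewrite Im_sum; apply: eq_bigr => n _ /=; rewrite mul0r addr0 !mulrA. Qed.

Lemma continuous_mul_cst (c : R) : continuous (fun x : R => c * x).
Proof. by move=> x; apply: cvgM; [exact: cvg_cst|exact: cvg_id]. Qed.

Lemma continuous_sum_fun (f : nat -> R -> R) B :
  (forall n, continuous (f n)) -> continuous (fun x => \sum_(n < B) f n x).
Proof.
move=> cf; elim: B => [|B IH] x.
  by under eq_fun do rewrite big_ord0; exact: cvg_cst.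
under eq_fun do rewrite big_ord_recr.
by apply: cvgD; [exact: IH|exact: cf].
Qed.

Lemma continuous_cabs_tp B a : continuous (fun x => cabs (tp B a x)).
Proof.
pose F (g : R -> R) x := \sum_(n < B) a n * g (2 * pi * n%:R * x).
have cF g : continuous g -> continuous (F g).
  move=> cg; apply: (@continuous_sum_fun (fun n x => a n * g (2 * pi * n%:R * x))).
  move=> n y; apply: cvgM; first exact: cvg_cst.
  apply: (@continuous_comp _ _ _ (fun y : R => 2 * pi * n%:R * y) g).
    exact: continuous_mul_cst.
  exact: cg.
have -> : (fun x => cabs (tp B a x)) =
    Num.sqrt \o (fun x => F cos x * F cos x + F sin x * F sin x).
  by apply/funext => x; rewrite cabsE Re_tp Im_tp !expr2.
move=> x; apply: continuous_comp; last exact: sqrt_continuous.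
apply: cvgD; apply: cvgM; apply: cF; try exact: continuous_cos; exact: continuous_sin.
Qed.

Lemma nice_tp B a : nice (fun x => cabs (tp B a x)).
Proof.
apply: (@nice_continuous_bounded _ _ (\sum_(n < B) `|a n|)).
  exact: continuous_cabs_tp.
by move=> x; rewrite ger0_norm ?cabs_ge0// cabs_tp_le.
Qed.

Lemma nice_cos (c : R) : nice (fun x => cos (c * x)).
Proof.
apply: (@nice_continuous_bounded _ _ 1); last by move=> x; exact: cos_max.
by move=> x; apply: continuous_comp; [exact: continuous_mul_cst|exact: continuous_cos].
Qed.

Lemma sin_2pi_nat n : sin (2 * pi * n%:R) = 0 :> R.
Proof. by have /(congr1 (@complex.Im R)) := @e_nat R n. Qed.

Lemma Int_cos (m n : nat) :
  Int 0 1 (fun x => cos (2 * pi * m%:R * x - 2 * pi * n%:R * x)) = (m == n)%:R :> R.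
Proof.
have [->|mn] := eqVneq m n.
  under eq_Int do rewrite subrr cos0.
  by rewrite Int_cst// subr0 mulr1.
pose c : R := 2 * pi * m%:R - 2 * pi * n%:R.
have c0 : c != 0.
  rewrite /c -mulrBr mulf_neq0//; first by rewrite mulf_neq0// gt_eqF// pi_gt0.
  by rewrite subr_eq0 eqr_nat.
under eq_Int do rewrite -mulrBl.
rewrite -/c /Int /Rintegral.
have dF (x : R) : is_derive x 1 (fun x => c^-1 * sin (c * x)) (cos (c * x)).
  have H1 : is_derive x 1 (fun x : R => c * x) c.
    rewrite -[X in is_derive _ _ _ X]mulr1.
    exact: (is_deriveZ c (is_derive_id x 1)).
  have H2 : is_derive x 1 (sin \o (fun x : R => c * x)) (c * cos (c * x)).
    rewrite [c * _]mulrC; apply: is_derive1_comp.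
  have -> : cos (c * x) = c^-1 *: (c * cos (c * x)).
    by rewrite /GRing.scale/= mulrA mulVf// mul1r.
  exact: (is_deriveZ c^-1 H2).
have cF : continuous (fun x => c^-1 * sin (c * x)).
  move=> x; apply: cvgM; first exact: cvg_cst.
  by apply: continuous_comp; [exact: continuous_mul_cst|exact: continuous_sin].
rewrite (@continuous_FTC2 _ _ (fun x => c^-1 * sin (c * x)))//.
- rewrite /= !mulr0 sin0 mulr0 subr0 mulr1 /c sinB !sin_2pi_nat.
  by rewrite mul0r mulr0 subr0 mulr0.
- apply: continuous_subspaceT => x.
  by apply: continuous_comp; [exact: continuous_mul_cst|exact: continuous_cos].
- split.
  + by move=> x _; case: (dF x).
  + by apply: cvg_at_right_filter; exact: cF.
  + by apply: cvg_at_left_filter; exact: cF.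
- by move=> x _; rewrite derive1E; apply: derive_val.
Qed.

(** The real coefficients reduce the orthogonality of the exponentials to that
    of the cosines. *)
Lemma parseval B a :
  Int 0 1 (fun x => cabs (tp B a x) ^+ 2) = \sum_(n < B) a n ^+ 2.
Proof.
have E x : cabs (tp B a x) ^+ 2 = \sum_(m < B) \sum_(n < B)
    a m * a n * cos (2 * pi * m%:R * x - 2 * pi * n%:R * x).
  rewrite cabs_sqr Re_tp Im_tp !expr2 !mulr_suml -big_split/=.
  apply: eq_bigr => m _; rewrite !mulr_sumr -big_split/=.
  by apply: eq_bigr => n _; rewrite cosB; ring.
rewrite (eq_Int _ _ E) Int_sum; last first.
  move=> m _; apply: nice_sum => n _; apply: niceZ.
  by under eq_fun do rewrite -mulrBl; exact: nice_cos.
apply: eq_bigr => m _; rewrite Int_sum; last first.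
  by move=> n _; apply: niceZ; under eq_fun do rewrite -mulrBl; exact: nice_cos.
rewrite (bigD1 m)//= big1 ?addr0 => [|n nm]; rewrite IntZ ?Int_cos.
- by rewrite eqxx mulr1 expr2.
- by under eq_fun do rewrite -mulrBl; exact: nice_cos.
- by move: nm; rewrite -val_eqE eq_sym => /negbTE ->; rewrite mulr0.
- by under eq_fun do rewrite -mulrBl; exact: nice_cos.
Qed.

End TrigPolynomials.

(** * The Moebius function *)

Section Moebius.

(** The involution shows that the sum is its own opposite. *)
Lemma sum_involution (V : numDomainType) (T : finType) (P : pred T) (F : T -> V)
    (f : T -> T) :
  (forall i, P i -> [/\ P (f i), f (f i) = i & F (f i) = - F i]) ->
  \sum_(i | P i) F i = 0.
Proof.
move=> Hf.
have E : \sum_(i | P i) F i = - \sum_(i | P i) F i.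
  rewrite {1}(reindex_onto f f) => [|i Pi]; last by have [] := Hf _ Pi.
  rewrite -sumrN; apply: eq_big => [i|i].
    apply/andP/idP => [[Pfi /eqP ffi]|Pi].
      by have [] := Hf _ Pfi; rewrite ffi.
    by have [? -> _] := Hf _ Pi.
  move=> /andP[Pfi /eqP ffi].
  by have [_ _] := Hf _ Pfi; rewrite ffi => ->; rewrite opprK.
have /eqP : (\sum_(i | P i) F i) *+ 2 = 0 by rewrite mulr2n {1}E addNr.
by rewrite mulrn_eq0/= => /eqP.
Qed.

(** The support of the Moebius function, tested as in its definition. *)
Definition sqfree (d : nat) : bool :=
  (0 < d)%N && all (fun p => ~~ (p ^ 2 %| d)%N) (primes d).

Lemma moebiusE d : moebius d = if sqfree d then (-1) ^+ size (primes d) else 0.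
Proof. by []. Qed.

Lemma sqfreeP d : reflect ((0 < d)%N /\ forall p, prime p -> ~~ (p ^ 2 %| d)%N) (sqfree d).
Proof.
apply: (iffP andP) => -[d0 H]; split=> //.
- move=> p pp; apply/negP => pd.
  have : p \in primes d.
    by rewrite mem_primes pp d0 (dvdn_trans _ pd)// dvdn_exp.
  by move/(allP H); rewrite pd.
- by apply/allP => p; rewrite mem_primes => /and3P[pp _ _]; exact: H.
Qed.

Lemma sqfree_dvd d m : sqfree d -> (m %| d)%N -> sqfree m.
Proof.
move=> /sqfreeP[d0 H] md; apply/sqfreeP; split; first exact: dvdn_gt0 md.
by move=> p pp; apply/negP => pm; move: (H p pp); rewrite (dvdn_trans pm md).
Qed.

Lemma moebius_sqfree d : (moebius d != 0) = sqfree d.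
Proof. by rewrite moebiusE; case: ifP => _; rewrite ?eqxx// signr_eq0. Qed.

Lemma normr_moebius d : `|moebius d| = (sqfree d : nat)%:Z.
Proof. by rewrite moebiusE; case: ifP => _; rewrite ?normr0// normrX normrN1 expr1n. Qed.

Lemma normr_moebius_le1 d : `|moebius d| <= 1.
Proof. by rewrite normr_moebius; case: sqfree. Qed.

Lemma moebius1 : moebius 1 = 1.
Proof. by []. Qed.

Lemma sqfree_mul_prime p d : prime p -> ~~ (p %| d)%N -> sqfree (p * d) = sqfree d.
Proof.
move=> pp pd; apply/idP/idP => [H|/sqfreeP[d0 H]].
  by apply: sqfree_dvd H _; rewrite dvdn_mull.
apply/sqfreeP; split; first by rewrite muln_gt0 prime_gt0.
move=> q pq; have [->|qp] := eqVneq q p.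
  by rewrite expnS expn1 dvdn_pmul2l ?prime_gt0.
rewrite Gauss_dvdr ?H// coprime_pexpl//.
by rewrite prime_coprime// dvdn_prime2.
Qed.

Lemma moebius_mul_prime p d : prime p -> ~~ (p %| d)%N ->
  moebius (p * d) = - moebius d.
Proof.
move=> pp pd; rewrite !moebiusE sqfree_mul_prime//; case: ifPn => [/sqfreeP[d0 _]|_]; last by rewrite oppr0.
have -> : size (primes (p * d)) = (size (primes d)).+1.
  apply: (@perm_size _ _ (p :: primes d)).
  apply: uniq_perm; rewrite ?primes_uniq//=.
    by rewrite primes_uniq mem_primes pp (negbTE pd) !andbF.
  by move=> q; rewrite (primesM _ (prime_gt0 pp) d0) inE primes_prime// mem_seq1.
by rewrite exprS mulN1r.
Qed.

Lemma moebius_div_prime p d : prime p -> (p %| d)%N -> sqfree d ->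
  moebius (d %/ p) = - moebius d.
Proof.
move=> pp /dvdnP[c ->] sf; rewrite mulnK ?prime_gt0//.
rewrite [(c * p)%N]mulnC moebius_mul_prime ?opprK//.
apply/negP => pc; move/sqfreeP: sf => [_ /(_ p pp)].
by rewrite expnS expn1 dvdn_pmul2r ?prime_gt0// pc.
Qed.

(** On squarefree integers this is an involution that reverses the sign of the
    Moebius function; all cancellations below come from it. *)
Definition toggle (p d : nat) : nat := if (p %| d)%N then (d %/ p)%N else (p * d)%N.

Lemma toggleK p d : prime p -> sqfree d -> toggle p (toggle p d) = d.
Proof.
move=> pp sf; rewrite {2}/toggle; case: ifPn => pd; rewrite /toggle; last first.
  by rewrite ifT ?mulKn ?prime_gt0// dvdn_mulr.
rewrite ifN; first by rewrite mulnC divnK.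
case/dvdnP: pd sf => c ->; rewrite mulnK ?prime_gt0// => /sqfreeP[_ /(_ p pp)].
by rewrite expnS expn1 dvdn_pmul2r ?prime_gt0.
Qed.

Lemma moebius_toggle p d : prime p -> sqfree d -> moebius (toggle p d) = - moebius d.
Proof.
move=> pp sf; rewrite /toggle; case: ifPn => pd; first exact: moebius_div_prime.
exact: moebius_mul_prime.
Qed.

(** Moebius inversion: if p^k divides n, toggling p is a sign-reversing
    involution of the squarefree d with d^k dividing n; otherwise only d = 1
    occurs. *)
Lemma kfree_indic (R : numDomainType) k n : (0 < k)%N -> (0 < n)%N ->
  forall M, (n < M)%N ->
  \sum_(1 <= d < M | (d ^ k %| n)%N) (moebius d)%:~R = \1_(kfree k) n :> R.
Proof.
move=> k0 n0 M nM.
have leM d : (d ^ k %| n)%N -> (d < M)%N.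
  move=> dn; apply: leq_ltn_trans nM; apply: leq_trans (dvdn_leq n0 dn).
  by rewrite -[leqLHS]expn1; case: d {dn} => // d; rewrite leq_pexp2l.
rewrite indicE; have [kf|nkf] := boolP (n \in kfree k).
  rewrite -big_filter (big_rem 1%N)/=; last first.
    by rewrite mem_filter exp1n dvd1n mem_index_iota (leq_ltn_trans n0).
  rewrite big_seq big1 ?addr0// => d.
  rewrite rem_filter ?filter_uniq ?iota_uniq// mem_filter/= mem_filter mem_index_iota.
  move=> /and3P[d1 dn /andP[dgt _]].
  exfalso; have dgt1 : (1 < d)%N by rewrite ltn_neqAle eq_sym d1.
  move: kf; rewrite inE => /(_ (pdiv d) (pdiv_prime dgt1)).
  by rewrite (dvdn_trans _ dn)// dvdn_exp2r// pdiv_dvd.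
have [p pp pn] : exists2 p, prime p & (p ^ k %| n)%N.
  move: nkf; rewrite notin_setE /kfree/= => /existsNP[p] /not_implyP[pp /negP].
  by rewrite negbK; exists p.
rewrite big_mkcond/= (bigID sqfree)/= [X in _ + X]big1 ?addr0; last first.
  by move=> d /negbTE sf; rewrite moebiusE sf; case: ifP.
rewrite -big_mkcondl /= big_nat_cond big_add1 /= big_mkord => {k0}.
rewrite (eq_bigl (fun i : 'I_M.-1 => (i.+1 ^ k %| n)%N && sqfree i.+1)); last first.
  move=> i /=; have -> : (i.+1 < M)%N by have := ltn_ord i; lia.
  by rewrite ?andbT.
have tg d : (d ^ k %| n)%N -> sqfree d -> (toggle p d ^ k %| n)%N && sqfree (toggle p d).
  move=> dn sf; rewrite -moebius_sqfree moebius_toggle// oppr_eq0 moebius_sqfree sf andbT.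
  rewrite /toggle; case: ifPn => pd.
    by rewrite (dvdn_trans _ dn)// dvdn_exp2r// dvdn_div.
  rewrite expnMn Gauss_dvd ?pn ?dn//.
  by rewrite coprimeXl// coprimeXr// prime_coprime.
apply: (@sum_involution R _ _ _ (fun i : 'I_M.-1 => insubd i (toggle p i.+1).-1)).
move=> i /andP[dn sf].
have /andP[dn' sf'] := tg _ dn sf.
have t0 : (0 < toggle p i.+1)%N by case/andP: sf'.
have tM : ((toggle p i.+1).-1 < M.-1)%N by have := leM _ dn'; lia.
rewrite !val_insubd tM prednK// dn' sf'; split=> //.
  by apply: val_inj; rewrite /= !val_insubd tM prednK// toggleK//= ltn_ord.
by rewrite moebius_toggle// rmorphN.
Qed.

End Moebius.

(** * Counting multiples, squarefree numbers and common divisors *)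

Section Counting.
Context {R : realType}.

Lemma sum_mult_nat q a b : (0 < q)%N ->
  (\sum_(n < b.+1) ((a < n) && (q %| n)) = b %/ q - a %/ q)%N.
Proof.
move=> q0; elim: b => [|b IH].
  by rewrite big_ord_recl big_ord0 ltn0/= div0n sub0n.
rewrite big_ord_recr/= IH divnS//.
case: (ltnP a b.+1) => ab /=.
  have := leq_div2r q ab; rewrite divnS//; case: (q %| b.+1)%N; have := @leq_div2r q a b; lia.
by have := leq_div2r q ab; rewrite divnS//; case: (q %| b.+1)%N; lia.
Qed.

Lemma natr_div_le (m q : nat) (B : R) : 0 <= B -> (m <= Num.truncn B)%N -> (0 < q)%N ->
  (m %/ q)%:R <= B / q%:R.
Proof.
move=> B0 mB q0; rewrite ler_pdivlMr ?ltr0n// -natrM.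
have /andP[+ _] := truncn_itv B0; apply: le_trans.
by rewrite ler_nat (leq_trans (leq_divM _ _)).
Qed.

Lemma natr_div_gt (q : nat) (B : R) : 0 <= B -> (0 < q)%N ->
  B / q%:R - 1 < (Num.truncn B %/ q)%:R.
Proof.
move=> B0 q0; rewrite ltrBlDr ltr_pdivrMr ?ltr0n// natr1 -natrM.
have /andP[_] := truncn_itv B0; move/lt_le_trans; apply.
by rewrite ler_nat -ltn_divLR.
Qed.

Lemma itv_truncn (A B : R) n : 0 <= A -> A <= B ->
  (A < n%:R <= B) = ((Num.truncn A < n) && (n <= Num.truncn B))%N.
Proof.
move=> A0 AB.
by rewrite truncn_lt_nat// truncn_ge_nat// (le_trans A0 AB).
Qed.

(** The bound b only makes the sum finite; the value no longer depends on it
    once b exceeds B. *)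
Definition nmult (q : nat) (A B : R) (b : nat) : R :=
  \sum_(n < b) ((A < n%:R <= B) && (q %| n)%N)%:R.

Lemma nmult_full q (A B : R) b : (0 < q)%N -> 0 <= A -> A <= B ->
  nmult q A B b <= ((Num.truncn B %/ q) - (Num.truncn A %/ q))%N%:R /\
  (B < b%:R -> nmult q A B b = ((Num.truncn B %/ q) - (Num.truncn A %/ q))%N%:R).
Proof.
move=> q0 A0 AB; set c := Num.truncn B.
have E m : nmult q A B (c.+1 + m) = nmult q A B c.+1.
  elim: m => [|m IH]; first by rewrite addn0.
  rewrite addnS /nmult big_ord_recr/= -/(nmult _ _ _ _) IH.
  by rewrite itv_truncn// -/c [(_ <= c)%N]leqNgt ltnS leq_addr !andbF addr0.
have M m1 m2 : (m1 <= m2)%N -> nmult q A B m1 <= nmult q A B m2.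
  move=> m12; rewrite /nmult (big_ord_widen _ (fun n => ((A < n%:R <= B) && (q %| n)%N)%:R) m12).
  by rewrite big_mkcond/=; apply: ler_sum => i _; case: ifP.
have V : nmult q A B c.+1 = (c %/ q - Num.truncn A %/ q)%N%:R.
  rewrite -sum_mult_nat// natr_sum; apply: eq_bigr => n _.
  rewrite itv_truncn// -/c.
  by have -> : (n <= c)%N; [have := ltn_ord n; rewrite ltnS|rewrite andbT].
split; last first.
  move=> Bb; have cb : (c < b)%N by rewrite truncn_lt_nat// (le_trans A0).
  by rewrite -(subnKC cb) E.
rewrite -V -(E b); apply: M; exact: leq_addl.
Qed.

Lemma nmult_le q (A B : R) b : (0 < q)%N -> 0 <= A -> A <= B ->
  nmult q A B b <= (B - A) / q%:R + 1.
Proof.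
move=> q0 A0 AB; have B0 := le_trans A0 AB.
have [/le_trans H _] := nmult_full b q0 A0 AB; apply: H.
rewrite natrB; last by rewrite leq_div2r// le_truncn.
have := natr_div_gt A0 q0; have := natr_div_le B0 (leqnn _) q0.
by rewrite mulrBl; lra.
Qed.

Lemma nmult_ge q (A B : R) b : (0 < q)%N -> 0 <= A -> A <= B -> B < b%:R ->
  (B - A) / q%:R - 1 <= nmult q A B b.
Proof.
move=> q0 A0 AB Bb; have B0 := le_trans A0 AB.
have [_ ->//] := nmult_full b q0 A0 AB.
rewrite natrB; last by rewrite leq_div2r// le_truncn.
have := natr_div_gt B0 q0; have := natr_div_le A0 (leqnn _) q0.
by rewrite mulrBl; lra.
Qed.

(** 1/4 plus the telescoping majorant of the terms from 3 on, which is 1/2. *)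
Lemma sum_inv_sqr M : \sum_(2 <= m < M) (m%:R ^- 2) <= 3 / 4 :> R.
Proof.
have [M3|M3] := ltnP M 3.
  by rewrite big_geq// divr_ge0.
(* The subtracted term makes the induction work, as 1/m^2 < 1/(m-1) - 1/m. *)
have : \sum_(2 <= m < M) (m%:R ^- 2) <= 3 / 4 - (M.-1)%:R^-1 :> R; last first.
  by move/le_trans; apply; rewrite gerBl invr_ge0.
rewrite -(subnKC M3); elim: (M - 3)%N => [|m IH].
  by rewrite addn0 big_nat1 /=; lra.
rewrite addnS big_nat_recr//= (le_trans (lerD IH (lexx _)))//.
rewrite addSn/=; set x : R := (2 + m)%:R.
have x0 : 0 < x by rewrite ltr0n.
have -> : (3 + m)%:R = x + 1 by rewrite natr1.
have x1 : x != 0 by rewrite gt_eqF.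
have x2 : x + 1 != 0 by rewrite gt_eqF// addr_gt0.
rewrite -subr_ge0.
have -> : 3 / 4 - (x + 1)^-1 - (3 / 4 - x^-1 + (x + 1) ^- 2) = (x * (x + 1) ^+ 2)^-1.
  by clearbody x; field; rewrite x1 x2.
by rewrite invr_ge0 mulr_ge0// ?sqr_ge0// ltW.
Qed.

Lemma sum_inv_pow k M : (2 <= k)%N -> \sum_(2 <= m < M) (m%:R ^- k) <= 3 / 4 :> R.
Proof.
move=> k2; apply: le_trans (sum_inv_sqr M); apply: ler_sum_nat => m /andP[m2 _].
rewrite lef_pV2 ?posrE ?exprn_gt0 ?ltr0n ?(leq_trans _ m2)//.
by rewrite ler_weXn2l// ler1n (leq_trans _ m2).
Qed.

(** Removing the multiples of the squares m^2 leaves a proportion at least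
    1 - 3/4, and the rounding errors, one for each m <= sqrt(2y), are below
    y / 10 for y >= 200. *)
Lemma sqfree_count (y : R) b : 200 <= y -> 2 * y < b%:R ->
  y / 8 <= \sum_(n < b) ((y < n%:R <= 2 * y) && sqfree n)%:R.
Proof.
move=> y200 yb.
have y0 : 0 <= y by lra.
set M := (Num.truncn (Num.sqrt (2 * y))).+1.
have H1 : nmult 1 y (2 * y) b - \sum_(2 <= m < M) nmult (m ^ 2) y (2 * y) b <=
    \sum_(n < b) ((y < n%:R <= 2 * y) && sqfree n)%:R.
  rewrite lerBlDr /nmult exchange_big/= -big_split/=; apply: ler_sum => n _.
  rewrite dvd1n andbT; have [yn|_] := boolP (y < n%:R <= 2 * y); last first.
    by rewrite add0r sumr_ge0.
  rewrite /=; have [sf|nsf] := boolP (sqfree n).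
    by rewrite lerDl sumr_ge0.
  rewrite add0r.
  have n0 : (0 < n)%N by rewrite -(ltr0n R); case/andP: yn => + _; apply: le_lt_trans.
  have [p pp pn] : exists2 p, prime p & (p ^ 2 %| n)%N.
    apply: contrapT => H; move/negP: nsf; apply; apply/sqfreeP; split=> // p pp.
    by apply/negP => pn; apply: H; exists p.
  have pM : (2 <= p < M)%N.
    rewrite prime_gt1// ltnS truncn_ge_nat ?sqrtr_ge0//.
    rewrite -ler_sqr ?nnegrE ?sqrtr_ge0// sqr_sqrtr; last by lra.
    by case/andP: yn => _; apply: le_trans; rewrite -natrX ler_nat dvdn_leq.
  rewrite (bigD1_seq p)/= ?mem_index_iota ?iota_uniq//.
  by rewrite pn lerDl sumr_ge0.
apply: le_trans H1.
have y2 : y <= 2 * y by lra.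
have := nmult_ge (q := 1) isT y0 y2 yb.
have H2 : \sum_(2 <= m < M) nmult (m ^ 2) y (2 * y) b <= y * (3 / 4) + y / 10.
  apply: (@le_trans _ _ (\sum_(2 <= m < M) (y * m%:R ^- 2 + 1))).
    apply: ler_sum_nat => m /andP[m2 _].
    apply: le_trans (nmult_le _ _ y0 y2) _; first by rewrite expn_gt0 (leq_trans _ m2).
    by rewrite natrX; have -> : 2 * y - y = y by lra.
  rewrite big_split/= -mulr_sumr lerD// ?ler_wpM2l ?sum_inv_sqr//.
  rewrite sumr_const_nat.
  have /andP[+ _] := truncn_itv (sqrtr_ge0 (2 * y)).
  set t := Num.truncn _ => tle; apply: (@le_trans _ _ t%:R).
    by rewrite -mulr_natl mulr1 ler_nat /M -/t; lia.
  apply: le_trans tle _; rewrite -ler_sqr ?nnegrE ?sqrtr_ge0 ?divr_ge0//.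
  rewrite sqr_sqrtr; last by lra.
  nra.
move: H2; rewrite divr1; lra.
Qed.

(** A power of a common divisor is at most the sum over all common divisors g,
    and at most (D/g)^2 pairs are divisible by g. *)
Lemma sum_gcd_pow k D : (2 <= k)%N ->
  (\sum_(1 <= d < D.+1) \sum_(1 <= d' < D.+1) gcdn d d' ^ k <= D ^ k.+1)%N.
Proof.
move=> k2.
have H : (\sum_(1 <= d < D.+1) \sum_(1 <= d' < D.+1) gcdn d d' ^ k <=
   \sum_(1 <= d < D.+1) \sum_(1 <= d' < D.+1) \sum_(1 <= g < D.+1)
     g ^ k * ((g %| d) * (g %| d')))%N.
  rewrite !big_nat; apply: leq_sum => d /andP[d0 dD].
  rewrite !big_nat; apply: leq_sum => d' /andP[d'0 d'D].
  rewrite (bigD1_seq (gcdn d d')) ?iota_uniq//=; last first.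
    rewrite mem_index_iota gcdn_gt0 d0/= ltnS (leq_trans (dvdn_leq d0 (dvdn_gcdl _ _)))//.
  by rewrite dvdn_gcdl dvdn_gcdr !muln1 leq_addr.
apply: leq_trans H _.
under eq_bigr do rewrite exchange_big/=.
rewrite exchange_big/=.
have -> : (D ^ k.+1 = \sum_(1 <= g < D.+1) D ^ k)%N.
  by rewrite sum_nat_const_nat subSS subn0 expnS.
rewrite !big_nat; apply: leq_sum => g /andP[g0 gD].
under eq_bigr do rewrite -big_distrr/= -big_distrr/=.
rewrite -big_distrr/= -big_distrl/=.
have -> : (\sum_(1 <= d < D.+1) (g %| d) = D %/ g)%N.
  rewrite -[RHS]subn0 -[X in (_ - X)%N](div0n g) -sum_mult_nat//.
  rewrite -(big_mkord xpredT (fun n : nat => ((0 < n) && (g %| n)) : nat))%N.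
  rewrite [RHS]big_ltn//= add0n.
  by rewrite [LHS]big_nat [RHS]big_nat; apply: eq_bigr => n /andP[-> _].
rewrite -(subnKC k2); set c := (D %/ g)%N.
have -> : (g ^ (2 + (k - 2)) * (c * c) = (c * g) ^ 2 * g ^ (k - 2))%N.
  by rewrite expnD expnMn mulnn mulnAC [(g ^ 2 * _)%N]mulnC.
rewrite expnD leq_mul//; first by rewrite leq_sqr leq_divM.
by case: (k - 2)%N => // j; rewrite leq_exp2r.
Qed.

End Counting.

Lemma gcdnX k a b : (0 < a)%N -> (gcdn a b ^ k = gcdn (a ^ k) (b ^ k))%N.
Proof.
move=> a0; have g0 : (0 < gcdn a b)%N by rewrite gcdn_gt0 a0.
have [/dvdnP[u ua] /dvdnP[v vb]] := (dvdn_gcdl a b, dvdn_gcdr a b).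
have uv : coprime u v.
  by rewrite /coprime -(eqn_pmul2r g0) muln_gcdl -ua -vb mul1n.
have -> : (a ^ k = u ^ k * gcdn a b ^ k)%N by rewrite -expnMn -ua.
have -> : (b ^ k = v ^ k * gcdn a b ^ k)%N by rewrite -expnMn -vb.
rewrite -muln_gcdl; have -> : gcdn (u ^ k) (v ^ k) = 1%N.
  by apply/eqP/coprimeXl/coprimeXr.
by rewrite mul1n.
Qed.

(** A squarefree d has only prime primary components. *)
Lemma sqfree_prime_dvd d m : (0 < m)%N -> sqfree d -> ~~ (d %| m)%N ->
  exists p, [/\ prime p, (p %| d)%N & ~~ (p %| m)%N].
Proof.
move=> m0 sf dm; have /sqfreeP[d0 Hd] := sf.
apply: contrapT => H; move/negP: dm; apply; apply/dvdn_partP => // p.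
rewrite mem_primes => /and3P[pp _ pd].
have -> : (d`_p = p)%N.
  rewrite p_part; have : (logn p d < 2)%N by rewrite ltnNge -pfactor_dvdn// Hd.
  have : (0 < logn p d)%N by rewrite logn_gt0 mem_primes pp d0.
  by case: logn => // -[|//] _ _; rewrite expn1.
by apply: contrapT => /negP pm; apply: H; exists p.
Qed.

(** * Mean squares over dyadic blocks of divisors *)

Section BlockSums.
Context {R : realType}.

(** A nonnegative majorant for the contribution of the divisors in ]D/2, D]. *)
Definition blk (k : nat) (D : R) (n : nat) : R :=
  \sum_(1 <= d < (Num.truncn D).+1 | D / 2 < d%:R) (d ^ k %| n)%:R.

Lemma card_le_real (D : R) : 0 <= D -> (Num.truncn D)%:R <= D.
Proof. by move=> D0; have /andP[] := truncn_itv D0. Qed.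

(** Expanding the square counts the multiples of lcm(d^k, d'^k), which is at
    least (D/2)^(2k) / gcd(d, d')^k; the sum of the gcd^k is [sum_gcd_pow], and
    the at most D^2 rounding errors are absorbed by the hypothesis on L. *)
Lemma block_L2 k (D A L : R) b : (2 <= k)%N -> 1 <= D -> D ^+ k.+1 <= L -> 0 <= A ->
  \sum_(n < b) (A < n%:R <= A + L)%R%:R * blk k D n ^+ 2 <= (4 ^+ k + 1) * (L * D / D ^+ k).
Proof.
move=> k2 D1 DL A0.
have D0 : 0 < D by lra.
have Dk : 0 < D ^+ k by rewrite exprn_gt0.
have L0 : 0 <= L by rewrite (le_trans _ DL)// exprn_ge0// ltW.
set T := (Num.truncn D).+1.
have -> : \sum_(n < b) (A < n%:R <= A + L)%R%:R * blk k D n ^+ 2 =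
    \sum_(1 <= d < T | D / 2 < d%:R) \sum_(1 <= d' < T | D / 2 < d'%:R)
      nmult (lcmn (d ^ k) (d' ^ k)) A (A + L) b.
  under eq_bigr do rewrite /blk expr2 mulr_suml mulr_sumr.
  rewrite exchange_big/=; apply: eq_bigr => d _.
  under eq_bigr do rewrite mulr_sumr mulr_sumr.
  rewrite exchange_big/=; apply: eq_bigr => d' _.
  rewrite /nmult; apply: eq_bigr => n _.
  by rewrite dvdn_lcm -!natrM !mulnb.
apply: (@le_trans _ _ (\sum_(1 <= d < T) \sum_(1 <= d' < T)
    (L * 4 ^+ k / D ^+ (2 * k) * (gcdn d d' ^ k)%:R + 1))).
  rewrite big_mkcond/= ![X in X <= _]big_nat [X in _ <= X]big_nat.
  apply: ler_sum => d /andP[d0 dT].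
  have S0 d' : 0 <= L * 4 ^+ k / D ^+ (2 * k) * (gcdn d d' ^ k)%:R + 1 :> R.
    by rewrite addr_ge0// mulr_ge0// divr_ge0 ?mulr_ge0 ?exprn_ge0// ltW.
  case: ifP => Dd; last by rewrite sumr_ge0.
  rewrite big_mkcond/= ![X in X <= _]big_nat [X in _ <= X]big_nat.
  apply: ler_sum => d' /andP[d'0 d'T]; case: ifP => Dd'; last exact: S0.
  have l0 : (0 < lcmn (d ^ k) (d' ^ k))%N by rewrite lcmn_gt0 !expn_gt0 d0 d'0.
  apply: le_trans (nmult_le _ l0 A0 _) _; first by rewrite lerDl.
  rewrite addrAC subrr add0r lerD2r -!mulrA ler_wpM2l//.
  rewrite -[X in X <= _]mul1r ler_pdivrMr ?ltr0n//.
  have E : (gcdn d d' ^ k * lcmn (d ^ k) (d' ^ k) = (d * d') ^ k)%N.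
    have -> : (gcdn d d' ^ k = gcdn (d ^ k) (d' ^ k))%N.
      by rewrite gcdnX.
    by rewrite mulnC muln_lcm_gcd expnMn.
  rewrite -!mulrA -natrM E natrX natrM mulrA.
  rewrite mulrAC ler_pdivlMr ?exprn_gt0// mul1r exprM -exprMn.
  rewrite lerXn2r ?nnegrE ?mulr_ge0 ?exprn_ge0//; try exact: ltW.
  have -> : D ^+ 2 = 4 * ((D / 2) * (D / 2)) by field.
  by rewrite ler_pM2l// ler_pM ?divr_ge0// ltW.
have DD : T.-1%:R <= D by apply: card_le_real; exact: ltW.
under eq_bigr do rewrite big_split/= -mulr_sumr.
rewrite big_split/= -mulr_sumr.
rewrite mulrDl mul1r lerD//; last first.
  rewrite !sumr_const_nat subSS subn0 -/T.-1.
  rewrite -mulr_natr ler_pdivlMr//.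
  apply: (@le_trans _ _ (D * D * D ^+ k)).
    by rewrite ler_wpM2r ?(ltW Dk)// ler_pM.
  rewrite mulrAC -exprS ler_wpM2r//; exact: ltW.
have G : \sum_(1 <= d < T) \sum_(1 <= d' < T) (gcdn d d' ^ k)%:R <= D ^+ k.+1 :> R.
  have := sum_gcd_pow (Num.truncn D) k2; rewrite -/T -(ler_nat R) => H.
  apply: (@le_trans _ _ ((Num.truncn D) ^ k.+1)%:R).
    by apply: le_trans H; rewrite natr_sum; apply: ler_sum => d _; rewrite natr_sum.
  by rewrite natrX lerXn2r ?nnegrE// ltW.
rewrite (le_trans (ler_wpM2l _ G))//.
  by rewrite divr_ge0 ?mulr_ge0 ?exprn_ge0// ltW.
rewrite le_eqVlt; apply/orP; left; apply/eqP.
by rewrite mul2n -addnn exprD exprS; field; rewrite gt_eqF.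
Qed.

End BlockSums.

(** * Ramanujan sums adapted to kth powers *)

Section RamanujanSums.
Context {R : realType}.

Lemma e_eq1 (t : R) : 0 < t < 1 -> e t != 1.
Proof.
move=> /andP[t0 t1]; apply/eqP => /(congr1 (@complex.Re R))/=.
have -> : 2 * pi * t = (pi * t) *+ 2 by rewrite -mulrA mulr_natl.
rewrite cos_mulr2n cos2sin2.
have : 0 < sin (pi * t).
  by rewrite sin_gt0_pi// mulr_gt0 ?pi_gt0//= gtr_pMr ?pi_gt0.
move: (sin _) => s s0; have : 0 < s ^+ 2 by rewrite exprn_gt0.
rewrite mulr2n; lra.
Qed.

Lemma eX (t : R) m : e (m%:R * t) = e t ^+ m.
Proof.
elim: m => [|m IH]; first by rewrite mul0r e0 expr0.
by rewrite -natr1 mulrDl mul1r eD IH exprSr.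
Qed.

(** Orthogonality of the additive characters modulo q. *)
Lemma sum_e_mod (q n : nat) : (0 < q)%N ->
  \sum_(a < q) e (n%:R * (a%:R / q%:R) : R) = (q%:R * (q %| n)%:R)%:C.
Proof.
move=> q0; have q0' : q%:R != 0 :> R by rewrite pnatr_eq0 -lt0n.
have E (a : nat) : e (n%:R * (a%:R / q%:R) : R) = e (n%:R / q%:R : R) ^+ a.
  by rewrite -eX; congr e; field.
under eq_bigr do rewrite E.
case: (boolP (q %| n)%N) => [/dvdnP[c ->]|qn].
  rewrite natrM mulfK// e_nat; under eq_bigr do rewrite expr1n.
  by rewrite sumr_const card_ord mulr1 rmorph_nat.
rewrite mulr0; apply/eqP; rewrite -(mulrI_eq0 _ (x := e (n%:R / q%:R : R) - 1)).
  by rewrite -subrX1 -eX mulrCA mulfV// mulr1 e_nat subrr.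
apply/lregP; rewrite subr_eq0 {1}(divn_eq n q) natrD natrM mulrDl mulfK// eD e_nat mul1r.
apply: e_eq1; rewrite divr_gt0 ?ltr0n//= ?lt0n//.
by rewrite ltr_pdivrMr ?ltr0n// mul1r ltr_nat ltn_mod.
Qed.

Lemma sum_dvd_reindex (V : nmodType) (q r : nat) (F : nat -> V) : (0 < q)%N ->
  \sum_(a < q * r | (q %| a)%N) F a = \sum_(a < r) F (q * a)%N.
Proof.
move=> q0; elim: r => [|r IH]; first by rewrite muln0 !big_ord0.
rewrite [RHS]big_ord_recr/= -IH.
rewrite -(big_mkord (fun a => q %| a)%N) -[X in _ = X + _](big_mkord (fun a => q %| a)%N).
rewrite (@big_cat_nat _ _ _ (q * r))//=; last by rewrite leq_mul2l leqnSn orbT.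
congr (_ + _).
rewrite big_ltn_cond ?dvdn_mulr//; last by rewrite ltn_pmul2l.
rewrite big1_seq ?addr0// => i /andP[/dvdnP[c ->]]; rewrite mem_index_iota [(c * q)%N]mulnC.
by rewrite !ltn_pmul2l// => /andP[]; lia.
Qed.

(** Moebius inversion over the common divisors b^k of a and d^k turns the
    left-hand side into complete character sums modulo (d / b)^k. *)
Lemma kfree_ramanujan k d n : (2 <= k)%N -> (0 < d)%N ->
  \sum_(a < d ^ k) (\1_(kfree k) (gcdn a (d ^ k)) : R)%:C * e (n%:R * (a%:R / (d ^ k)%:R)) =
  (\sum_(b < d.+1 | (b %| d)%N) (moebius (d %/ b))%:~R * (b ^ k)%:R * (b ^ k %| n)%:R)%:C.
Proof.
move=> k2 d0; have k0 : (0 < k)%N by lia.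
have dk0 : (0 < d ^ k)%N by rewrite expn_gt0 d0.
have E1 (a : 'I_(d ^ k)) : \1_(kfree k) (gcdn a (d ^ k)) =
    \sum_(b < d.+1 | (b %| d)%N) (moebius b)%:~R * (b ^ k %| a)%:R :> R.
  have g0 : (0 < gcdn a (d ^ k))%N by rewrite gcdn_gt0 dk0 orbT.
  rewrite -(kfree_indic R k0 g0 (M := (d ^ k).+1)); last first.
    by rewrite ltnS dvdn_leq// dvdn_gcdr.
  rewrite -(big_mkord (fun b => b %| d)%N (fun b => (moebius b)%:~R * (b ^ k %| a)%:R)).
  rewrite [RHS]big_ltn_cond// dvd0n gtn_eqF//.
  rewrite (@big_cat_nat _ _ _ d.+1)//=; last first.
    by rewrite ltnS -[leqLHS]expn1; case: (d) d0 => // m _; rewrite leq_pexp2l.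
  rewrite [X in _ + X]big1_seq ?addr0; last first.
    move=> b; rewrite dvdn_gcd dvdn_pexp2r// mem_index_iota => /andP[/andP[_ bd]].
    by have := dvdn_leq d0 bd; lia.
  rewrite big_mkcond [RHS]big_mkcond; apply: eq_bigr => b _.
  rewrite dvdn_gcd dvdn_pexp2r// andbC; case: (b %| d)%N => //=.
  by case: (b ^ k %| a)%N; rewrite ?mulr1 ?mulr0.
under eq_bigr do rewrite E1 rmorph_sum/= mulr_suml.
rewrite exchange_big/= rmorph_sum/=.
pose h (b : 'I_d.+1) : 'I_d.+1 := inord (d %/ b).
have hE (b : 'I_d.+1) : h b = (d %/ b)%N :> nat.
  by rewrite inordK// ltnS leq_div.
rewrite [RHS](reindex_onto h h)/=; last first.
  by move=> b bd; apply: val_inj; rewrite /= !hE divnA// mulKn.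
apply: eq_big => b.
  apply/idP/andP => [bd|[]].
    rewrite hE dvdn_div//; split=> //; apply/eqP/val_inj.
    by rewrite /= !hE divnA// mulKn.
  by rewrite hE => bd /eqP/(congr1 val)/=; rewrite !hE => <-; exact: dvdn_div.
move=> bd; rewrite hE divnA// mulKn//.
have b0 : (0 < b)%N by apply: dvdn_gt0 bd.
have dE : (d ^ k = b ^ k * (d %/ b) ^ k)%N by rewrite -expnMn mulnC divnK.
have bk0 : (b ^ k)%:R != 0 :> R by rewrite pnatr_eq0 -lt0n expn_gt0 b0.
have c0 : (0 < (d %/ b) ^ k)%N by rewrite expn_gt0 divn_gt0// dvdn_leq.
rewrite -mulrA rmorphM/= -sum_e_mod// mulr_sumr.
pose F (a : nat) : R[i] := ((moebius b)%:~R : R)%:C * e (n%:R * (a%:R / (d ^ k)%:R) : R).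
transitivity (\sum_(a < d ^ k | (b ^ k %| a)%N) F a).
  rewrite [RHS]big_mkcond/=; apply: eq_bigr => a _; rewrite /F.
  by case: (b ^ k %| a)%N; rewrite ?mulr1// mulr0 mul0r.
rewrite [in X in X = _]dE sum_dvd_reindex ?expn_gt0 ?b0//.
apply: eq_bigr => a _; rewrite /F; congr (_ * e (_ * _)).
have ck0 : ((d %/ b) ^ k)%:R != 0 :> R by rewrite pnatr_eq0 -lt0n.
by rewrite dE !natrM; field; rewrite bk0 ck0.
Qed.

(** Toggling a prime p that divides d but not m changes the sign of
    moebius (d / b) and leaves gcd(b, m) unchanged. *)
Lemma sum_moebius_gcd k d m : sqfree d -> ~~ (d %| m)%N ->
  \sum_(b < d.+1 | (b %| d)%N) (moebius (d %/ b))%:~R * (gcdn b m ^ k)%:R = 0 :> R.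
Proof.
move=> sf dm; have /sqfreeP[d0 Hd] := sf.
have m0 : (0 < m)%N by move: dm; case: (m) => //; rewrite dvdn0.
have [p [pp pd pm]] := sqfree_prime_dvd m0 sf dm.
apply: (@sum_involution R _ _ _ (fun b : 'I_d.+1 => inord (toggle p b))).
move=> b bd; have b0 : (0 < b)%N by apply: dvdn_gt0 bd.
have sb : sqfree b by apply: sqfree_dvd sf bd.
have td : (toggle p b %| d)%N.
  rewrite /toggle; case: ifPn => pb; first by rewrite (dvdn_trans _ bd)// dvdn_div.
  by rewrite Gauss_dvd ?pd ?bd// prime_coprime.
have tE : (inord (toggle p b) : 'I_d.+1) = toggle p b :> nat.
  by rewrite inordK// ltnS dvdn_leq.
rewrite tE; split=> //.
  by apply: val_inj; rewrite /= toggleK// inordK.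
have sdb : sqfree (d %/ b) by apply: sqfree_dvd sf _; rewrite dvdn_div.
move: sdb bd b0 sb td; clear tE; move: (nat_of_ord b) => {}b sdb bd b0 sb td.
have [c dE] : exists c, d = (b * c)%N by exists (d %/ b)%N; rewrite mulnC divnK.
have dbE : (d %/ b = c)%N by rewrite dE mulKn.
have pc0 := prime_gt0 pp.
have mp : coprime m p by rewrite coprime_sym prime_coprime.
have -> : (d %/ toggle p b = toggle p (d %/ b))%N.
  rewrite dbE /toggle; case: ifPn => pb.
    have [b' bE] := dvdnP pb.
    have pc : ~~ (p %| c)%N.
      apply/negP => /dvdnP[c' cE]; move: (Hd p pp).
      by rewrite dE bE cE mulnACA mulnn dvdn_mull.
    rewrite (negbTE pc) dE bE mulnK// -mulnA mulKn//.
    by move: b0; rewrite bE muln_gt0 => /andP[].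
  have pc : (p %| c)%N by move: pd; rewrite dE Euclid_dvdM// (negbTE pb).
  by rewrite pc [(p * b)%N]mulnC divnMA dbE.
rewrite moebius_toggle// rmorphN/= mulNr; congr (- (_ * (_ ^ _)%:R)).
rewrite /toggle; case: ifPn => pb; rewrite gcdnC [RHS]gcdnC.
  by have [b' ->] := dvdnP pb; rewrite mulnK// Gauss_gcdl.
by rewrite Gauss_gcdr.
Qed.

End RamanujanSums.

(** * Inequalities between powers *)

Section Powers.
Context {R : realType}.
Implicit Types x y s t : R.

Lemma powRDgt x s t : 0 < x -> x `^ (s + t) = x `^ s * x `^ t.
Proof. by move=> x0; rewrite powRD//; apply/implyP => _; rewrite gt_eqF. Qed.

Lemma powRBgt x s t : 0 < x -> x `^ (s - t) = x `^ s / x `^ t.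
Proof. by move=> x0; rewrite powRDgt// powRN. Qed.

(** A pointwise substitute for Hoelder's inequality: the first term dominates
    for x <= l, the second one for x > l. *)
Lemma powR_interp x (l p s q : R) : 0 <= x -> 0 < l -> 0 <= p -> p <= s -> s <= q ->
  x `^ s <= l `^ (s - p) * x `^ p + l `^ (s - q) * x `^ q.
Proof.
move=> x0 l0 p0 ps sq; have s0 := le_trans p0 ps.
have nn (a b c : R) : 0 <= l `^ a * c `^ b by rewrite mulr_ge0 ?powR_ge0.
have [->|xn0] := eqVneq x 0.
  have [s00|sn0] := eqVneq s 0; last by rewrite powR0// addr_ge0.
  have -> : p = 0 by apply/eqP; rewrite eq_le p0 andbT -s00.
  by rewrite s00 subrr !powRr0 mulr1 ler_wpDr// nn.
have xp : 0 < x by rewrite lt_neqAle eq_sym xn0.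
have [xl|lx] := leP x l.
  rewrite ler_wpDr// -{1}(subrK p s) (powRDgt _ _ xp).
  by rewrite ler_wpM2r ?powR_ge0// ge0_ler_powR ?subr_ge0 ?nnegrE// ltW.
rewrite ler_wpDl// -{1}(subrK q s) (powRDgt _ _ xp).
rewrite ler_wpM2r ?powR_ge0// -opprB !powRN lef_pV2 ?posrE ?powR_gt0//.
by rewrite ge0_ler_powR ?subr_ge0 ?nnegrE// ltW.
Qed.

(** Convexity of the power at the weighted mean of a / A and b / B with weights
    proportional to A and B. *)
Lemma powR_add_le (A B a b s : R) : 0 < A -> 0 < B -> 0 <= a -> 0 <= b -> 1 <= s ->
  (a + b) `^ s <= (A + B) `^ (s - 1) * (A `^ (1 - s) * a `^ s + B `^ (1 - s) * b `^ s).
Proof.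
move=> A0 B0 a0 b0 s1; have AB0 : 0 < A + B by rewrite addr_gt0.
have s0 : 0 <= s by rewrite (le_trans _ s1).
have t01 : 0 <= A / (A + B) <= 1.
  by rewrite (divr_ge0 (ltW A0) (ltW AB0)) ler_pdivrMr// mul1r lerDl ltW.
have := convex_powR s1 (Itv01 (proj1 (andP t01)) (proj2 (andP t01))).
move=> /(_ (a / A) (b / B)).
have aA : 0 <= a / A by rewrite divr_ge0// ltW.
have bB : 0 <= b / B by rewrite divr_ge0// ltW.
rewrite !inE/= !in_itv/= aA bB => /(_ isT isT).
rewrite [X in X `^ _ <= _ -> _]convRE [X in _ <= X -> _]convRE/= /unstable.onem.
have -> : 1 - A / (A + B) = B / (A + B) by field; rewrite gt_eqF.
have -> : A / (A + B) * (a / A) + B / (A + B) * (b / B) = (a + b) / (A + B).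
  by field; rewrite !gt_eqF.
have iA : 0 <= A^-1 by rewrite invr_ge0 ltW.
have iB : 0 <= B^-1 by rewrite invr_ge0 ltW.
have iAB : 0 <= (A + B)^-1 by rewrite invr_ge0 ltW.
rewrite (powRM _ (addr_ge0 a0 b0) iAB) (powRM _ a0 iA) (powRM _ b0 iB) => H.
have V (x : R) : 0 < x -> x^-1 `^ s = x `^ (1 - s) / x.
  move=> x0; have x0' := ltW x0.
  rewrite powRBgt// powRr1// mulrAC mulfV ?gt_eqF// mul1r.
  by rewrite -powR_inv1// -powRrM mulN1r powRN.
move: H; rewrite !V//.
have -> : (A + B) `^ (s - 1) = ((A + B) `^ (1 - s))^-1 by rewrite -powRN opprB.
have P0 : 0 < (A + B) `^ (1 - s) by rewrite powR_gt0.
rewrite mulrC [X in _ <= X -> _](_ : _ =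
   (A `^ (1 - s) * a `^ s + B `^ (1 - s) * b `^ s) / (A + B)); last first.
  by field; rewrite !gt_eqF.
rewrite mulrAC ler_pdivrMr// mulfVK ?gt_eqF// => H.
by rewrite ler_pdivlMl.
Qed.

Lemma powR_sum_le m (A a : nat -> R) s : 1 <= s -> (forall i, 0 < A i) -> (forall i, 0 <= a i) ->
  (\sum_(i < m) a i) `^ s <=
  (\sum_(i < m) A i) `^ (s - 1) * \sum_(i < m) (A i `^ (1 - s) * a i `^ s).
Proof.
move=> s1 A0 a0; have sp : 0 < s by rewrite (lt_le_trans _ s1).
elim: m => [|[|m] IH].
- by rewrite !big_ord0 mulr0 powR0 ?gt_eqF.
- rewrite !big_ord1 mulrA -powRDgt//.
  have -> : s - 1 + (1 - s) = 0 by ring.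
  by rewrite powRr0 mul1r.
rewrite big_ord_recr/= [in X in _ <= X `^ _ * _]big_ord_recr/= [X in _ <= _ * X]big_ord_recr/=.
have S0 : 0 < \sum_(i < m.+1) A i by rewrite big_ord_recr/= ltr_wpDl ?sumr_ge0// => i _; rewrite ltW.
apply: le_trans (powR_add_le S0 (A0 m.+1) _ (a0 m.+1) s1) _; first by rewrite sumr_ge0.
rewrite ler_wpM2l ?powR_ge0// lerD2r.
have -> : \sum_(i < m.+1) A i `^ (1 - s) * a i `^ s =
  (\sum_(i < m.+1) A i) `^ (1 - s) * ((\sum_(i < m.+1) A i) `^ (s - 1) *
    \sum_(i < m.+1) (A i `^ (1 - s) * a i `^ s)).
  rewrite mulrA -powRDgt//.
  have -> : 1 - s + (s - 1) = 0 by ring.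
  by rewrite powRr0 mul1r.
by rewrite ler_wpM2l ?powR_ge0.
Qed.

(** A form of Minkowski's inequality: bounds C A_i^s for the sth moments add up
    in the A_i. *)
Lemma Int_powR_sum (u v : R) m (A : nat -> R) (f : nat -> R -> R) (C s : R) :
  1 <= s -> (forall i, 0 < A i) -> (forall i x, 0 <= f i x) -> (forall i, nice (f i)) ->
  (forall i, (i < m)%N -> Int u v (fun x => f i x `^ s) <= C * A i `^ s) ->
  Int u v (fun x => (\sum_(i < m) f i x) `^ s) <= C * (\sum_(i < m) A i) `^ s.
Proof.
move=> s1 A0 f0 nf Hf; have s0 : 0 <= s by rewrite (le_trans _ s1).
have nfs i : nice (fun x => f i x `^ s) by exact: nice_powR.
have nS : nice (fun x => \sum_(i < m) (A i `^ (1 - s) * f i x `^ s)).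
  by apply: (@nice_sum _ _ _ _ (fun (i : 'I_m) x => A i `^ (1 - s) * f i x `^ s)) => i _; exact: niceZ.
apply: (@le_trans _ _ (Int u v (fun x => (\sum_(i < m) A i) `^ (s - 1) *
    \sum_(i < m) (A i `^ (1 - s) * f i x `^ s)))).
  have nF : nice (fun x => \sum_(i < m) f i x).
    by apply: (@nice_sum _ _ _ _ (fun i : 'I_m => f i)) => i _; exact: nf.
  apply: le_Int; [exact: nice_powR s0 nF|exact: niceZ|].
  by move=> x _; apply: (@powR_sum_le m A (f ^~ x)).
rewrite IntZ// Int_sum; last by move=> i _; exact: niceZ.
case: m Hf {nS} => [|m] Hf.
  by rewrite !big_ord0 mulr0 powR0 ?mulr0// gt_eqF// (lt_le_trans _ s1).
set S := \sum_(i < _) A i.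
have S0 : 0 < S by rewrite /S big_ord_recr/= ltr_wpDl ?sumr_ge0// => i _; rewrite ltW.
have -> : C * S `^ s = S `^ (s - 1) * \sum_(i < m.+1) (C * A i).
  by rewrite -mulr_sumr mulrCA -/S -[X in _ = _ * (_ * X)](powRr1 (ltW S0)) -powRDgt// subrK.
rewrite ler_wpM2l ?powR_ge0//; apply: ler_sum => i _; rewrite IntZ//.
apply: le_trans (ler_wpM2l (powR_ge0 _ _) (Hf i (ltn_ord i))) _.
rewrite mulrCA -powRDgt//.
have -> : 1 - s + s = 1 by ring.
by rewrite powRr1// ltW.
Qed.

End Powers.

(** * The L1 norm of smoothly weighted multiples *)

Section SmoothL1.
Context {R : realType}.

Definition win (A L t : R) : R := (A < t <= A + L)%R%:R.

Lemma win_ge0 A L t : 0 <= win A L t. Proof. by rewrite /win. Qed.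

Lemma sum_win_mult q (A L : R) b : (0 < q)%N -> 0 <= A -> 0 <= L ->
  \sum_(n < b) (q %| n)%:R * win A L n%:R <= L / q%:R + 1.
Proof.
move=> q0 A0 L0; have AL : A <= A + L by rewrite lerDl.
apply: le_trans (_ : _ <= nmult q A (A + L) b) _.
  by apply: ler_sum => n _; rewrite /win -natrM mulnb andbC.
by apply: le_trans (nmult_le b q0 A0 AL) _; rewrite addrAC subrr add0r.
Qed.

(** From Bernoulli's inequality in the form (1 - u)^m (1 + m u) <= 1. *)
Lemma geom_small (u : R) : 0 < u -> u < 1 -> exists L : nat, (1 - u) ^+ L <= 2^-1.
Proof.
move=> u0 u1.
have H m : (1 - u) ^+ m * (1 + m%:R * u) <= 1.
  elim: m => [|m IH]; first by rewrite expr0 mul1r mul0r addr0.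
  apply: le_trans IH; rewrite exprSr -mulrA ler_wpM2l//.
    by rewrite exprn_ge0// subr_ge0 ltW.
  rewrite -natr1 -subr_ge0.
  have -> : 1 + m%:R * u - (1 - u) * (1 + (m%:R + 1) * u) = (m%:R + 1) * u ^+ 2 by ring.
  by rewrite mulr_ge0 ?sqr_ge0// addr_ge0.
exists (Num.truncn u^-1).+1; set L := _.+1.
have LU : 1 <= L%:R * u.
  by rewrite -ler_pdivrMr// div1r; apply/ltW/truncnS_gt.
have P0 : 0 <= (1 - u) ^+ L by rewrite exprn_ge0// subr_ge0 ltW.
have := H L; rewrite -[_^-1]mul1r ler_pdivlMr//; apply: le_trans.
by rewrite ler_wpM2l//; lra.
Qed.

(** Let f be the polynomial and M = H / q >= 1, the number of its terms up to a
    constant factor. Multiplication by 1 - r e(q x), with r = 1 - 1/(2M), turns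
    the coefficients into differences of consecutive ones, of size O(1/M), so
    that the product has squared L2 norm O(1/M). Dividing again costs a
    truncated geometric series, of squared L2 norm O(M), and the two factors
    balance. *)
Lemma smooth_L1 (W : R -> R) (q b : nat) (H A A' : R) :
  (0 < q)%N -> q%:R <= H -> 0 <= A -> 0 <= A' ->
  (forall t, `|W t| <= 1) ->
  (forall t u, `|W t - W u| <= 2 / H * `|t - u|) ->
  (forall t, win A (2 * H) t = 0 -> win A' (2 * H) t = 0 -> W t = 0) ->
  (forall n : nat, (b <= n)%N -> W n%:R = 0) ->
  Int 0 1 (fun x => cabs (tp b (fun n => W n%:R * (q %| n)%:R) x)) <= 104.
Proof.
move=> q0 qH A0 A'0 W1 WL WS Wb.
have qR : 0 < q%:R :> R by rewrite ltr0n.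
have H0 : 0 < H by rewrite (lt_le_trans qR).
have [M ME] : exists M, M = H / q%:R by exists (H / q%:R).
have M1 : 1 <= M by rewrite ME ler_pdivlMr// mul1r.
have M0 : 0 < M by rewrite (lt_le_trans ltr01).
set u := (2 * M)^-1.
have u0 : 0 < u by rewrite invr_gt0 mulr_gt0.
have u1 : u < 1 by rewrite invf_lt1 ?mulr_gt0//; lra.
(* Truncating the geometric series where r^L <= 1/2 keeps the factor
   1 - (r e(q x))^L at least 1/2 in absolute value. *)
set r := 1 - u.
have [L rL] := geom_small u0 u1; rewrite -/r in rL.
have r0 : 0 <= r by rewrite subr_ge0 ltW.
set a := fun n : nat => W n%:R * (q %| n)%N%:R.
pose a' (n : nat) := (W n%:R - r * W (n%:R - q%:R)) * (q %| n)%:R.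
pose g (n : nat) := if (q %| n)%N then r ^+ (n %/ q) else 0.
have Wneg t : t <= 0 -> W t = 0.
  move=> t0; apply: WS; rewrite /win.
    by rewrite ltNge (le_trans t0 A0).
  by rewrite ltNge (le_trans t0 A'0).
have E1 x : tp (q + b) a' x = tp b a x * (1 - r%:C * e (q%:R * x)).
  rewrite mulrBr mulr1 mulrCA.
  have -> : tp (q + b) a' x = tp (q + b) (fun n => a n - r * (W (n%:R - q%:R) * (q %| n)%:R)) x.
    by apply: eq_tp => n _; rewrite /a' /a mulrBl mulrA.
  rewrite tpB tpZ; congr (_ - _ * _).
    by apply: tp_widen => [|n bn]; rewrite ?leq_addl// /a Wb// mul0r.
  rewrite /tp big_split_ord/= big1 ?add0r.
    rewrite mulr_suml; apply: eq_bigr => n _; rewrite /a natrD addrAC subrr add0r.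
    by rewrite dvdn_addr// mulrDl eD mulrA mulrAC.
  move=> n _; rewrite Wneg ?mul0r// subr_le0 ler_nat; exact/ltnW/ltn_ord.
have E2 x : (1 - r%:C * e (q%:R * x)) * tp (q * L) g x = 1 - (r%:C * e (q%:R * x)) ^+ L.
  have -> : tp (q * L) g x = \sum_(m < L) (r%:C * e (q%:R * x)) ^+ m.
    rewrite /tp.
    transitivity (\sum_(n < q * L | (q %| n)%N) (g n)%:C * e (n%:R * x)).
      rewrite [RHS]big_mkcond/=; apply: eq_bigr => n _; rewrite /g; case: ifP => //.
      by rewrite mul0r.
    rewrite (sum_dvd_reindex L (fun n => (g n)%:C * e (n%:R * x)) q0).
    apply: eq_bigr => m _; rewrite /g dvdn_mulr// mulKn// rmorphXn exprMn -eX.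
    by congr (_ * e _); rewrite natrM; ring.
  by rewrite -[LHS]opprK -mulNr opprB -subrX1 opprB.
have uM : u * (2 * M) = 1 by rewrite mulVf// gt_eqF// mulr_gt0.
(* Arithmetic and geometric means, with the weights M and 1/M that balance the
   two mean squares. *)
have pt x : cabs (tp b a x) <= M * cabs (tp (q + b) a' x) ^+ 2 + M^-1 * cabs (tp (q * L) g x) ^+ 2.
  have G1 : 2^-1 <= cabs (1 - (r%:C * e (q%:R * x)) ^+ L).
    apply: (le_trans _ (cabs_ge_sub _ _)).
    rewrite cabs1 cabsX cabsM cabs_e mulr1 cabs_real ger0_norm//; lra.
  rewrite -E2 cabsM in G1.
  have F0 := cabs_ge0 (tp b a x).
  have := ler_wpM2l F0 G1; rewrite mulrA -cabsM -E1.
  move: (cabs_ge0 (tp (q + b) a' x)) (cabs_ge0 (tp (q * L) g x)) F0.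
  move: (cabs (tp b a x)) (cabs (tp (q + b) a' x)) (cabs (tp (q * L) g x)) => f p v p0 v0 f0 fpv.
  apply: (@le_trans _ _ (2 * (p * v))); first by lra.
  rewrite -subr_ge0.
  have -> : M * p ^+ 2 + M^-1 * v ^+ 2 - 2 * (p * v) = M * (p - M^-1 * v) ^+ 2.
    by field; rewrite gt_eqF.
  by rewrite mulr_ge0 ?sqr_ge0// ltW.
have n1 : nice (fun x => cabs (tp (q + b) a' x) ^+ 2) by apply: nice_sqr; exact: nice_tp.
have n2 : nice (fun x => cabs (tp (q * L) g x) ^+ 2) by apply: nice_sqr; exact: nice_tp.
apply: (@le_trans _ _ (Int 0 1 (fun x => M * cabs (tp (q + b) a' x) ^+ 2 +
    M^-1 * cabs (tp (q * L) g x) ^+ 2))).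
  apply: le_Int => //; first exact: nice_tp.
  by apply: niceD; exact: niceZ.
rewrite IntD; [|exact: niceZ|exact: niceZ].
rewrite !IntZ// !parseval.
have S1 : \sum_(n < q * L) g n ^+ 2 <= 2 * M.
  have -> : \sum_(n < q * L) g n ^+ 2 = \sum_(m < L) (r ^+ 2) ^+ m.
    transitivity (\sum_(n < q * L | (q %| n)%N) g n ^+ 2).
      rewrite [RHS]big_mkcond/=; apply: eq_bigr => n _; rewrite /g; case: ifP => //.
      by rewrite expr0n.
    rewrite (sum_dvd_reindex L (fun n => g n ^+ 2) q0).
    by apply: eq_bigr => m _; rewrite /g dvdn_mulr// mulKn// exprAC.
  have T : (1 - r ^+ 2) * \sum_(m < L) (r ^+ 2) ^+ m <= 1.
    rewrite -[X in X <= _]opprK -mulNr opprB -subrX1 opprB gerBl.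
    by rewrite exprn_ge0// sqr_ge0.
  have S0 : 0 <= \sum_(m < L) (r ^+ 2) ^+ m.
    by apply: sumr_ge0 => m _; rewrite exprn_ge0// sqr_ge0.
  have ur : u <= 1 - r ^+ 2.
    have -> : 1 - r ^+ 2 = u + u * r by rewrite /r; ring.
    by rewrite lerDl mulr_ge0// ltW.
  have := le_trans (ler_wpM2r S0 ur) T.
  by rewrite mulrC -ler_pdivlMr// div1r /u invrK.
pose S t := win A (2 * H) t + win A' (2 * H) t.
have S0 t : 0 <= S t by rewrite addr_ge0// win_ge0.
have SW t : `|W t| <= S t.
  rewrite /S /win; case: (boolP (A < t <= _)) => Ht.
    by apply: le_trans (W1 t) _; rewrite lerDl.
  case: (boolP (A' < t <= _)) => Ht'.
    by apply: le_trans (W1 t) _; rewrite lerDr.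
  by rewrite WS ?normr0 ?addr0// /win ?(negbTE Ht) ?(negbTE Ht').
have Sdich t : S t = 0 \/ 1 <= S t.
  rewrite /S /win; case: (A < t <= _); case: (A' < t <= _) => /=;
    rewrite ?addr0 ?add0r; by [left|right; rewrite ?lexx// lerDl].
(* Each squared coefficient is at most 2 (2/M)^2 + 2 (1/(2M))^2 = 17/(2 M^2), on
   four intervals of length 2H with at most 3M multiples of q each. *)
have S2 : \sum_(n < q + b) a' n ^+ 2 <= 102 / M.
  have P (n : nat) : a' n ^+ 2 <=
      (17 / 2 / M ^+ 2) * ((q %| n)%:R * S n%:R + (q %| n)%:R * S (n%:R - q%:R)).
    rewrite /a'; case: (q %| n)%N; last by rewrite !mulr0 !mul0r expr0n/= addr0 mulr0.
    rewrite mulr1 !mul1r.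
    set w1 := W _; set w2 := W _.
    set s1 := S _; set s2 := S _.
    have d1 : `|w1 - w2| <= 2 / M.
      apply: le_trans (WL _ _) _.
      have -> : n%:R - (n%:R - q%:R) = q%:R :> R by ring.
      rewrite ger0_norm ?ler0n// ME le_eqVlt; apply/orP; left; apply/eqP.
      by field; rewrite !gt_eqF.
    have d2 : (w1 - w2) ^+ 2 <= 4 / M ^+ 2 * (s1 + s2).
      have I4 : 0 <= 4 / M ^+ 2 by rewrite divr_ge0// exprn_ge0// ltW.
      case: (Sdich n%:R) => [/= z1|g1]; last first.
        apply: (@le_trans _ _ (4 / M ^+ 2 * 1)); last first.
          by rewrite ler_wpM2l//; have := S0 (n%:R - q%:R); move: g1; rewrite -/s1 -/s2; lra.
        rewrite mulr1 -real_normK ?num_real//.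
        have -> : 4 / M ^+ 2 = (2 / M) ^+ 2 by field; rewrite gt_eqF.
        by rewrite ler_sqr ?nnegrE// divr_ge0// ltW.
      case: (Sdich (n%:R - q%:R)) => [/= z2|g2]; last first.
        apply: (@le_trans _ _ (4 / M ^+ 2 * 1)); last first.
          by rewrite ler_wpM2l//; have := S0 n%:R; move: g2; rewrite -/s1 -/s2; lra.
        rewrite mulr1 -real_normK ?num_real//.
        have -> : 4 / M ^+ 2 = (2 / M) ^+ 2 by field; rewrite gt_eqF.
        by rewrite ler_sqr ?nnegrE// divr_ge0// ltW.
      have := SW n%:R; have := SW (n%:R - q%:R); rewrite z1 z2 !normr_le0.
      rewrite -/w1 -/w2 => /eqP -> /eqP ->; rewrite subrr expr0n/= mulr_ge0//.
      exact: addr_ge0 (S0 _) (S0 _).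
    have d3 : w2 ^+ 2 <= s2.
      apply: le_trans (SW _); rewrite -/w2 -real_normK ?num_real// expr2.
      by rewrite ler_piMl// W1.
    have -> : w1 - r * w2 = (w1 - w2) + u * w2 by rewrite /r; ring.
    apply: (@le_trans _ _ (2 * (w1 - w2) ^+ 2 + 2 * (u ^+ 2 * w2 ^+ 2))).
      rewrite -subr_ge0.
      have -> : 2 * (w1 - w2) ^+ 2 + 2 * (u ^+ 2 * w2 ^+ 2) - (w1 - w2 + u * w2) ^+ 2 =
        (w1 - w2 - u * w2) ^+ 2 by ring.
      exact: sqr_ge0.
    have -> : u ^+ 2 = (4 * M ^+ 2)^-1 by rewrite /u; field; rewrite gt_eqF.
    have I0 : 0 < (M ^+ 2)^-1 by rewrite invr_gt0 exprn_gt0.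
    have := S0 n%:R; have := S0 (n%:R - q%:R); rewrite -/s1 -/s2 => s20 s10.
    have -> : 17 / 2 / M ^+ 2 * (s1 + s2) =
      2 * (4 / M ^+ 2 * (s1 + s2)) + 2 * ((4 * M ^+ 2)^-1 * (s1 + s2)).
      by field; rewrite gt_eqF.
    have I3 : 0 <= (4 * M ^+ 2)^-1 by rewrite invr_ge0 mulr_ge0// exprn_ge0// ltW.
    apply: lerD; first by rewrite ler_pM2l.
    rewrite ler_pM2l// ler_wpM2l//.
    by apply: le_trans d3 _; rewrite lerDr.
  apply: (@le_trans _ _ (\sum_(n < q + b) (17 / 2 / M ^+ 2) *
      ((q %| n)%:R * S n%:R + (q %| n)%:R * S (n%:R - q%:R)))).
    by apply: ler_sum => n _; exact: P.
  rewrite -mulr_sumr big_split/=.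
  have T (B : R) (m : nat) : 0 <= B ->
      \sum_(n < m) (q %| n)%:R * win B (2 * H) n%:R <= 3 * M.
    move=> B0; apply: le_trans (sum_win_mult _ q0 B0 _) _; first by rewrite mulr_ge0// ltW.
    by rewrite -mulrA -ME; lra.
  have T2 : \sum_(n < q + b) (q %| n)%:R * S n%:R <= 6 * M.
    under eq_bigr do rewrite mulrDr.
    by rewrite big_split/=; have := T A (q + b)%N A0; have := T A' (q + b)%N A'0; lra.
  have wS B t : win B (2 * H) (t - q%:R) = win (B + q%:R) (2 * H) t.
    by rewrite /win ltrBrDr lerBlDr addrAC.
  have T3 : \sum_(n < q + b) (q %| n)%:R * S (n%:R - q%:R) <= 6 * M.
    under eq_bigr do rewrite mulrDr !wS.
    have Aq : 0 <= A + q%:R by rewrite addr_ge0.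
    have A'q : 0 <= A' + q%:R by rewrite addr_ge0.
    by rewrite big_split/=; have := T _ (q + b)%N Aq; have := T _ (q + b)%N A'q; lra.
  have -> : 102 / M = 17 / 2 / M ^+ 2 * (12 * M) by field; rewrite gt_eqF.
  rewrite ler_wpM2l//; last by lra.
  by rewrite divr_ge0// exprn_ge0// ltW.
rewrite -[X in _ <= X](_ : 102 + 2 = _); last by ring.
apply: lerD.
  by rewrite -[X in _ <= X](_ : M * (102 / M) = _) ?ler_pM2l//; field; rewrite gt_eqF.
by rewrite ler_pdivrMl// mulrC.
Qed.

End SmoothL1.

(** * Moments of a block under a localized weight *)

Section Block.
Context {R : realType}.

(** The part of the indicator of the k-free integers that comes from the
    divisors d in ]D/2, D]. *)
Definition mublk (k : nat) (D : R) (n : nat) : R :=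
  \sum_(1 <= d < (Num.truncn D).+1 | D / 2 < d%:R) (moebius d)%:~R * (d ^ k %| n)%:R.

Lemma normr_moebiusR d : `|(moebius d)%:~R| <= 1 :> R.
Proof. by rewrite -intr_norm -[1]/(1%:~R) ler_int normr_moebius_le1. Qed.

Lemma mublk_le k D n : `|mublk k D n| <= blk k D n.
Proof.
apply: le_trans (ler_norm_sum _ _ _) _; apply: ler_sum => d _.
by rewrite normrM [X in _ * X]ger0_norm// ler_piMl// normr_moebiusR.
Qed.

Lemma blk_ge0 k (D : R) n : 0 <= blk k D n.
Proof. by rewrite /blk sumr_ge0. Qed.

(** The mean square only sees the support of the weight, here contained in two
    intervals of length L. *)
Lemma block_window_L2 k (D A A' L : R) b (W : R -> R) :
  (2 <= k)%N -> 1 <= D -> D ^+ k.+1 <= L -> 0 <= A -> 0 <= A' ->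
  (forall t, `|W t| <= 1) ->
  (forall t, win A L t = 0 -> win A' L t = 0 -> W t = 0) ->
  Int 0 1 (fun x => cabs (tp b (fun n => W n%:R * mublk k D n) x) ^+ 2) <=
  2 * (4 ^+ k + 1) * (L * D / D ^+ k).
Proof.
move=> k2 D1 DL A0 A'0 W1 WS; rewrite parseval.
have := block_L2 b k2 D1 DL A0; have := block_L2 b k2 D1 DL A'0.
suff : \sum_(n < b) (W n%:R * mublk k D n) ^+ 2 <=
    \sum_(n < b) (A < n%:R <= A + L)%R%:R * blk k D n ^+ 2 +
    \sum_(n < b) (A' < n%:R <= A' + L)%R%:R * blk k D n ^+ 2 by lra.
rewrite -big_split/=; apply: ler_sum => n _; rewrite -mulrDl.
have S : (W n%:R) ^+ 2 <= win A L n%:R + win A' L n%:R.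
  rewrite /win; case: (boolP (A < n%:R <= _)) => Ht.
    by rewrite -real_normK ?num_real// (@le_trans _ _ 1) ?exprn_ile1// lerDl.
  case: (boolP (A' < n%:R <= _)) => Ht'.
    by rewrite -real_normK ?num_real// (@le_trans _ _ 1) ?exprn_ile1// lerDr.
  by rewrite WS ?expr0n/= ?addr0// /win ?(negbTE Ht) ?(negbTE Ht').
rewrite exprMn ler_pM ?sqr_ge0//.
by rewrite -real_normK ?num_real// ler_sqr ?nnegrE ?blk_ge0// mublk_le.
Qed.

(** The L1 norm is O(D), by [smooth_L1] for each d, and the mean square is O(H
    D^(1-k)); they balance at the threshold l = H / D^k. *)
Lemma block_piece k (s D H A A' : R) b (W : R -> R) :
  (2 <= k)%N -> 1 < s -> s < 2 -> 1 <= D -> D ^+ k.+1 <= H -> 0 <= A -> 0 <= A' ->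
  (forall t, `|W t| <= 1) ->
  (forall t u, `|W t - W u| <= 2 / H * `|t - u|) ->
  (forall t, win A (2 * H) t = 0 -> win A' (2 * H) t = 0 -> W t = 0) ->
  (forall n : nat, (b <= n)%N -> W n%:R = 0) ->
  Int 0 1 (fun x => cabs (tp b (fun n => W n%:R * mublk k D n) x) `^ s) <=
  (104 + 4 * (4 ^+ k + 1)) * (D * (H / D ^+ k) `^ (s - 1)).
Proof.
move=> k2 s1 s2 D1 DH A0 A'0 W1 WL WS Wb.
have D0 : 0 < D by rewrite (lt_le_trans ltr01).
have Dk0 : 0 < D ^+ k by rewrite exprn_gt0.
have H0 : 0 < H by rewrite (lt_le_trans _ DH)// exprn_gt0.
have DkH : D ^+ k <= H by rewrite (le_trans _ DH)// ler_weXn2l.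
set l := H / D ^+ k.
have l0 : 0 < l by rewrite divr_gt0.
pose F x := cabs (tp b (fun n => W n%:R * mublk k D n) x).
have nF : nice F by exact: nice_tp.
have L1 : Int 0 1 F <= 104 * D.
  have E x : F x <= \sum_(1 <= d < (Num.truncn D).+1 | D / 2 < d%:R)
      cabs (tp b (fun n => W n%:R * (d ^ k %| n)%:R) x).
    rewrite /F (eq_tp (b := fun n => \sum_(1 <= d < (Num.truncn D).+1 | D / 2 < d%:R)
       (moebius d)%:~R * (W n%:R * (d ^ k %| n)%:R))); last first.
      by move=> n _; rewrite mulr_sumr; apply: eq_bigr => d _; rewrite mulrCA.
    rewrite tp_sum; apply: le_trans (cabs_sum _ _ _) _; apply: ler_sum => d _.
    by rewrite tpZ cabsM cabs_real ler_piMl ?cabs_ge0// normr_moebiusR.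
  apply: le_trans (le_Int nF _ (fun x _ => E x)) _.
    by apply: nice_sum => d _; exact: nice_tp.
  rewrite Int_sum; last by move=> d _; exact: nice_tp.
  apply: (@le_trans _ _ (\sum_(1 <= d < (Num.truncn D).+1) 104)).
    rewrite [X in X <= _]big_mkcond/= ![X in X <= _]big_nat [X in _ <= X]big_nat.
    apply: ler_sum => d /andP[d0 dD]; case: ifP => _ //.
    have dk0 : (0 < d ^ k)%N by rewrite expn_gt0 d0.
    apply: (@smooth_L1 _ W (d ^ k) b H A A' dk0) => //.
    apply: le_trans DkH; rewrite natrX lerXn2r ?nnegrE ?(ltW D0)//.
    by move: dD; rewrite ltnS truncn_ge_nat// ltW.
  rewrite sumr_const_nat subSS subn0 -[_ *+ Num.truncn D]mulr_natr ler_wpM2l//.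
  by apply: card_le_real; exact: ltW.
have L2 : Int 0 1 (fun x => F x ^+ 2) <= 4 * (4 ^+ k + 1) * (D * l).
  have D2H : D ^+ k.+1 <= 2 * H by rewrite (le_trans DH)//; lra.
  apply: le_trans (block_window_L2 b k2 D1 D2H A0 A'0 W1 WS) _.
  rewrite le_eqVlt; apply/orP; left; apply/eqP.
  by rewrite /l; field; rewrite gt_eqF.
have nF2 : nice (fun x => F x ^+ 2) by exact: nice_sqr.
apply: (@le_trans _ _ (Int 0 1 (fun x => l `^ (s - 1) * F x + l `^ (s - 2) * F x ^+ 2))).
  apply: le_Int.
  - by apply: nice_powR => //; rewrite ltW// (lt_trans ltr01).
  - by apply: niceD; exact: niceZ.
  - move=> x _; have F0 : 0 <= F x by exact: cabs_ge0.
    have := @powR_interp _ (F x) l 1 s 2 F0 l0 ler01 (ltW s1) (ltW s2).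
    by rewrite powRr1// -[F x ^+ 2]powR_mulrn.
rewrite IntD; [|exact: niceZ|exact: niceZ].
rewrite !IntZ// [X in _ <= X]mulrDl; apply: lerD.
  rewrite mulrC mulrA ler_wpM2r ?powR_ge0//.
apply: le_trans (ler_wpM2l (powR_ge0 _ _) L2) _.
have -> : l `^ (s - 1) = l `^ (s - 2) * l.
  by rewrite -{3}(powRr1 (ltW l0)) -powRDgt//; congr (_ `^ _); ring.
by rewrite le_eqVlt; apply/orP; left; apply/eqP; ring.
Qed.

(** At the shortest scale, H about D^(k+1), the mean square alone suffices, with
    the threshold D, about H / D^k. *)
Lemma block_edges k (s D H A A' : R) b (W : R -> R) :
  (2 <= k)%N -> 1 < s -> s < 2 -> 1 <= D -> D ^+ k.+1 <= H -> H <= 2 * D ^+ k.+1 ->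
  0 <= A -> 0 <= A' ->
  (forall t, `|W t| <= 1) ->
  (forall t, win A H t = 0 -> win A' H t = 0 -> W t = 0) ->
  Int 0 1 (fun x => cabs (tp b (fun n => W n%:R * mublk k D n) x) `^ s) <=
  (104 + 4 * (4 ^+ k + 1)) * (D * (H / D ^+ k) `^ (s - 1)).
Proof.
move=> k2 s1 s2 D1 DH HD A0 A'0 W1 WS.
have D0 : 0 < D by rewrite (lt_le_trans ltr01).
have Dk0 : 0 < D ^+ k by rewrite exprn_gt0.
pose F x := cabs (tp b (fun n => W n%:R * mublk k D n) x).
have nF : nice F by exact: nice_tp.
have L2 : Int 0 1 (fun x => F x ^+ 2) <= 4 * (4 ^+ k + 1) * D ^+ 2.
  apply: le_trans (block_window_L2 b k2 D1 DH A0 A'0 W1 WS) _.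
  have -> : 4 * (4 ^+ k + 1) * D ^+ 2 = 2 * (4 ^+ k + 1) * (2 * D ^+ k.+1 * D / D ^+ k).
    by rewrite (exprS D k); field; rewrite gt_eqF.
  rewrite ler_wpM2l ?mulr_ge0 ?addr_ge0 ?exprn_ge0//.
  by rewrite ler_wpM2r ?invr_ge0 ?(ltW Dk0)// ler_wpM2r// ltW.
have nF2 : nice (fun x => F x ^+ 2) by exact: nice_sqr.
have s0 : 0 <= s by rewrite ltW// (lt_trans ltr01).
apply: (@le_trans _ _ (Int 0 1 (fun x => D `^ s + D `^ (s - 2) * F x ^+ 2))).
  apply: le_Int.
  - exact: nice_powR.
  - by apply: niceD; [exact: nice_cst|exact: niceZ].
  - move=> x _; have F0 : 0 <= F x by exact: cabs_ge0.
    have := @powR_interp _ (F x) D 0 s 2 F0 D0 (lexx _) s0 (ltW s2).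
    by rewrite subr0 powRr0 mulr1 -[F x ^+ 2]powR_mulrn.
rewrite IntD; [|exact: nice_cst|exact: niceZ].
rewrite IntZ// Int_cst// subr0 mulr1.
apply: (@le_trans _ _ ((1 + 4 * (4 ^+ k + 1)) * D `^ s)).
  rewrite mulrDl mul1r lerD2l.
  apply: le_trans (ler_wpM2l (powR_ge0 _ _) L2) _.
  have -> : D `^ s = D `^ (s - 2) * D ^+ 2.
    by rewrite -powR_mulrn ?(ltW D0)// -powRDgt// subrK.
  by rewrite le_eqVlt; apply/orP; left; apply/eqP; ring.
have C0 : 0 <= 4 * (4 ^+ k + 1) :> R by rewrite mulr_ge0// addr_ge0// exprn_ge0.
apply: ler_pM; rewrite ?powR_ge0 ?addr_ge0//; first by lra.
have -> : D `^ s = D * D `^ (s - 1) by rewrite mulr_powRB1// ?(ltW D0)// (lt_trans ltr01).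
rewrite ler_wpM2l ?(ltW D0)// ge0_ler_powR ?nnegrE ?(ltW D0)//.
- by rewrite subr_ge0 ltW.
- by rewrite divr_ge0 ?(ltW Dk0)// (le_trans _ DH)// exprn_ge0// ltW.
- by rewrite ler_pdivlMr// -exprS.
Qed.

End Block.

(** * Trapezoids *)

Section Trapezoid.
Context {R : realType}.
Implicit Types K H t u : R.

Definition clamp (x : R) : R := Num.max 0 (Num.min 1 x).
Definition trap K H t : R := clamp (Num.min (t / H) ((K - t) / H)).

Lemma clamp01 x : 0 <= clamp x <= 1.
Proof. by rewrite /clamp le_max lexx ge_max ler01 ge_min lexx. Qed.

Lemma clamp_le0 x : x <= 0 -> clamp x = 0.
Proof. by move=> x0; rewrite /clamp max_l// ge_min x0 orbT. Qed.

Lemma clamp_ge1 x : 1 <= x -> clamp x = 1.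
Proof. by move=> x1; rewrite /clamp min_l// max_r. Qed.

Lemma clamp_lip x y : `|clamp x - clamp y| <= `|x - y|.
Proof.
have := ler_norm (x - y); have := ler_norm (y - x); rewrite [`|y - x|]distrC.
move: (`|x - y|) => z H1 H2; rewrite ler_norml /clamp.
by case: (leP 1 x) => x1; case: (leP 1 y) => y1; rewrite ?(max_r ler01);
  try case: (leP 0 x) => x0; try case: (leP 0 y) => y0; lra.
Qed.

Lemma min_lip a b c d : `|Num.min a b - Num.min c d| <= Num.max `|a - c| `|b - d| :> R.
Proof.
have := ler_norm (a - c); have := ler_norm (c - a); rewrite [`|c - a|]distrC.
have := ler_norm (b - d); have := ler_norm (d - b); rewrite [`|d - b|]distrC.
rewrite le_max !ler_norml; move: (`|a - c|) (`|b - d|) => z w *.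
by case: (leP a b) => ab; case: (leP c d) => cd; case: (leP z w) => zw; apply/orP; lra.
Qed.

Lemma trap_lip K H t u : 0 < H -> `|trap K H t - trap K H u| <= `|t - u| / H.
Proof.
move=> H0; apply: le_trans (clamp_lip _ _) _; apply: le_trans (min_lip _ _ _ _) _.
rewrite ge_max -!mulrBl !normrM [`|H^-1|]ger0_norm ?invr_ge0 ?(ltW H0)// lexx/=.
have -> : K - t - (K - u) = u - t by ring.
by rewrite distrC.
Qed.

Lemma trap01 K H t : 0 <= trap K H t <= 1.
Proof. exact: clamp01. Qed.

Lemma trap_out K H t : 0 < H -> ~~ (0 < t < K) -> trap K H t = 0.
Proof.
move=> H0 h; apply: clamp_le0; rewrite ge_min.
by rewrite !pmulr_lle0 ?invr_gt0//; move: h; rewrite negb_and -!leNgt subr_le0.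
Qed.

Lemma trap_in K H t : 0 < H -> H <= t -> t <= K - H -> trap K H t = 1.
Proof.
move=> H0 Ht tK; apply: clamp_ge1; rewrite le_min !ler_pdivlMr// !mul1r Ht/=; lra.
Qed.

(** Heights of the trapezoids on ]0, K] with edges of length K / 2^i; the level
    0 is the zero function, so that consecutive differences telescope. *)
Definition level K (i : nat) t : R := if i is 0%N then 0 else trap K (K / 2 ^+ i) t.

Lemma level_out K i t : 0 < K -> ~~ (0 < t < K) -> level K i t = 0.
Proof. by case: i => [//|i] K0; apply: trap_out; rewrite divr_gt0// exprn_gt0. Qed.

Lemma level_in K i t : 0 < K -> K / 2 ^+ i < t -> t <= K - K / 2 ^+ i -> level K i t = 1.
Proof.
case: i => [|i] K0 t1 t2; first by move: t1 t2; rewrite expr0 divr1 subrr; lra.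
by rewrite /level trap_in ?divr_gt0 ?exprn_gt0// ltW.
Qed.

Lemma level_lip K i t u : 0 < K -> `|level K i t - level K i u| <= `|t - u| / (K / 2 ^+ i).
Proof.
move=> K0; have H0 : 0 < K / 2 ^+ i by rewrite divr_gt0// exprn_gt0.
case: i H0 => [|i] H0 /=; first by rewrite subrr normr0 divr_ge0// ltW.
exact: trap_lip.
Qed.

Lemma level01 K i t : 0 <= level K i t <= 1.
Proof. by case: i => [|i]; rewrite /level ?trap01// lexx ler01. Qed.

End Trapezoid.

(** * Moments of a dyadic block *)

Section BlockMoment.
Context {R : realType}.

Lemma win_eq0 (A L t : R) : win A L t = 0 -> t <= A \/ A + L < t.
Proof.
rewrite /win; case: (boolP (A < t <= _)) => [_ /eqP|]; first by rewrite oner_eq0.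
by rewrite negb_and -leNgt -ltNge => /orP.
Qed.

Lemma win_out (A L t : R) : t <= A \/ A + L < t -> win A L t = 0.
Proof. by rewrite /win; case: (boolP (A < t <= _)) => // /andP[? ?] []; lra. Qed.

Lemma win_in (A L t : R) : A < t -> t <= A + L -> win A L t = 1.
Proof. by rewrite /win => -> ->. Qed.

Lemma dyadic_scale (X : R) : 1 <= X -> exists i : nat, 2 ^+ i <= X < 2 ^+ i.+1.
Proof.
move=> X1; have X0 : 0 <= X by rewrite (le_trans ler01).
have t0 : (0 < Num.truncn X)%N by rewrite truncn_ge_nat.
exists (trunc_log 2 (Num.truncn X)).
have /andP[H1 H2] := trunc_log_bounds (isT : (1 < 2)%N) t0.
rewrite -!natrX; apply/andP; split; first by rewrite -truncn_ge_nat.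
by rewrite -truncn_lt_nat.
Qed.

(** The cut-off is the sum of the differences of consecutive levels, down to
    edges of length about D^(k+1), and of a remainder supported at the two ends.
    The bounds for the pieces form a geometric progression since s > 1, so that
    the first of them decides. *)
Lemma block_moment k (s : R) : (2 <= k)%N -> 1 < s -> s < 2 ->
  exists2 C : R, 0 < C & forall (A K D : R) b,
    0 <= A -> 1 <= D -> D ^+ k.+1 <= K -> A + K < b%:R ->
    Int 0 1 (fun x => cabs (tp b (fun n => win A K n%:R * mublk k D n) x) `^ s) <=
    C * (D * (K / D ^+ k) `^ (s - 1)).
Proof.
move=> k2 s1 s2.
pose C0 : R := 104 + 4 * (4 ^+ k + 1).
have C00 : 0 < C0 by rewrite /C0 ltr_wpDr// mulr_ge0// addr_ge0// exprn_ge0.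
have s0 : 0 < s by rewrite (lt_trans ltr01).
pose rho : R := 2^-1 `^ ((s - 1) / s).
have rho0 : 0 < rho by rewrite powR_gt0// invr_gt0.
have rho1 : rho < 1.
  have e0 : 0 < (s - 1) / s by rewrite divr_gt0// subr_gt0.
  have := @gt0_ltr_powR R _ e0 2^-1 1; rewrite powR1 !nnegrE; apply; lra.
exists (C0 * ((1 - rho)^-1) `^ s).
  by rewrite mulr_gt0// powR_gt0// invr_gt0 subr_gt0.
move=> A K D b A0 D1 DK Kb.
have D0 : 0 < D by rewrite (lt_le_trans ltr01).
have Dk0 : 0 < D ^+ k by rewrite exprn_gt0.
have Dk1 : 0 < D ^+ k.+1 by rewrite exprn_gt0.
have K0 : 0 < K by rewrite (lt_le_trans Dk1).
have [I /andP[I1 I2]] : exists i : nat, 2 ^+ i <= K / D ^+ k.+1 < 2 ^+ i.+1.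
  by apply: dyadic_scale; rewrite ler_pdivlMr// mul1r.
have p2 i : 0 < 2 ^+ i :> R by rewrite exprn_gt0.
have DI i : (i <= I)%N -> D ^+ k.+1 <= K / 2 ^+ i.
  move=> iI; rewrite ler_pdivlMr// mulrC -ler_pdivlMr//.
  by apply: le_trans I1; rewrite ler_weXn2l// ler1n.
(* The pieces of the cut-off; the last one is what remains beyond level I. *)
pose W (i : nat) (t : R) : R := if (i < I)%N then level K i.+1 (t - A) - level K i (t - A)
  else win A K t - level K I (t - A).
pose f (i : nat) (x : R) := cabs (tp b (fun n => W i n%:R * mublk k D n) x).
(* The bound for the ith piece is the sth power of a rho^i. *)
pose a := (D * (K / D ^+ k) `^ (s - 1)) `^ s^-1.
have DK0 : 0 < D * (K / D ^+ k) `^ (s - 1) by rewrite mulr_gt0// powR_gt0// divr_gt0.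
have a0 : 0 < a by rewrite powR_gt0.
have aE : a `^ s = D * (K / D ^+ k) `^ (s - 1).
  by rewrite /a -powRrM mulVf ?gt_eqF// powRr1// ltW.
have WS t : \sum_(i < I.+1) W i t = win A K t.
  rewrite big_ord_recr/= {2}/W ltnn.
  have -> : \sum_(i < I) W i t = \sum_(0 <= i < I) (level K i.+1 (t - A) - level K i (t - A)).
    by rewrite big_mkord; apply: eq_bigr => i _; rewrite /W ltn_ord.
  by rewrite (telescope_sumr (fun i => level K i (t - A)))//= subr0 addrC subrK.
have E x : cabs (tp b (fun n => win A K n%:R * mublk k D n) x) <= \sum_(i < I.+1) f i x.
  rewrite (eq_tp (b := fun n => \sum_(i < I.+1) W i n%:R * mublk k D n)).
    by rewrite tp_sum; exact: cabs_sum.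
  by move=> n _; rewrite -WS mulr_suml.
have aiE i : (a * rho ^+ i) `^ s = D * (K / 2 ^+ i / D ^+ k) `^ (s - 1).
  have ri0 : 0 <= rho ^+ i by rewrite exprn_ge0// ltW.
  rewrite powRM ?(ltW a0)// aE -mulrA; congr (_ * _).
  have -> : K / 2 ^+ i / D ^+ k = (K / D ^+ k) * 2^-1 ^+ i.
    by rewrite -exprVn mulrAC.
  have q0 : 0 <= 2^-1 :> R by rewrite invr_ge0.
  have kd0 : 0 <= K / D ^+ k by rewrite divr_ge0// ltW.
  rewrite (powRM _ kd0 (exprn_ge0 i q0)); congr (_ * _).
  have rE : rho ^+ i = 2^-1 `^ ((s - 1) / s * i%:R).
    by rewrite -(powR_mulrn i (ltW rho0)) /rho -powRrM.
  rewrite rE -(powR_mulrn i q0) -!powRrM.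
  by congr (_ `^ _); field; rewrite gt_eqF.
have fi i : (i < I.+1)%N -> Int 0 1 (fun x => f i x `^ s) <= C0 * (a * rho ^+ i) `^ s.
  rewrite ltnS leq_eqVlt aiE => /orP[/eqP ->|iI].
    have HI0 : 0 < K / 2 ^+ I by rewrite divr_gt0.
    apply: (@block_edges _ k s D (K / 2 ^+ I) A (A + (K - K / 2 ^+ I))) => //.
    - exact: DI.
    - rewrite ler_pdivrMr// mulrC mulrA -exprSr -ler_pdivrMr//; exact: ltW.
    - rewrite addr_ge0// subr_ge0 ler_pdivrMr// ler_peMr ?(ltW K0)//.
      by rewrite -[X in X <= _](expr1n _ I) lerXn2r ?nnegrE// ler1n.
    - move=> t; rewrite /W ltnn ler_norml /win; have /andP[] := level01 K I (t - A).
      by case: (A < t <= _) => /= ? ?; lra.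
    - move=> t; rewrite /W ltnn => /win_eq0 w1 /win_eq0 w2.
      have [/andP[t1 t2]|tout] := boolP (0 < t - A < K).
        rewrite win_in; [|lra|lra].
        by rewrite level_in ?subrr//; lra.
      rewrite level_out// subr0 win_out//; move: tout.
      by rewrite negb_and -!leNgt => /orP; lra.
  set H := K / 2 ^+ i.+1.
  have H0 : 0 < H by rewrite divr_gt0.
  have H2 : K / 2 ^+ i = 2 * H by rewrite /H exprS; field; rewrite gt_eqF.
  have HK : 2 * H <= K.
    rewrite -H2 ler_pdivrMr// ler_peMr ?(ltW K0)//.
    by rewrite -[X in X <= _](expr1n _ i) lerXn2r ?nnegrE// ler1n.
  apply: (@le_trans _ _ (C0 * (D * (H / D ^+ k) `^ (s - 1)))); last first.
    rewrite ler_wpM2l ?(ltW C00)// ler_wpM2l ?(ltW D0)// ge0_ler_powR ?nnegrE//.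
    - by rewrite subr_ge0 ltW.
    - by rewrite divr_ge0// ltW.
    - by rewrite H2 divr_ge0 ?mulr_ge0// ltW.
    - by rewrite H2 ler_wpM2r ?invr_ge0 ?(ltW Dk0)//; lra.
  apply: (@block_piece _ k s D H A (A + (K - 2 * H))) => //.
  - exact: DI.
  - by lra.
  - move=> t; rewrite /W iI ler_norml.
    have /andP[? ?] := level01 K i (t - A); have /andP[? ?] := level01 K i.+1 (t - A).
    lra.
  - move=> t u; rewrite /W iI.
    have -> : level K i.+1 (t - A) - level K i (t - A) - (level K i.+1 (u - A) - level K i (u - A)) =
      (level K i.+1 (t - A) - level K i.+1 (u - A)) - (level K i (t - A) - level K i (u - A)) by ring.
    apply: le_trans (ler_normB _ _) _.
    have := level_lip i (t - A) (u - A) K0; have := level_lip i.+1 (t - A) (u - A) K0.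
    rewrite -/H H2; have -> : t - A - (u - A) = t - u by ring.
    have -> : `|t - u| / (2 * H) = `|t - u| / H / 2 by field; rewrite gt_eqF.
    have -> : 2 / H * `|t - u| = 2 * (`|t - u| / H) by ring.
    have : 0 <= `|t - u| / H by rewrite divr_ge0// ltW.
    move: (`|t - u| / H) => z; lra.
  - move=> t; rewrite /W iI => /win_eq0 w1 /win_eq0 w2.
    have [/andP[t1 t2]|tout] := boolP (0 < t - A < K); last by rewrite !level_out// subrr.
    rewrite !level_in ?subrr// -/H ?H2; lra.
  - move=> n bn; have Hn : A + K < n%:R by apply: lt_le_trans Kb _; rewrite ler_nat.
    by rewrite /W iI !level_out ?subrr// negb_and -!leNgt; apply/orP; right; lra.
apply: (@le_trans _ _ (Int 0 1 (fun x => (\sum_(i < I.+1) f i x) `^ s))).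
  have nS : nice (fun x => \sum_(i < I.+1) f i x).
    by apply: (@nice_sum _ _ _ _ (fun i : 'I_I.+1 => f i)) => i _; exact: nice_tp.
  apply: le_Int.
  - by apply: nice_powR (ltW s0) _; exact: nice_tp.
  - exact: nice_powR (ltW s0) nS.
  - move=> x _; apply: ge0_ler_powR; rewrite ?nnegrE ?(ltW s0) ?cabs_ge0//.
    by apply: sumr_ge0 => i _; exact: cabs_ge0.
apply: (le_trans (Int_powR_sum (ltW s1) _ _ _ fi)).
- by move=> i; rewrite mulr_gt0// exprn_gt0.
- by move=> i x; exact: cabs_ge0.
- by move=> i; exact: nice_tp.
rewrite -mulr_sumr -mulrA ler_wpM2l ?(ltW C00)//.
rewrite powRM ?(ltW a0) ?sumr_ge0//; last by move=> i _; rewrite exprn_ge0// ltW.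
rewrite aE mulrC ler_wpM2r ?(ltW DK0)// ge0_ler_powR ?nnegrE ?(ltW s0)//.
- by rewrite sumr_ge0// => i _; rewrite exprn_ge0// ltW.
- by rewrite invr_ge0 subr_ge0 ltW.
rewrite -[X in _ <= X]mul1r ler_pdivlMr ?subr_gt0//.
rewrite mulrC -[X in X <= _]opprK -mulNr opprB -subrX1 opprB gerBl.
by rewrite exprn_ge0// ltW.
Qed.

End BlockMoment.

(** * Moments of the small divisors *)

Section TruncatedSums.
Context {R : realType}.

Lemma geometric_le (rho : R) m : 0 < rho -> rho < 1 -> \sum_(i < m) rho ^+ i <= (1 - rho)^-1.
Proof.
move=> rho0 rho1; rewrite -[X in _ <= X]mul1r ler_pdivlMr ?subr_gt0//.
rewrite mulrC -[X in X <= _]opprK -mulNr opprB -subrX1 opprB gerBl.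
by rewrite exprn_ge0// ltW.
Qed.

Lemma powR_lt1 (t d : R) : 0 <= t -> t < 1 -> 0 < d -> t `^ d < 1.
Proof.
move=> t0 t1 d0; have := @gt0_ltr_powR R _ d0 t 1.
by rewrite powR1 !nnegrE; apply.
Qed.

(** The geometric series is dominated by its first term x^d if d > 0, and by its
    last term, at most 1, if d < 0. *)
Lemma dyadic_sum_le (d : R) : d != 0 -> exists2 C : R, 0 < C & forall (x : R) J, 1 <= x ->
  (forall j, (j < J)%N -> 1 <= x / 2 ^+ j) ->
  \sum_(j < J) (x / 2 ^+ j) `^ d <= C * Num.max 1 (x `^ d).
Proof.
move=> dn0; have [d0|d0] := ltP 0 d.
  set rho : R := 2^-1 `^ d.
  have rho0 : 0 < rho by rewrite powR_gt0 ?invr_gt0.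
  have rho1 : rho < 1 by rewrite powR_lt1// ?invr_ge0//; lra.
  exists (1 - rho)^-1; first by rewrite invr_gt0 subr_gt0.
  move=> x J x1 _; have x0 : 0 <= x by rewrite (le_trans ler01).
  have E (j : nat) : (x / 2 ^+ j) `^ d = x `^ d * rho ^+ j.
    have h0 : 0 <= 2^-1 :> R by rewrite invr_ge0.
    rewrite -exprVn powRM ?exprn_ge0//; congr (_ * _).
    rewrite -(powR_mulrn j h0) -powRrM mulrC powRrM -(powR_mulrn j (ltW rho0)).
    by rewrite /rho -!powRrM mulrC.
  under eq_bigr do rewrite E.
  rewrite -mulr_sumr mulrC ler_pM ?powR_ge0 ?geometric_le//.
    by apply: sumr_ge0 => j _; rewrite exprn_ge0// ltW.
  by rewrite le_max lexx orbT.
have {d0} d0 : d < 0 by rewrite lt_neqAle dn0.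
set rho : R := 2 `^ d.
have rho0 : 0 < rho by rewrite powR_gt0.
have rho1 : rho < 1.
  rewrite /rho -[d]opprK powRN invf_lt1 ?powR_gt0//.
  have nd0 : 0 < - d by rewrite oppr_gt0.
  have := @gt0_ltr_powR R _ nd0 1 2; rewrite powR1 !nnegrE; apply; lra.
exists (1 - rho)^-1; first by rewrite invr_gt0 subr_gt0.
move=> x J x1 HJ; have x0 : 0 <= x by rewrite (le_trans ler01).
apply: (@le_trans _ _ (1 - rho)^-1); last first.
  by rewrite ler_peMr ?invr_ge0 ?subr_ge0 ?(ltW rho1)// le_max lexx.
apply: le_trans (geometric_le J rho0 rho1).
rewrite (reindex_inj rev_ord_inj)/=; apply: ler_sum => j _.
have jJ := ltn_ord j.
have -> : rho ^+ j = (2 ^+ j) `^ d.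
  by rewrite -(powR_mulrn j (ltW rho0)) /rho -powRrM mulrC powRrM powR_mulrn.
have H : 2 ^+ j <= x / 2 ^+ (J - j.+1).
  have := HJ J.-1 ltac:(lia); rewrite !ler_pdivlMr ?exprn_gt0// mul1r -exprD.
  by have -> : (j + (J - j.+1) = J.-1)%N by lia.
have p0 : 0 < 2 ^+ j :> R by rewrite exprn_gt0.
have p1 := lt_le_trans p0 H.
have [c [c0 ->]] : exists c, 0 <= c /\ d = - c.
  by exists (- d); rewrite opprK oppr_ge0 ltW.
rewrite !powRN lef_pV2 ?posrE ?powR_gt0//.
by rewrite ge0_ler_powR ?nnegrE ?(ltW p0) ?(ltW p1).
Qed.

(** The part of the indicator of the k-free integers that comes from the
    divisors d <= x. *)
Definition mutrunc (k : nat) (x : R) (n : nat) : R :=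
  \sum_(1 <= d < (Num.truncn x).+1) (moebius d)%:~R * (d ^ k %| n)%:R.

Lemma mutrunc_split k x n : 0 <= x -> mutrunc k x n = mublk k x n + mutrunc k (x / 2) n.
Proof.
move=> x0; rewrite /mutrunc (bigID (fun d : nat => x / 2 < d%:R))/=; congr (_ + _).
have xx : x / 2 <= x by lra.
have x20 : 0 <= x / 2 by lra.
rewrite (@big_cat_nat _ _ _ (Num.truncn (x / 2)).+1)//=; last by rewrite ltnS le_truncn.
rewrite [X in _ + X]big1_seq ?addr0; last first.
  move=> d /andP[]; rewrite -leNgt mem_index_iota => dx /andP[+ _].
  by rewrite truncn_lt_nat// ltNge dx.
rewrite big_nat_cond [RHS]big_nat; apply: eq_bigl => d.
case: (boolP (0 < d < _)%N) => //= /andP[_].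
by rewrite ltnS truncn_ge_nat// -leNgt => ->.
Qed.

Lemma mutrunc_lt1 k x n : x < 1 -> mutrunc k x n = 0.
Proof.
move=> x1; rewrite /mutrunc; have -> : Num.truncn x = 0%N.
  by apply/truncn0Pn; rewrite -ltNge.
by rewrite big_geq.
Qed.

Lemma mutrunc_dyadic k x n J : 0 <= x -> x / 2 ^+ J < 1 ->
  mutrunc k x n = \sum_(j < J) mublk k (x / 2 ^+ j) n.
Proof.
move=> x0 xJ.
have H j : mutrunc k x n = \sum_(i < j) mublk k (x / 2 ^+ i) n + mutrunc k (x / 2 ^+ j) n.
  elim: j => [|j IH]; first by rewrite big_ord0 add0r expr0 divr1.
  rewrite IH big_ord_recr/= -addrA; congr (_ + _).
  rewrite mutrunc_split ?divr_ge0 ?exprn_ge0//; congr (_ + mutrunc _ _ _).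
  by rewrite exprS; field; rewrite gt_eqF// exprn_gt0.
by rewrite (H J) mutrunc_lt1// addr0.
Qed.

(** Sums [block_moment] over dyadic D <= x. Its bound is K^(s-1) times the power
    1 - k (s - 1) of D, so the largest block decides if s < 1 + 1/k and the
    smallest one if s > 1 + 1/k. *)
Lemma trunc_moment k (s : R) : (2 <= k)%N -> 1 < s -> s < 2 -> s <> 1 + k%:R^-1 ->
  exists2 C : R, 0 < C & forall (A K x : R) b,
    0 <= A -> 1 <= x -> x ^+ k.+1 <= K -> A + K < b%:R ->
    Int 0 1 (fun t => cabs (tp b (fun n => win A K n%:R * mutrunc k x n) t) `^ s) <=
    C * (K `^ (s - 1) * Num.max 1 (x `^ (1 - k%:R * (s - 1)))).
Proof.
move=> k2 s1 s2 sk.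
have s0 : 0 < s by rewrite (lt_trans ltr01).
have k0 : 0 < k%:R :> R by rewrite ltr0n; lia.
set g := 1 - k%:R * (s - 1).
have dn0 : g / s != 0.
  rewrite mulf_neq0 ?invr_neq0 ?(gt_eqF s0)//; apply/eqP => g0; apply: sk.
  have : k%:R * (s - 1) = 1 by move: g0; rewrite /g => /eqP; rewrite subr_eq0 => /eqP.
  move=> H; have -> : s = 1 + (s - 1) by ring.
  by congr (_ + _); apply: (mulfI (lt0r_neq0 k0)); rewrite H mulfV// gt_eqF.
have [C0 C00 HB] := @block_moment R k s k2 s1 s2.
have [C1 C10 HD] := dyadic_sum_le dn0.
exists (C0 * C1 `^ s); first by rewrite mulr_gt0// powR_gt0.
move=> A K x b A0 x1 xK Kb.
have x0 : 0 < x by rewrite (lt_le_trans ltr01).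
have K0 : 0 < K by apply: lt_le_trans xK; rewrite exprn_gt0.
have [I /andP[I1 I2]] := dyadic_scale x1.
have xI : x / 2 ^+ I.+1 < 1 by rewrite ltr_pdivrMr ?exprn_gt0// mul1r.
have Dj j : (j < I.+1)%N -> 1 <= x / 2 ^+ j.
  rewrite ltnS => jI; rewrite ler_pdivlMr ?exprn_gt0// mul1r (le_trans _ I1)//.
  by rewrite ler_weXn2l// ler1n.
pose f (j : nat) t := cabs (tp b (fun n => win A K n%:R * mublk k (x / 2 ^+ j) n) t).
pose a (j : nat) := K `^ ((s - 1) / s) * (x / 2 ^+ j) `^ (g / s).
have pj0 (j : nat) : 0 < x / 2 ^+ j by rewrite divr_gt0// exprn_gt0.
have a0 j : 0 < a j by rewrite mulr_gt0// powR_gt0.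
have E t : cabs (tp b (fun n => win A K n%:R * mutrunc k x n) t) <= \sum_(j < I.+1) f j t.
  rewrite (eq_tp (b := fun n => \sum_(j < I.+1) win A K n%:R * mublk k (x / 2 ^+ j) n)).
    by rewrite tp_sum; exact: cabs_sum.
  by move=> n _; rewrite (mutrunc_dyadic k n (ltW x0) xI) mulr_sumr.
have fi j : (j < I.+1)%N -> Int 0 1 (fun t => f j t `^ s) <= C0 * a j `^ s.
  move=> jI; apply: le_trans (HB A K (x / 2 ^+ j) b A0 (Dj _ jI) _ Kb) _.
    apply: le_trans xK; rewrite lerXn2r ?nnegrE ?(ltW x0) ?(ltW (pj0 _))//.
    rewrite ler_pdivrMr ?exprn_gt0// ler_peMr ?(ltW x0)//.
    by rewrite -[X in X <= _](expr1n _ j) lerXn2r ?nnegrE// ler1n.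
  rewrite ler_wpM2l ?(ltW C00)// /a.
  have y0 := pj0 j; set y := x / 2 ^+ j in y0 *.
  rewrite [X in _ <= X]powRM ?powR_ge0// -!powRrM.
  have -> : (s - 1) / s * s = s - 1 by field; rewrite gt_eqF.
  have -> : g / s * s = g by field; rewrite gt_eqF.
  rewrite powRM ?(ltW K0) ?invr_ge0 ?exprn_ge0 ?(ltW y0)//.
  rewrite mulrCA ler_wpM2l ?powR_ge0//.
  rewrite -powR_mulrn ?(ltW y0)// -powRN -powRrM -[X in X * _]powRr1 ?(ltW y0)// -powRDgt//.
  by rewrite le_eqVlt; apply/orP; left; apply/eqP; congr (_ `^ _); rewrite /g; ring.
apply: (@le_trans _ _ (Int 0 1 (fun t => (\sum_(j < I.+1) f j t) `^ s))).
  have nS : nice (fun t => \sum_(j < I.+1) f j t).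
    by apply: (@nice_sum _ _ _ _ (fun j : 'I_I.+1 => f j)) => j _; exact: nice_tp.
  apply: le_Int.
  - by apply: nice_powR (ltW s0) _; exact: nice_tp.
  - exact: nice_powR (ltW s0) nS.
  - move=> t _; apply: ge0_ler_powR; rewrite ?nnegrE ?(ltW s0) ?cabs_ge0//.
    by apply: sumr_ge0 => j _; exact: cabs_ge0.
apply: (le_trans (Int_powR_sum (ltW s1) a0 _ _ fi)).
- by move=> j t; exact: cabs_ge0.
- by move=> j; exact: nice_tp.
rewrite -mulr_sumr -mulrA ler_wpM2l ?(ltW C00)//.
have S0 : 0 <= \sum_(j < I.+1) (x / 2 ^+ j) `^ (g / s).
  by apply: sumr_ge0 => j _; exact: powR_ge0.
rewrite powRM ?powR_ge0// -powRrM.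
have -> : (s - 1) / s * s = s - 1 by field; rewrite gt_eqF.
rewrite mulrCA ler_wpM2l ?powR_ge0//.
have M0 : 0 <= Num.max 1 (x `^ (g / s)) by rewrite le_max ler01.
apply: (@le_trans _ _ ((C1 * Num.max 1 (x `^ (g / s))) `^ s)).
  by rewrite ge0_ler_powR ?nnegrE ?(ltW s0) ?mulr_ge0 ?(ltW C10)//; exact: HD x1 Dj.
rewrite powRM ?(ltW C10)// ler_wpM2l ?powR_ge0//.
set y := x `^ (g / s); have -> : x `^ g = y `^ s.
  by rewrite /y -powRrM; congr (_ `^ _); field; rewrite gt_eqF.
have [y1|y1] := leP y 1; first by rewrite powR1 le_max lexx.
by rewrite le_max lexx orbT.
Qed.

End TruncatedSums.

(** * The k-free sum and its mean square tail *)

Section Setup.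
Context {R : realType}.
Implicit Types N K x y z s : R.

(** The first integer exceeding N, an exclusive bound for the range of n. *)
Definition bnd (N : R) : nat := (Num.truncn N).+1.

(** Coefficients of the exponential sum over k-free integers and of its two
    parts, the divisors d <= x and the divisors d > x. The upper end N + x + 1
    exceeds x as well as every divisor of an n <= N. *)
Definition cS k N K (n : nat) : R := win (N - K) K n%:R * \1_(kfree k) n.
Definition cf k N K x (n : nat) : R := win (N - K) K n%:R * mutrunc k x n.
Definition cg k N K x (n : nat) : R := win (N - K) K n%:R * (cdiv k n x (N + x + 1))%:~R.

Definition absS k N K (t : R) : R := cabs (tp (bnd N) (cS k N K) t).
Definition absf k N K x (t : R) : R := cabs (tp (bnd N) (cf k N K x) t).
Definition absg k N K x (t : R) : R := cabs (tp (bnd N) (cg k N K x) t).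

Lemma nice_absS k N K : nice (absS k N K). Proof. exact: nice_tp. Qed.
Lemma nice_absf k N K x : nice (absf k N K x). Proof. exact: nice_tp. Qed.
Lemma nice_absg k N K x : nice (absg k N K x). Proof. exact: nice_tp. Qed.
Lemma absS_ge0 k N K t : 0 <= absS k N K t. Proof. exact: cabs_ge0. Qed.
Lemma absf_ge0 k N K x t : 0 <= absf k N K x t. Proof. exact: cabs_ge0. Qed.
Lemma absg_ge0 k N K x t : 0 <= absg k N K x t. Proof. exact: cabs_ge0. Qed.

Lemma bndP N K : 0 <= N -> N - K + K < (bnd N)%:R.
Proof. by move=> N0; rewrite subrK /bnd truncnS_gt. Qed.

Lemma win0 A L : 0 <= A -> win A L 0 = 0 :> R.
Proof. by move=> A0; rewrite win_out//; left. Qed.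

Lemma winE N K (n : nat) : 0 <= N -> (n < bnd N)%N -> win (N - K) K n%:R = (N - K < n%:R)%R%:R.
Proof.
move=> N0; rewrite /bnd ltnS truncn_ge_nat// => nN.
by rewrite /win subrK nN andbT.
Qed.

Lemma expsumE k N K t : 0 <= N -> K <= N -> expsum k N K t = tp (bnd N) (cS k N K) t.
Proof.
move=> N0 KN; rewrite /expsum /tp.
pose F (n : nat) : R[i] := (cS k N K n)%:C * e (n%:R * t).
transitivity (\sum_(0 <= n < bnd N) F n); last by rewrite big_mkord.
rewrite [RHS]big_ltn// {1}/F /cS win0 ?subr_ge0// mul0r mul0r add0r.
rewrite big_mkcond/= !big_nat; apply: eq_bigr => n /andP[n0 nb].
rewrite /F /cS winE//; case: (N - K < n%:R); rewrite ?mul1r// !mul0r//.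
Qed.

Lemma momentE k s N K : 0 <= N -> K <= N -> 0 <= s ->
  moment k s N K = (Int 0 1 (fun t => absS k N K t `^ s))%:E.
Proof.
move=> N0 KN s0; rewrite /moment /Int /Rintegral fineK; last first.
  apply: integrable_fin_num => //; apply: nice_integrable.
  by apply: nice_powR s0 _; exact: nice_absS.
by apply: eq_integral => t _; rewrite expsumE.
Qed.

Lemma kfree_split k N K x n : (2 <= k)%N -> 0 <= N -> K <= N -> 0 <= x -> (n < bnd N)%N ->
  cS k N K n = cf k N K x n + cg k N K x n.
Proof.
move=> k2 N0 KN x0 nb; rewrite /cS /cf /cg -mulrDr.
case: n nb => [|n] nb; first by rewrite win0 ?mul0r// subr_ge0.
congr (_ * _); set z := N + x + 1.
have z0 : 0 <= z by rewrite !addr_ge0.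
have nz : (n.+1 < (Num.truncn z).+1)%N.
  move: nb; rewrite /bnd !ltnS => /leq_trans; apply; apply: le_truncn.
  by rewrite /z -addrA lerDl addr_ge0.
rewrite -(kfree_indic R _ _ nz)//; last by lia.
rewrite (bigID (fun d : nat => x < d%:R))/= addrC; congr (_ + _).
  rewrite /mutrunc [RHS]big_mkcond/=.
  rewrite [RHS](_ : _ = \sum_(1 <= d < (Num.truncn x).+1) if (d ^ k %| n.+1)%N then (moebius d)%:~R else 0); last first.
    by apply: eq_bigr => d _; case: (_ %| _)%N; rewrite ?mulr1 ?mulr0.
  rewrite -big_mkcond/= [LHS](@big_cat_nat _ _ _ (Num.truncn x).+1)//=; last first.
    by rewrite ltnS; apply: le_truncn; rewrite /z -addrA addrCA lerDl addr_ge0.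
  rewrite [X in _ + X]big1_seq ?addr0; last first.
    move=> d /andP[/andP[_]]; rewrite -leNgt mem_index_iota => dx /andP[+ _].
    by rewrite truncn_lt_nat// ltNge dx.
  rewrite big_nat_cond [RHS]big_nat_cond; apply: eq_bigl => d.
  case: (boolP (0 < d < _)%N) => //= /andP[_].
  by rewrite ltnS truncn_ge_nat// -leNgt => ->; rewrite andbT.
rewrite /cdiv rmorph_sum/=; apply: eq_bigl => d; exact: andbC.
Qed.

Lemma tpS_split k N K x t : (2 <= k)%N -> 0 <= N -> K <= N -> 0 <= x ->
  tp (bnd N) (cS k N K) t = tp (bnd N) (cf k N K x) t + tp (bnd N) (cg k N K x) t.
Proof.
move=> k2 N0 KN x0; rewrite -tpD; apply: eq_tp => n nb.
exact: kfree_split.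
Qed.

Lemma absS_le k N K x t : (2 <= k)%N -> 0 <= N -> K <= N -> 0 <= x ->
  absS k N K t <= absf k N K x t + absg k N K x t.
Proof. by move=> k2 N0 KN x0; rewrite /absS (tpS_split t k2 N0 KN x0) cabsD. Qed.

Lemma absg_le k N K x t : (2 <= k)%N -> 0 <= N -> K <= N -> 0 <= x ->
  absg k N K x t <= absS k N K t + absf k N K x t.
Proof.
move=> k2 N0 KN x0; rewrite /absS (tpS_split t k2 N0 KN x0).
rewrite -[X in _ <= _ + X]cabsN (le_trans _ (cabsD _ _))//.
by rewrite addrAC subrr add0r.
Qed.

(** In the range K >= c N^theta a power of N is negligible against a power of K
    with a larger exponent in terms of N. *)
Lemma pow_dom (th c a be : R) : 0 < c -> 0 <= be -> a < th * be ->
  forall ep : R, 0 < ep -> exists2 N0, 1 <= N0 & forall N K, N0 <= N -> c * N `^ th <= K ->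
    N `^ a <= ep * K `^ be.
Proof.
move=> c0 be0 ab ep ep0; set de := th * be - a.
have de0 : 0 < de by rewrite subr_gt0.
set q := (ep * c `^ be)^-1.
have cb0 : 0 < ep * c `^ be by rewrite mulr_gt0// powR_gt0.
have q0 : 0 < q by rewrite invr_gt0.
exists (Num.max 1 (q `^ de^-1)); first by rewrite le_max lexx.
move=> N K; rewrite ge_max => /andP[N1 Nq] NK.
have N0 : 0 < N by rewrite (lt_le_trans ltr01).
have cN0 : 0 < c * N `^ th by rewrite mulr_gt0// powR_gt0.
apply: (@le_trans _ _ (ep * (c * N `^ th) `^ be)); last first.
  rewrite ler_wpM2l ?(ltW ep0)// ge0_ler_powR ?nnegrE ?(ltW cN0)//.
  exact: le_trans (ltW cN0) NK.
rewrite powRM ?(ltW c0) ?powR_ge0// -powRrM mulrA.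
have -> : th * be = a + de by rewrite /de; ring.
rewrite powRDgt// mulrCA ler_peMr ?powR_ge0//.
rewrite -ler_pdivrMl// mulr1 -/q.
have -> : q = (q `^ de^-1) `^ de by rewrite -powRrM mulVf ?gt_eqF// powRr1// ltW.
by rewrite ge0_ler_powR ?nnegrE ?powR_ge0// ltW.
Qed.

(** By Parseval the mean square of g is the sum bounded by a variance exponent;
    its last two terms are of smaller order than K^be by [pow_dom]. *)
Lemma tail_L2 k (D th c be : R) : (2 <= k)%N -> variance_exponent k D ->
  0 < c -> 0 < th -> k%:R^-1 < be -> D < th * be ->
  exists2 C, 0 < C & forall ep, 0 < ep -> exists2 N0, 1 <= N0 & forall N K x,
    N0 <= N -> 1 <= K -> K <= N -> c * N `^ th <= K -> 1 <= x ->
    Int 0 1 (fun t => absg k N K x t ^+ 2) <= C * (K * x `^ (1 - k%:R)) + ep * K `^ be.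
Proof.
move=> k2 vD c0 th0 kb Db.
have ki0 : 0 < k%:R^-1 :> R by rewrite invr_gt0 ltr0n; lia.
have be0 : 0 < be by rewrite (lt_trans ki0).
(* Small enough to be absorbed by both gaps, be - 1/k and th be - D. *)
pose eps := Num.min (th * (be - k%:R^-1)) (th * be - D) / 2.
have m0 : 0 < Num.min (th * (be - k%:R^-1)) (th * be - D).
  by rewrite lt_min mulr_gt0 ?subr_gt0.
have eps0 : 0 < eps by rewrite divr_gt0.
have e1 : eps < th * (be - k%:R^-1).
  by have : eps < Num.min (th * (be - k%:R^-1)) (th * be - D); [rewrite /eps; lra|rewrite lt_min => /andP[]].
have e2 : D + eps < th * be.
  by have : eps < Num.min (th * (be - k%:R^-1)) (th * be - D); [rewrite /eps; lra|rewrite lt_min => /andP[_]; lra].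
have [C HC] := vD _ eps0.
have C1 : 0 < `|C| + 1 by rewrite ltr_wpDl.
exists (`|C| + 1) => // ep ep0.
have ep1 : 0 < ep / (2 * (`|C| + 1)) by rewrite divr_gt0// mulr_gt0.
have b1 : 0 <= be - k%:R^-1 by rewrite subr_ge0 ltW.
have [N1 N11 H1] := pow_dom c0 b1 e1 ep1.
have [N2 N21 H2] := pow_dom c0 (ltW be0) e2 ep1.
exists (Num.max N1 N2); first by rewrite le_max N11.
move=> N K x; rewrite ge_max => /andP[NN1 NN2] K1 KN NK x1.
have N0 : 0 <= N by rewrite (le_trans _ KN)// (le_trans ler01).
have K0 : 0 < K by rewrite (lt_le_trans ltr01).
rewrite parseval.
have xz : x < N + x + 1 by lra.
have := HC N K x _ K1 KN x1 xz.
have -> : \sum_(1 <= n < (Num.truncn N).+1 | N - K < n%:R) `|(cdiv k n x (N + x + 1))%:~R : R| ^+ 2 =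
   \sum_(n < bnd N) cg k N K x n ^+ 2.
  rewrite -(big_mkord xpredT (fun n => cg k N K x n ^+ 2)) [RHS]big_ltn//.
  rewrite {1}/cg win0 ?subr_ge0// mul0r expr0n add0r.
  rewrite big_mkcond/= !big_nat; apply: eq_bigr => n /andP[n0 nb].
  rewrite /cg winE//; case: (N - K < n%:R); rewrite ?mul1r ?mul0r ?expr0n//.
  by rewrite real_normK ?num_real.
move=> H; apply: le_trans H _.
have KE : K `^ be = K `^ (be - k%:R^-1) * K `^ k%:R^-1 by rewrite -powRDgt// subrK.
have T1 : N `^ eps * K `^ k%:R^-1 <= ep / (2 * (`|C| + 1)) * K `^ be.
  by rewrite KE mulrA ler_wpM2r ?powR_ge0//; exact: H1.
have T2 := H2 N K NN2 NK.
have P0 : 0 <= K * x `^ (1 - k%:R) by rewrite mulr_ge0 ?powR_ge0// ltW.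
have P1 : 0 <= N `^ eps * K `^ k%:R^-1 by rewrite mulr_ge0 ?powR_ge0.
have P2 : 0 <= N `^ (D + eps) by rewrite powR_ge0.
apply: (@le_trans _ _ ((`|C| + 1) * (K * x `^ (1 - k%:R) + N `^ eps * K `^ k%:R^-1 + N `^ (D + eps)))).
  rewrite ler_wpM2r ?addr_ge0//.
  by rewrite (le_trans (ler_norm _))// lerDl.
rewrite -addrA mulrDr lerD2l.
apply: (@le_trans _ _ ((`|C| + 1) * (2 * (ep / (2 * (`|C| + 1)) * K `^ be)))).
  rewrite ler_wpM2l ?(ltW C1)//; lra.
rewrite le_eqVlt; apply/orP; left; apply/eqP; field.
by rewrite gt_eqF.
Qed.

End Setup.

(** * Upper bounds for the moments *)

Section UpperBounds.
Context {R : realType}.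
Implicit Types N K x y z s : R.

Lemma sum_win N K : 1 <= K -> K <= N -> \sum_(n < bnd N) win (N - K) K n%:R <= 2 * K.
Proof.
move=> K1 KN; have K0 : 0 <= K by rewrite (le_trans ler01).
have NK0 : 0 <= N - K by rewrite subr_ge0.
have := sum_win_mult (bnd N) (isT : (0 < 1)%N) NK0 K0.
rewrite divr1 => H.
have -> : \sum_(n < bnd N) win (N - K) K n%:R = \sum_(n < bnd N) (1 %| n)%N%:R * win (N - K) K n%:R.
  by apply: eq_bigr => n _; rewrite dvd1n mul1r.
by apply: le_trans H _; lra.
Qed.

Lemma indic01 k n : 0 <= (\1_(kfree k) n : R) <= 1.
Proof. by rewrite indicE; case: (_ \in _); rewrite ?lexx ?ler01. Qed.

Lemma cS_ge0 k N K n : 0 <= cS k N K n.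
Proof. by rewrite mulr_ge0 ?win_ge0//; have /andP[] := indic01 k n. Qed.

Lemma cS_le k N K n : cS k N K n <= win (N - K) K n%:R.
Proof. by rewrite ler_piMr ?win_ge0//; have /andP[] := indic01 k n. Qed.

Lemma sum_cS_le k N K : 1 <= K -> K <= N -> \sum_(n < bnd N) cS k N K n <= 2 * K.
Proof.
move=> K1 KN; apply: le_trans (sum_win K1 KN); apply: ler_sum => n _.
exact: cS_le.
Qed.

Lemma absS_le_sup k N K t : 1 <= K -> K <= N -> absS k N K t <= 2 * K.
Proof.
move=> K1 KN; apply: le_trans (sum_cS_le k K1 KN).
apply: le_trans (cabs_tp_le _ _ _) _; apply: ler_sum => n _.
by rewrite ger0_norm// cS_ge0.
Qed.

(** The trivial bound 2K for all but two of the factors, and Parseval for these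
    two. *)
Lemma upper_ge2 k s N K : 2 <= s -> 1 <= K -> K <= N ->
  Int 0 1 (fun t => absS k N K t `^ s) <= (2 * K) `^ (s - 1).
Proof.
move=> s2 K1 KN; have K0 : 0 < 2 * K by lra.
have s0 : 0 <= s by lra.
have n2 : nice (fun t => absS k N K t ^+ 2) by apply: nice_sqr; exact: nice_absS.
apply: (@le_trans _ _ (Int 0 1 (fun t => (2 * K) `^ (s - 2) * absS k N K t ^+ 2))).
  apply: le_Int; [exact: nice_powR s0 (nice_absS _ _ _)|exact: niceZ|].
  move=> t _; have [->|t0] := eqVneq (absS k N K t) 0.
    by rewrite powR0 ?expr0n ?mulr0//; apply/eqP; lra.
  have t1 : 0 < absS k N K t by rewrite lt_neqAle eq_sym t0 absS_ge0.
  have -> : absS k N K t `^ s = absS k N K t `^ (s - 2) * absS k N K t ^+ 2.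
    by rewrite -powR_mulrn ?absS_ge0// -powRDgt// subrK.
  rewrite ler_wpM2r ?sqr_ge0// ge0_ler_powR ?nnegrE ?absS_ge0 ?(ltW K0)//; first by lra.
  exact: absS_le_sup.
rewrite IntZ// parseval.
have -> : (2 * K) `^ (s - 1) = (2 * K) `^ (s - 2) * (2 * K).
  by rewrite -[X in _ = _ * X]powRr1 ?(ltW K0)// -powRDgt//; congr (_ `^ _); ring.
rewrite ler_wpM2l ?powR_ge0//; apply: le_trans (sum_cS_le k K1 KN).
apply: ler_sum => n _; rewrite /cS exprMn expr2 /win.
case: (_ < _ <= _); rewrite ?mul0r// !mul1r expr2 indicE.
by case: (_ \in _); rewrite ?mul1r ?mul0r.
Qed.

Definition mu_exp k s : R := if s < 1 + k%:R^-1 then s / (k%:R + 1) else s - 1.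

Lemma moment_orderE k s K : moment_order k s K = K `^ (mu_exp k s).
Proof. by rewrite /moment_order /mu_exp; case: ifP. Qed.

(** Split at x = K^(1/(k+1)), the largest value allowed in [trunc_moment]. The
    part f has the expected moment, and g is estimated by its mean square with
    the threshold K^(m/s), the normalized size of S in this mean. *)
Lemma upper_12 k (D th c s : R) : (2 <= k)%N -> variance_exponent k D ->
  0 < c -> 0 < th -> 1 < s -> s < 2 -> s <> 1 + k%:R^-1 ->
  D < th * (2 * mu_exp k s / s) ->
  exists2 C, 0 < C & exists2 N0, 1 <= N0 & forall N K,
    N0 <= N -> 1 <= K -> K <= N -> c * N `^ th <= K ->
    Int 0 1 (fun t => absS k N K t `^ s) <= C * K `^ (mu_exp k s).
Proof.
move=> k2 vD c0 th0 s1 s2 sk; set m := mu_exp k s; set be := 2 * m / s => Db.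
have s0 : 0 < s by lra.
have k2R : 2 <= k%:R :> R by rewrite ler_nat.
have k0 : 0 < k%:R :> R by lra.
have k10 : 0 < k%:R + 1 :> R by lra.
(* The exponent be is at least that of the first term of the tail at
   x = K^(1/(k+1)). *)
have be_ge : 2 / (k%:R + 1) <= be.
  rewrite /be /m /mu_exp; case: ltP => h.
    rewrite le_eqVlt; apply/orP; left; apply/eqP; field; by rewrite !gt_eqF.
  rewrite ler_pdivrMr// mulrAC ler_pdivlMr//.
  have : 1 <= (s - 1) * k%:R by rewrite -ler_pdivrMr// div1r; lra.
  nra.
have kb : k%:R^-1 < be.
  apply: lt_le_trans be_ge; rewrite ltr_pdivlMr// mulrC ltr_pdivrMr//; lra.
have [Cg Cg0 Hg] := tail_L2 k2 vD c0 th0 kb Db.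
have [N0 N01 {}Hg] := Hg 1 ltr01.
have [Cf Cf0 Hf] := trunc_moment k2 s1 s2 sk.
exists (2 `^ (s - 1) * (Cf + (Cg + 2))).
  by rewrite mulr_gt0 ?powR_gt0// !addr_gt0.
exists N0 => // N K NN K1 KN NK.
have K0 : 0 < K by lra.
have N00 : 0 <= N by lra.
set x := K `^ (k%:R + 1)^-1.
have x1 : 1 <= x.
  by rewrite /x -[X in X <= _](powRr0 K) ler_powR// invr_ge0 ltW.
have xK : x ^+ k.+1 <= K.
  rewrite -powR_mulrn ?powR_ge0// /x -powRrM -natr1 mulVf ?gt_eqF//.
  by rewrite powRr1// ltW.
have x0 : 0 <= x by lra.
have Bf : Int 0 1 (fun t => absf k N K x t `^ s) <= Cf * K `^ m.
  have NK0 : 0 <= N - K by rewrite subr_ge0.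
  apply: le_trans (Hf _ K x (bnd N) NK0 x1 xK (bndP K N00)) _.
  rewrite ler_wpM2l ?(ltW Cf0)// /m /mu_exp; case: ltP => h.
    have g0 : 0 <= 1 - k%:R * (s - 1).
      have : (s - 1) * k%:R <= 1 by rewrite -ler_pdivlMr// div1r; lra.
      by lra.
    rewrite max_r; last first.
      by rewrite -[X in X <= _](powRr0 x) ler_powR.
    rewrite /x -powRrM -powRDgt// le_eqVlt; apply/orP; left; apply/eqP.
    by congr (_ `^ _); field; rewrite gt_eqF.
  have g0 : 1 - k%:R * (s - 1) <= 0.
    have : 1 <= (s - 1) * k%:R by rewrite -ler_pdivrMr// div1r; lra.
    by lra.
  rewrite max_l ?mulr1//.
  by rewrite -[X in _ <= X](powRr0 x) ler_powR.
have Bg2 : Int 0 1 (fun t => absg k N K x t ^+ 2) <= (Cg + 1) * K `^ be.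
  apply: le_trans (Hg N K x NN K1 KN NK x1) _.
  rewrite mulrDl lerD2r ler_wpM2l ?(ltW Cg0)//.
  rewrite /x -powRrM -[X in X * _]powRr1 ?(ltW K0)// -powRDgt//.
  rewrite ler_powR//; apply: le_trans be_ge.
  by rewrite le_eqVlt; apply/orP; left; apply/eqP; field; rewrite gt_eqF.
have nS : nice (fun t => absS k N K t `^ s) by apply: nice_powR (ltW s0) (nice_absS _ _ _).
have nf : nice (fun t => absf k N K x t `^ s) by apply: nice_powR (ltW s0) (nice_absf _ _ _ _).
have ng : nice (fun t => absg k N K x t `^ s) by apply: nice_powR (ltW s0) (nice_absg _ _ _ _).
have ng2 : nice (fun t => absg k N K x t ^+ 2) by apply: nice_sqr (nice_absg _ _ _ _).
have Bg : Int 0 1 (fun t => absg k N K x t `^ s) <= (Cg + 2) * K `^ m.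
  set l := K `^ (m / s).
  have l0 : 0 < l by rewrite powR_gt0.
  apply: (@le_trans _ _ (Int 0 1 (fun t => l `^ s + l `^ (s - 2) * absg k N K x t ^+ 2))).
    apply: le_Int => //; first by apply: niceD; [exact: nice_cst|exact: niceZ].
    move=> t _; have := @powR_interp _ (absg k N K x t) l 0 s 2 (absg_ge0 _ _ _ _ _) l0 (lexx _) (ltW s0) (ltW s2).
    by rewrite subr0 powRr0 mulr1 -[_ ^+ 2]powR_mulrn// absg_ge0.
  rewrite IntD; [|exact: nice_cst|exact: niceZ].
  rewrite IntZ// Int_cst// subr0 mulr1.
  apply: le_trans (lerD (lexx _) (ler_wpM2l (powR_ge0 _ _) Bg2)) _.
  rewrite mulrCA /l -!powRrM -powRDgt//.
  have -> : m / s * s = m by field; rewrite gt_eqF.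
  have -> : m / s * (s - 2) + be = m by rewrite /be; field; rewrite gt_eqF.
  by rewrite le_eqVlt; apply/orP; left; apply/eqP; ring.
apply: (@le_trans _ _ (Int 0 1 (fun t => 2 `^ (s - 1) * (absf k N K x t `^ s + absg k N K x t `^ s)))).
  apply: le_Int => //; first by apply: niceZ; exact: niceD.
  move=> t _; apply: (@le_trans _ _ ((absf k N K x t + absg k N K x t) `^ s)).
    by rewrite ge0_ler_powR ?nnegrE ?(ltW s0) ?addr_ge0 ?absS_ge0 ?absf_ge0 ?absg_ge0// absS_le.
  have := @powR_add_le _ 1 1 (absf k N K x t) (absg k N K x t) s ltr01 ltr01 (absf_ge0 _ _ _ _ _) (absg_ge0 _ _ _ _ _) (ltW s1).
  by rewrite !powR1 !mul1r.
rewrite IntZ ?IntD//; last exact: niceD.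
rewrite -mulrA ler_wpM2l ?powR_ge0// mulrDl lerD//.
Qed.

(** Interpolation between the trivial exponent 0 and some q in ]1, 1 + 1/k[,
    with the threshold K^(1/(k+1)). *)
Lemma upper_le1 k (D th c s : R) : (2 <= k)%N -> variance_exponent k D ->
  0 < c -> 0 < th -> 0 < s -> s <= 1 -> D < th * (2 / (k%:R + 1)) ->
  exists2 C, 0 < C & exists2 N0, 1 <= N0 & forall N K,
    N0 <= N -> 1 <= K -> K <= N -> c * N `^ th <= K ->
    Int 0 1 (fun t => absS k N K t `^ s) <= C * K `^ (s / (k%:R + 1)).
Proof.
move=> k2 vD c0 th0 s0 s1 Db.
have k2R : 2 <= k%:R :> R by rewrite ler_nat.
have ki0 : 0 < k%:R^-1 :> R by rewrite invr_gt0; lra.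
have ki1 : k%:R^-1 < 1 :> R by rewrite invf_lt1; lra.
have k10 : 0 < k%:R + 1 :> R by lra.
(* Any exponent strictly between 1 and 1 + 1/k would do. *)
set q : R := 1 + k%:R^-1 / 2.
have q0 : q != 0 by apply/eqP; rewrite /q; lra.
have qk : q < 1 + k%:R^-1 by rewrite /q; lra.
have mq : mu_exp k q = q / (k%:R + 1) by rewrite /mu_exp qk.
have [||||C C0 [N0 N01 H]] := @upper_12 k D th c q k2 vD c0 th0.
- by rewrite /q; lra.
- by rewrite /q; lra.
- by move=> qE; move: qk; rewrite qE ltxx.
- by rewrite mq; have -> : 2 * (q / (k%:R + 1)) / q = 2 / (k%:R + 1) by field; rewrite q0 gt_eqF.
exists (1 + C); first by rewrite addr_gt0.
exists N0 => // N K NN K1 KN NK; have := H N K NN K1 KN NK; rewrite mq => Hq.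
have K0 : 0 < K by lra.
set l := K `^ (k%:R + 1)^-1.
have l0 : 0 < l by rewrite powR_gt0.
have qp : 0 <= q by rewrite /q; lra.
have nq : nice (fun t => absS k N K t `^ q) by apply: nice_powR qp (nice_absS _ _ _).
apply: (@le_trans _ _ (Int 0 1 (fun t => l `^ s + l `^ (s - q) * absS k N K t `^ q))).
  apply: le_Int.
  - exact: nice_powR (ltW s0) (nice_absS _ _ _).
  - by apply: niceD; [exact: nice_cst|exact: niceZ].
  - move=> t _; have sq : s <= q by rewrite /q; lra.
    have := @powR_interp _ (absS k N K t) l 0 s q (absS_ge0 _ _ _ _) l0 (lexx _) (ltW s0) sq.
    by rewrite subr0 powRr0 mulr1.
rewrite IntD; [|exact: nice_cst|exact: niceZ].
rewrite IntZ// Int_cst// subr0 mulr1.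
apply: le_trans (lerD (lexx _) (ler_wpM2l (powR_ge0 _ _) Hq)) _.
rewrite mulrCA /l -!powRrM -powRDgt//.
have -> : (k%:R + 1)^-1 * (s - q) + q / (k%:R + 1) = s / (k%:R + 1) by field; rewrite gt_eqF.
rewrite [_^-1 * s]mulrC le_eqVlt; apply/orP; left; apply/eqP; ring.
Qed.

End UpperBounds.

(** * The contribution of a neighbourhood of 0 *)

Section MajorArc.
Context {R : realType}.
Implicit Types N K x y z s : R.

(** The factor 512 makes 8 K |t| at most 1/64 on the arc, where 8 is the
    Lipschitz constant of [cabs_e1]. *)
Definition arcw K : R := (512 * K)^-1.

Lemma arcw_gt0 K : 1 <= K -> 0 < arcw K.
Proof.
move=> K1; have K512 : 1 <= 512 * K by lra.
by rewrite /arcw invr_gt0; exact: lt_le_trans ltr01 K512.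
Qed.

Lemma arcwM K : 1 <= K -> K * arcw K = 512^-1.
Proof.
move=> K1; have K0 : K != 0 by rewrite gt_eqF// (lt_le_trans ltr01).
by rewrite /arcw; field.
Qed.

Lemma arcw_le1 K : 1 <= K -> arcw K <= 1.
Proof.
move=> K1; have h0 := arcw_gt0 K1; have := arcwM K1.
have : arcw K <= K * arcw K by rewrite ler_peMl// ltW.
lra.
Qed.

(** The divisor 1 contributes about K, and the rest removes at most 3/4 of it. *)
Lemma sum_cf_ge k N K x : (2 <= k)%N -> 0 <= K -> K <= N -> 1 <= x ->
  K / 4 - 1 - x <= \sum_(n < bnd N) cf k N K x n.
Proof.
move=> k2 K0 KN x1.
have N0 : 0 <= N by rewrite (le_trans K0).
have NK0 : 0 <= N - K by rewrite subr_ge0.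
have NKN : N - K <= N by rewrite gerBl.
have x0 : 0 <= x by lra.
have E : \sum_(n < bnd N) cf k N K x n =
    \sum_(1 <= d < (Num.truncn x).+1) (moebius d)%:~R * nmult (d ^ k) (N - K) N (bnd N).
  under eq_bigr do rewrite /cf /mutrunc mulr_sumr.
  rewrite exchange_big/=; apply: eq_bigr => d _.
  rewrite /nmult mulr_sumr; apply: eq_bigr => n _.
  by rewrite mulrCA /win subrK -natrM mulnb.
rewrite E big_ltn; last by rewrite ltnS truncn_ge_nat.
rewrite moebius1 mul1r exp1n.
have B1 : K - 1 <= nmult 1 (N - K) N (bnd N).
  have := nmult_ge (isT : (0 < 1)%N) NK0 NKN (truncnS_gt N).
  by rewrite divr1 opprB addrCA subrr addr0.
have B2 : - (K * (3 / 4) + x) <=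
    \sum_(2 <= d < (Num.truncn x).+1) (moebius d)%:~R * nmult (d ^ k) (N - K) N (bnd N).
  apply: (@le_trans _ _ (\sum_(2 <= d < (Num.truncn x).+1) - (K * d%:R ^- k + 1))).
    rewrite sumrN lerN2 big_split/= -mulr_sumr; apply: lerD.
      by rewrite ler_wpM2l// sum_inv_pow.
    rewrite sumr_const_nat.
    apply: (@le_trans _ _ (Num.truncn x)%:R); first by rewrite ler_nat; lia.
    exact: card_le_real.
  rewrite !big_nat; apply: ler_sum => d /andP[d2 dx].
  have dk0 : (0 < d ^ k)%N by rewrite expn_gt0 (leq_trans _ d2).
  have H := nmult_le (bnd N) dk0 NK0 NKN.
  have H0 : 0 <= nmult (d ^ k) (N - K) N (bnd N) by rewrite sumr_ge0.
  apply: (@le_trans _ _ (- nmult (d ^ k) (N - K) N (bnd N))).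
    rewrite lerN2; apply: le_trans H _.
    by rewrite natrX lerD2r; have -> : N - (N - K) = K by lra.
  have := normr_moebiusR (R := R) d; rewrite ler_norml => /andP[m1 _].
  by rewrite -mulN1r ler_wpM2r.
lra.
Qed.

(** The divisors d <= x contribute about K / 4 by [sum_cf_ge]; for a large
    constant x the others have a small mean square. *)
Lemma kfree_count k (D th c : R) : (2 <= k)%N -> variance_exponent k D ->
  0 < c -> 0 < th -> D < th ->
  exists2 N0, 1 <= N0 & forall N K,
    N0 <= N -> 1 <= K -> K <= N -> c * N `^ th <= K ->
    K / 16 <= \sum_(n < bnd N) cS k N K n.
Proof.
move=> k2 vD c0 th0 Dth.
have k2R : 2 <= k%:R :> R by rewrite ler_nat.
have kb : k%:R^-1 < 1 :> R by rewrite invf_lt1; lra.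
have Db : D < th * 1 by rewrite mulr1.
have [C C0 HC] := tail_L2 k2 vD c0 th0 kb Db.
have e0 : 0 < 256^-1 :> R by rewrite invr_gt0 ltr0n.
have [N1 N11 {}HC] := HC _ e0.
pose x := 256 * C + 1.
have x1 : 1 <= x by rewrite /x; nra.
have x0 : 0 < x by lra.
pose ep := (16 * (2 + x))^-1.
have ep0 : 0 < ep by rewrite invr_gt0 mulr_gt0// addr_gt0.
have th0' : 0 < th * 1 by rewrite mulr1.
have [N2 N21 HN2] := pow_dom c0 ler01 th0' ep0.
exists (Num.max N1 N2); first by rewrite le_max N11.
move=> N K; rewrite ge_max => /andP[NN1 NN2] K1 KN NK.
have K0 : 0 < K by lra.
have N0 : 0 <= N by lra.
have KL : 16 * (2 + x) <= K.
  have := HN2 N K NN2 NK; rewrite powRr0 powRr1 ?(ltW K0)// /ep.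
  by rewrite ler_pdivlMl ?mulr1// mulr_gt0// addr_gt0.
have := HC N K x NN1 K1 KN NK x1; rewrite parseval powRr1 ?(ltW K0)// => Hg.
have xk : C * x `^ (1 - k%:R) <= 256^-1.
  apply: (@le_trans _ _ (C * x `^ (-1))).
    by rewrite ler_wpM2l ?(ltW C0)// ler_powR//; lra.
  rewrite powR_inv1 ?(ltW x0)// ler_pdivrMr// /x; lra.
have Hg2 : \sum_(n < bnd N) cg k N K x n ^+ 2 <= K / 128.
  apply: le_trans Hg _.
  have : K * (C * x `^ (1 - k%:R)) <= K * 256^-1 by rewrite ler_wpM2l ?(ltW K0).
  by rewrite mulrCA; lra.
(* Pointwise v >= - (1/32 + 8 v^2), by completing the square. *)
have HG : - (K / 8) <= \sum_(n < bnd N) cg k N K x n.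
  apply: (@le_trans _ _ (\sum_(n < bnd N) - (win (N - K) K n%:R / 32 + 8 * cg k N K x n ^+ 2))).
    rewrite sumrN lerN2 big_split/= -mulr_suml -mulr_sumr.
    have := sum_win K1 KN; have := Hg2; lra.
  apply: ler_sum => n _; rewrite /cg /win; case: (_ < _ <= _); last by rewrite !mul0r expr0n/= mulr0 addr0 oppr0.
  rewrite !mul1r; move: (_%:~R) => v.
  rewrite -subr_ge0 opprK.
  have -> : v + (32^-1 + 8 * v ^+ 2) = 8 * (v + 16^-1) ^+ 2 by field.
  by rewrite mulr_ge0// sqr_ge0.
have -> : \sum_(n < bnd N) cS k N K n =
    \sum_(n < bnd N) cf k N K x n + \sum_(n < bnd N) cg k N K x n.
  rewrite -big_split/=; apply: eq_bigr => n _.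
  by apply: kfree_split => //; exact: ltW.
have := sum_cf_ge k2 (ltW K0) KN x1; lra.
Qed.

(** After multiplication by e(- N t) all terms are nearly equal to 1, because n
    varies over an interval of length K. *)
Lemma major_arc k N K t : 1 <= K -> K <= N ->
  K / 16 <= \sum_(n < bnd N) cS k N K n -> `|t| <= arcw K ->
  K / 32 <= absS k N K t.
Proof.
move=> K1 KN HS Ht; have K0 : 0 < K by lra.
pose G : R[i] := \sum_(n < bnd N) (cS k N K n)%:C * e ((n%:R - N) * t).
have E : tp (bnd N) (cS k N K) t = e (N * t) * G.
  rewrite /tp /G mulr_sumr; apply: eq_bigr => n _.
  by rewrite mulrCA -eD; congr (_ * e _); ring.
rewrite /absS E cabsM cabs_e mul1r.
pose S0 := \sum_(n < bnd N) cS k N K n.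
have S00 : 0 <= S0 by rewrite sumr_ge0// => n _; exact: cS_ge0.
have H1 : cabs (S0%:C - G) <= K / 32.
  rewrite /S0 /G rmorph_sum/= -sumrB.
  apply: le_trans (cabs_sum _ _ _) _.
  apply: (@le_trans _ _ (\sum_(n < bnd N) cS k N K n * 64^-1)).
    apply: ler_sum => n _.
    rewrite -[X in X - _]mulr1 -mulrBr cabsM cabs_real ger0_norm ?cS_ge0//.
    have [wn|wn] := eqVneq (win (N - K) K n%:R) 0.
      by rewrite /cS wn !mul0r.
    rewrite ler_wpM2l ?cS_ge0// cabsB; apply: le_trans (cabs_e1 _) _.
    have : N - K < n%:R <= N.
      by move: wn; rewrite /win subrK; case: (_ < _ <= _); rewrite ?eqxx.
    move=> /andP[n1 n2].
    have nN : `|n%:R - N| <= K by rewrite ler_norml; lra.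
    rewrite normrM.
    have : `|n%:R - N| * `|t| <= K * arcw K by rewrite ler_pM.
    rewrite (arcwM K1); lra.
  rewrite -mulr_suml; have := sum_cS_le k K1 KN; lra.
have := cabs_ge_sub S0%:C (S0%:C - G).
have -> : S0%:C - (S0%:C - G) = G by rewrite opprB addrC subrK.
rewrite cabs_real ger0_norm//; rewrite /S0 in HS *; lra.
Qed.

Lemma lower_major k s N K : 0 < s -> 1 <= K -> K <= N ->
  K / 16 <= \sum_(n < bnd N) cS k N K n ->
  (512 * 32 `^ s)^-1 * K `^ (s - 1) <= Int 0 1 (fun t => absS k N K t `^ s).
Proof.
move=> s0 K1 KN HS; have K0 : 0 < K by lra.
set h := arcw K; have h0 : 0 < h := arcw_gt0 K1; have h1 := arcw_le1 K1.
have nS : nice (fun t => absS k N K t `^ s) by apply: nice_powR (ltW s0) (nice_absS _ _ _).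
apply: (@le_trans _ _ (Int 0 h (fun t => absS k N K t `^ s))); last first.
  by apply: le_Int_itv => // t; exact: powR_ge0.
apply: (@le_trans _ _ (Int 0 h (fun=> (K / 32) `^ s))).
  rewrite Int_cst ?(ltW h0)// subr0.
  have i32 : 0 <= 32^-1 :> R by rewrite invr_ge0.
  rewrite (powRM _ (ltW K0) i32).
  have -> : 32^-1 `^ s = (32 `^ s)^-1 :> R.
    by rewrite -powR_inv1// -powRrM mulN1r powRN.
  rewrite powRBgt// powRr1 ?(ltW K0)// invfM.
  have -> : 512^-1 = K * h by rewrite arcwM.
  have K0' : K != 0 by rewrite gt_eqF.
  move: (32 `^ s)^-1 (K `^ s) => u v.
  by have -> : K * h * u * (v / K) = v * u * h by field.
apply: le_Int => //; first exact: nice_cst.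
move=> t /andP[t0 th]; rewrite ge0_ler_powR ?nnegrE ?(ltW s0) ?absS_ge0//.
  by rewrite divr_ge0// ltW.
by apply: major_arc => //; rewrite ger0_norm.
Qed.

End MajorArc.

(** * Averages over translates by fractions *)

Section TwistedSums.
Context {R : realType}.
Implicit Types N K x y z s : R.

(** The weights that [twist] produces, by [kfree_ramanujan]: an analogue of the
    Ramanujan sum in which d is replaced by d^k. *)
Definition ram (k d n : nat) : R :=
  \sum_(b < d.+1 | (b %| d)%N) (moebius (d %/ b))%:~R * (b ^ k)%:R * (b ^ k %| n)%:R.

(** For squarefree d the fractions a / d^k that occur are the analogue, for kth
    powers, of the reduced fractions modulo d: they do not come from a smaller
    kth power in the denominator. *)
Definition twist (k d : nat) (F : R -> R[i]) (t : R) : R[i] :=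
  \sum_(a < d ^ k) (\1_(kfree k) (gcdn a (d ^ k)) : R)%:C * F (a%:R / (d ^ k)%:R + t).

Lemma twist_tp k d B (c : nat -> R) t : (2 <= k)%N -> (0 < d)%N ->
  twist k d (tp B c) t = tp B (fun n => c n * ram k d n) t.
Proof.
move=> k2 d0; rewrite /twist /tp.
under eq_bigr do rewrite mulr_sumr.
rewrite exchange_big/=; apply: eq_bigr => n _.
rewrite rmorphM/= /ram -kfree_ramanujan// mulr_sumr mulr_suml.
by apply: eq_bigr => a _; rewrite mulrDr eD; ring.
Qed.

(** Only b = 1 satisfies b^k | n. *)
Lemma ram_kfree k d n : (2 <= k)%N -> (0 < d)%N -> n \in kfree k ->
  ram k d n = (moebius d)%:~R.
Proof.
move=> k2 d0; rewrite inE /kfree/= => kf; rewrite /ram.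
have d1 : (1 < d.+1)%N by [].
rewrite (bigD1 (Ordinal d1))//= exp1n dvd1n !mulr1 divn1 big1 ?addr0//.
move=> b /andP[bd b1].
have b2 : (1 < b)%N.
  rewrite ltn_neqAle (dvdn_gt0 d0 bd) andbT eq_sym.
  by apply: contra b1 => /eqP b1; apply/eqP/val_inj.
case: (boolP (b ^ k %| n)%N) => bn; last by rewrite mulr0.
have := kf _ (pdiv_prime b2).
by rewrite (dvdn_trans _ bn)// dvdn_exp2r// pdiv_dvd.
Qed.

(** All n occurring in the sum are k-free, where the weights are constant. *)
Lemma twist_S k d N K t : (2 <= k)%N -> (0 < d)%N ->
  twist k d (tp (bnd N) (cS k N K)) t = ((moebius d)%:~R : R)%:C * tp (bnd N) (cS k N K) t.
Proof.
move=> k2 d0; rewrite twist_tp// -tpZ; apply: eq_tp => n _.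
rewrite /cS indicE; case: (boolP (n \in kfree k)) => [nk|_]; last by rewrite !mulr0 mul0r.
by rewrite ram_kfree// mulrC.
Qed.

(** Passing to the complementary divisor, the terms are d^k / b^k, and the sum
    of the b^(-k) is at most 1 + 3/4. *)
Lemma sum_div_pow k d : (2 <= k)%N -> (0 < d)%N ->
  \sum_(b < d.+1 | (b %| d)%N) (b ^ k)%:R <= 2 * (d ^ k)%:R :> R.
Proof.
move=> k2 d0.
pose h (b : 'I_d.+1) : 'I_d.+1 := inord (d %/ b).
have hE (b : 'I_d.+1) : h b = (d %/ b)%N :> nat by rewrite inordK// ltnS leq_div.
rewrite (reindex_onto h h)/=; last first.
  by move=> b bd; apply: val_inj; rewrite /= !hE divnA// mulKn.
apply: (@le_trans _ _ (\sum_(1 <= b < d.+1) (d ^ k)%:R * b%:R ^- k)).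
  rewrite [X in X <= _]big_mkcond/= big_ord_recl hE divn0 dvd0n gtn_eqF//= add0r.
  rewrite [X in _ <= X]big_add1/= big_mkord; apply: ler_sum => b _.
  case: ifP => [/andP[bd /eqP bE]|_]; last by rewrite divr_ge0// exprn_ge0.
  have {}bE : (d %/ (d %/ b.+1) = b.+1)%N by rewrite -[RHS](congr1 val bE) /= !hE.
  have bd' : (b.+1 %| d)%N by rewrite -bE dvdn_div//; move: bd; rewrite hE.
  rewrite hE ler_pdivlMr ?exprn_gt0// -!natrX -natrM -expnMn.
  by rewrite divnK// ler_nat leq_exp2l // lexx.
rewrite -mulr_sumr mulrC ler_wpM2r// big_ltn// expr1n invr1.
by have := @sum_inv_pow R k d.+1 k2; lra.
Qed.

(** Summation by parts. *)
Lemma abel_sum (u : nat -> R) (v : nat -> R[i]) (q : R) m :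
  (forall j, `|\sum_(i < j) u i| <= q) -> (forall i, cabs (v i) <= 1) ->
  cabs (\sum_(i < m) (u i)%:C * v i) <= q + q * \sum_(i < m) cabs (v i.+1 - v i).
Proof.
move=> Hu Hv; have q0 : 0 <= q by apply: le_trans (Hu 0%N).
pose U j := \sum_(i < j) u i.
have H j : cabs (\sum_(i < j) (u i)%:C * v i - (U j)%:C * v j) <= q * \sum_(i < j) cabs (v i.+1 - v i).
  elim: j => [|j IH]; first by rewrite /U !big_ord0 mul0r subr0 cabs0 mulr0.
  rewrite !big_ord_recr/= mulrDr.
  have -> : \sum_(i < j) (u i)%:C * v i + (u j)%:C * v j - (U j.+1)%:C * v j.+1 =
     (\sum_(i < j) (u i)%:C * v i - (U j)%:C * v j) - (U j.+1)%:C * (v j.+1 - v j).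
    by rewrite /U big_ord_recr/= rmorphD/=; ring.
  apply: le_trans (cabsD _ _) _; rewrite cabsN cabsM cabs_real lerD//.
  by rewrite ler_wpM2r ?cabs_ge0//; exact: Hu.
rewrite -[X in cabs X](subrK ((U m)%:C * v m)).
apply: le_trans (cabsD _ _) _; rewrite addrC lerD//.
by rewrite cabsM cabs_real; have := ler_pM (normr_ge0 _) (cabs_ge0 _) (Hu m) (Hv m); rewrite mulr1.
Qed.

(** The multiples of q carry a fraction 1/q of the exponential sum over an
    interval on which e(n t) is nearly constant: the partial sums of q [q | n] - 1
    are at most q in absolute value, and e(n t) has variation at most 1. *)
Lemma sum_e_mult N K t q : 1 <= K -> K <= N -> (0 < q)%N -> `|t| <= arcw K ->
  cabs (tp (bnd N) (fun n => win (N - K) K n%:R * (q %| n)%:R) t -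
    (q%:R^-1)%:C * tp (bnd N) (fun n => win (N - K) K n%:R) t) <= 2.
Proof.
move=> K1 KN q0 Ht; have K0 : 0 < K by lra.
have NK0 : 0 <= N - K by rewrite subr_ge0.
have N0 : 0 <= N by lra.
set a := Num.truncn (N - K).
have NKN : N - K <= N by lra.
have qR : 0 < q%:R :> R by rewrite ltr0n.
pose u (i : nat) : R := (q%:R * (q %| (a + i.+1))%:R - 1).
pose v (i : nat) : R[i] := e ((a + i.+1)%:R * t).
have aN : (a <= Num.truncn N)%N by apply: le_truncn.
have wE i : (i < Num.truncn N - a)%N -> win (N - K) K (a + i.+1)%:R = 1.
  move=> iN; rewrite win_in ?subrK//.
    by rewrite -truncn_lt_nat// addnS ltnS leq_addr.
  by rewrite -truncn_ge_nat//; lia.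
have E (c : nat -> R) : tp (bnd N) (fun n => win (N - K) K n%:R * c n) t =
    \sum_(i < Num.truncn N - a) (c (a + i.+1)%N)%:C * v i.
  rewrite /tp; have -> : bnd N = (a.+1 + (Num.truncn N - a))%N by rewrite /bnd; lia.
  rewrite big_split_ord/= big1 ?add0r => [|i _]; last first.
    rewrite win_out ?mul0r//; left; have /andP[+ _] := truncn_itv NK0; apply: le_trans.
    by rewrite ler_nat -ltnS.
  by apply: eq_bigr => i _; rewrite /v addSnnS wE// mul1r.
have HU j : `|\sum_(i < j) u i| <= q%:R.
  have -> : \sum_(i < j) u i = (a %% q)%:R - ((a + j) %% q)%:R.
    elim: j => [|j IH]; first by rewrite big_ord0 addn0 subrr.
    rewrite big_ord_recr/= IH /u addnS modnS.
    case: (boolP (q %| (a + j).+1)%N) => Hq; last by rewrite mulr0 -natr1; ring.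
    have Hq' : (q %| (a + j) %/ q * q + ((a + j) %% q).+1)%N by rewrite addnS -divn_eq.
    rewrite dvdn_addr ?dvdn_mull// in Hq'.
    have qE : q = ((a + j) %% q).+1 by apply/eqP; rewrite eqn_leq ltn_pmod// dvdn_leq.
    have qE' : q%:R = ((a + j) %% q)%:R + 1 :> R by rewrite {1}qE -natr1.
    by rewrite /= qE'; ring.
  have := ltn_pmod a q0; have := ltn_pmod (a + j) q0.
  rewrite -!(ltr_nat R) => h1 h2.
  have := ler0n R (a %% q); have := ler0n R ((a + j) %% q).
  by rewrite ler_norml; lra.
have -> : tp (bnd N) (fun n => win (N - K) K n%:R) t = tp (bnd N) (fun n => win (N - K) K n%:R * 1) t.
  by apply: eq_tp => n _; rewrite mulr1.
rewrite !E.
have -> : \sum_(i < Num.truncn N - a) (((q %| a + i.+1)%N)%:R)%:C * v i -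
   (q%:R^-1)%:C * (\sum_(i < Num.truncn N - a) (1 : R)%:C * v i) =
   (q%:R^-1)%:C * \sum_(i < Num.truncn N - a) (u i)%:C * v i.
  rewrite !mulr_sumr -sumrB; apply: eq_bigr => i _.
  rewrite !mulrA -mulrBl -!rmorphM -rmorphB/=; congr (_%:C * _).
  by rewrite /u; field; rewrite gt_eqF.
rewrite cabsM cabs_real ger0_norm ?invr_ge0 ?(ltW qR)//.
rewrite ler_pdivrMl//.
have Hv i : cabs (v i) <= 1 by rewrite cabs_e.
apply: le_trans (abel_sum (Num.truncn N - a) HU Hv) _.
have dv i : cabs (v i.+1 - v i) <= 8 * arcw K.
  rewrite /v addnS -natr1 mulrDl mul1r eD -[X in _ - X]mulr1 -mulrBr cabsM cabs_e mul1r.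
  by apply: le_trans (cabs_e1 _) _; rewrite ler_wpM2l.
have S : \sum_(i < Num.truncn N - a) cabs (v i.+1 - v i) <= 1.
  apply: (@le_trans _ _ (\sum_(i < Num.truncn N - a) 8 * arcw K)).
    by apply: ler_sum => i _; exact: dv.
  rewrite sumr_const card_ord -[_ *+ (_ - _)]mulr_natr natrB//.
  have : (Num.truncn N)%:R <= N by exact: card_le_real.
  have : N - K < a%:R + 1 by rewrite natr1 truncnS_gt.
  move=> h1 h2.
  apply: (@le_trans _ _ (8 * arcw K * (2 * K))).
    rewrite ler_wpM2l//; last by lra.
    by rewrite mulr_ge0// ltW// arcw_gt0.
  have -> : 8 * arcw K * (2 * K) = 16 * (K * arcw K) by ring.
  rewrite (arcwM K1); lra.
have := ler_wpM2l (ltW qR) S; lra.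
Qed.

(** The divisors d' <= x < d contribute to the twist only through boundary
    effects: their main terms cancel by [sum_moebius_gcd]. *)
Lemma twist_f k d N K x t : (2 <= k)%N -> sqfree d -> 1 <= K -> K <= N -> 0 <= x ->
  x < d%:R -> `|t| <= arcw K ->
  cabs (twist k d (tp (bnd N) (cf k N K x)) t) <= 4 * x * (d ^ k)%:R.
Proof.
move=> k2 sf K1 KN x0 xd Ht; have d0 : (0 < d)%N by case/andP: sf.
pose E (q : nat) := tp (bnd N) (fun n => win (N - K) K n%:R * (q %| n)%:R) t.
pose E1 := tp (bnd N) (fun n => win (N - K) K n%:R) t.
pose m (b d' : nat) : R := (moebius d')%:~R * ((moebius (d %/ b))%:~R * (b ^ k)%:R).
pose q (b d' : nat) := lcmn (d' ^ k) (b ^ k).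
have -> : twist k d (tp (bnd N) (cf k N K x)) t =
    \sum_(1 <= d' < (Num.truncn x).+1) \sum_(b < d.+1 | (b %| d)%N)
      (m b d')%:C * E (q b d').
  rewrite twist_tp//.
  rewrite (eq_tp (b := fun n => \sum_(1 <= d' < (Num.truncn x).+1)
    \sum_(b < d.+1 | (b %| d)%N) m b d' * (win (N - K) K n%:R * (q b d' %| n)%:R))).
    rewrite tp_sum; apply: eq_bigr => d' _; rewrite tp_sum; apply: eq_bigr => b _.
    by rewrite tpZ.
  move=> n _; rewrite /cf /mutrunc [win _ _ _ * _]mulr_sumr mulr_suml; apply: eq_bigr => d' _.
  rewrite /ram mulr_sumr; apply: eq_bigr => b _.
  rewrite /q dvdn_lcm -mulnb natrM /m; ring.
have main : \sum_(1 <= d' < (Num.truncn x).+1) \sum_(b < d.+1 | (b %| d)%N)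
      (m b d')%:C * (((q b d')%:R^-1)%:C * E1) = 0.
  rewrite big_nat big1// => d' /andP[d'0 d'x].
  have dd' : ~~ (d %| d')%N.
    apply/negP => /(dvdn_leq d'0); rewrite leqNgt => /negP; apply.
    rewrite -(ltr_nat R); apply: le_lt_trans xd.
    by move: d'x; rewrite ltnS truncn_ge_nat.
  have := @sum_moebius_gcd R k d d' sf dd' => H.
  transitivity ((\sum_(b < d.+1 | (b %| d)%N) m b d' * (q b d')%:R^-1)%:C * E1).
    rewrite rmorph_sum/= mulr_suml; apply: eq_bigr => b _.
    by rewrite mulrA; congr (_ * _); rewrite -[LHS](rmorphM (real_complex R)).
  suff -> : \sum_(b < d.+1 | (b %| d)%N) m b d' * (q b d')%:R^-1 =
     ((moebius d')%:~R / (d' ^ k)%:R) *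
     \sum_(b < d.+1 | (b %| d)%N) (moebius (d %/ b))%:~R * (gcdn b d' ^ k)%:R.
    by rewrite H mulr0 mul0r.
  rewrite mulr_sumr; apply: eq_bigr => b bd.
  have b0 : (0 < b)%N by apply: dvdn_gt0 bd.
  have qE : (q b d' * gcdn b d' ^ k = d' ^ k * b ^ k)%N.
    by rewrite gcdnX// gcdnC muln_lcm_gcd.
  have bk : (b ^ k)%:R != 0 :> R by rewrite pnatr_eq0 -lt0n expn_gt0 b0.
  have dk : (d' ^ k)%:R != 0 :> R by rewrite pnatr_eq0 -lt0n expn_gt0 d'0.
  have q0 : (q b d')%:R != 0 :> R.
    by rewrite pnatr_eq0 -lt0n lcmn_gt0 !expn_gt0 b0 d'0.
  have : (q b d')%:R * (gcdn b d' ^ k)%:R = (d' ^ k)%:R * (b ^ k)%:R :> R.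
    by rewrite -!natrM qE.
  move=> /(canRL (mulKf q0)) ->.
  by rewrite /m; field; rewrite q0 dk.
rewrite -[X in cabs X]subr0 -[X in cabs (_ - X)]main -sumrB.
apply: le_trans (cabs_sum _ _ _) _.
apply: (@le_trans _ _ (\sum_(1 <= d' < (Num.truncn x).+1) 4 * (d ^ k)%:R)); last first.
  rewrite sumr_const_nat subSS subn0 -[_ *+ Num.truncn x]mulr_natr mulrAC.
  by rewrite ler_wpM2r// ler_wpM2l// card_le_real.
rewrite !big_nat; apply: ler_sum => d' /andP[d'0 d'x]; rewrite -sumrB.
apply: le_trans (cabs_sum _ _ _) _.
apply: (@le_trans _ _ (\sum_(b < d.+1 | (b %| d)%N) 2 * (b ^ k)%:R)); last first.
  by rewrite -mulr_sumr; have := @sum_div_pow k d k2 d0; lra.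
apply: ler_sum => b bd; have b0 : (0 < b)%N by apply: dvdn_gt0 bd.
rewrite -mulrBr cabsM cabs_real [X in _ <= X]mulrC.
rewrite ler_pM ?cabs_ge0//; last first.
  by apply: sum_e_mult => //; rewrite /q lcmn_gt0 !expn_gt0 b0 d'0.
rewrite /m !normrM [`|(b ^ k)%:R|]ger0_norm// mulrA ler_piMl//.
by rewrite mulr_ile1// normr_moebiusR.
Qed.

End TwistedSums.

(** * Close fractions *)

Section CloseFractions.

(** Pairs of fractions at a prescribed small distance: with g = gcd(q1, q2), q1
    = g r1 and q2 = g r2, the signed numerator of the difference of a / q1 and
    a' / q2, divided by g, and the quotient of a by r1 determine the pair. *)
Lemma count_close_nat (g r1 r2 V : nat) : (0 < r1)%N -> coprime r1 r2 ->
  (#|[pred p : 'I_(g * r1) * 'I_(g * r2) |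
     0 < (p.1 * r2 - p.2 * r1) + (p.2 * r1 - p.1 * r2) <= V]| <= g * (V + V))%N.
Proof.
move=> r10 co; set A := [pred _ | _].
(* The sign of the numerator is encoded by the shift by V. *)
pose f (p : 'I_(g * r1) * 'I_(g * r2)) : nat * nat :=
  ((p.1 %/ r1)%N, if (p.2 * r1 <= p.1 * r2)%N then (p.1 * r2 - p.2 * r1).-1
                  else (V + (p.2 * r1 - p.1 * r2).-1)%N).
have Ain p : (p \in A) =
    (0 < (p.1 * r2 - p.2 * r1) + (p.2 * r1 - p.1 * r2) <= V)%N by [].
have finj : {in A &, injective f}.
  move=> p1 p2; rewrite !Ain; move: p1 p2.
  move=> [[a1 la1] [b1 lb1]] [[a2 la2] [b2 lb2]] /= c1 c2 [Eq].
  move=> Ew.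
  have E : (a1 * r2 + b2 * r1 = a2 * r2 + b1 * r1)%N.
    by move: Ew; case: ifPn => h1; case: ifPn => h2; lia.
  have H (x1 x2 y1 y2 : nat) : (x1 %/ r1 = x2 %/ r1)%N -> (x2 <= x1)%N ->
      (x1 * r2 + y2 * r1 = x2 * r2 + y1 * r1)%N -> x1 = x2 /\ y1 = y2.
    move=> Eq' le EE.
    have D : (r1 %| (x1 - x2) * r2)%N.
      have -> : ((x1 - x2) * r2 = (y1 - y2) * r1)%N by rewrite !mulnBl; lia.
      exact: dvdn_mull.
    rewrite Gauss_dvdl// in D.
    have lt : (x1 - x2 < r1)%N.
      by have := divn_eq x1 r1; have := divn_eq x2 r1; have := ltn_pmod x1 r10; rewrite Eq'; lia.
    have x12 : x1 = x2.
      have : (x1 - x2 = 0)%N by apply/eqP; rewrite -leqn0 leqNgt; apply/negP => h; have := dvdn_leq h D; lia.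
      by lia.
    split=> //; move: EE; rewrite x12 => /eqP; rewrite eqn_add2l eqn_pmul2r// => /eqP.
    by move=> ->.
  have [le|le] := leqP a2 a1.
    have [? ?] := H _ _ _ _ Eq le E; congr (_, _); exact: val_inj.
  have [? ?] := H _ _ _ _ (esym Eq) (ltnW le) (esym E); congr (_, _); exact: val_inj.
pose s := [seq f p | p <- enum A].
have us : uniq s.
  rewrite map_inj_in_uniq ?enum_uniq// => p1 p2; rewrite !mem_enum; exact: finj.
have -> : #|A| = size s by rewrite size_map cardE.
have -> : (g * (V + V) = size [seq (i, w) | i <- iota 0 g, w <- iota 0 (V + V)])%N.
  by rewrite size_allpairs !size_iota.
apply: uniq_leq_size us _ => p /mapP[[a b]]; rewrite mem_enum Ain => /= c ->.
have la := ltn_ord a.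
apply/allpairsP; eexists (_, _); split=> [||//]; rewrite mem_iota/= add0n.
  by rewrite ltn_divLR.
by case: ifPn => h; lia.
Qed.

(** The numbers a q2 and b q1 are multiples of gcd(q1, q2), which reduces the
    bound to [count_close_nat]. *)
Lemma count_close (R : realType) (q1 q2 : nat) (H : R) : (0 < q1)%N -> (0 < q2)%N -> 0 <= H ->
  \sum_(a < q1) \sum_(b < q2)
    (((a * q2 != b * q1)%N && (`|(a * q2)%:R - (b * q1)%:R| <= H)) : bool)%:R <= 2 * H.
Proof.
move=> q10 q20 H0.
set g := gcdn q1 q2.
have g0 : (0 < g)%N by rewrite gcdn_gt0 q10.
have [r1 q1E] : exists r1, q1 = (g * r1)%N.
  by exists (q1 %/ g)%N; rewrite mulnC divnK// dvdn_gcdl.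
have [r2 q2E] : exists r2, q2 = (g * r2)%N.
  by exists (q2 %/ g)%N; rewrite mulnC divnK// dvdn_gcdr.
have r10 : (0 < r1)%N by move: q10; rewrite q1E muln_gt0 => /andP[].
have co : coprime r1 r2.
  by rewrite /coprime -(eqn_pmul2l g0) muln_gcdr -q1E -q2E muln1.
have gR : 0 < g%:R :> R by rewrite ltr0n.
set V := Num.truncn (H / g%:R).
have Hg0 : 0 <= H / g%:R by rewrite divr_ge0// ltW.
clearbody g; subst q1 q2.
apply: (@le_trans _ _ (#|[pred p : 'I_(g * r1) * 'I_(g * r2) |
     0 < (p.1 * r2 - p.2 * r1) + (p.2 * r1 - p.1 * r2) <= V]%N|%:R)).
  rewrite pair_big/= -sum1_card natr_sum big_mkcond/= [X in _ <= X]big_mkcond/=.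
  rewrite [X in _ <= X]big_mkcond/=.
  apply: ler_sum => -[a b] _ /=; rewrite inE/=.
  set X := (a * r2)%N; set Y := (b * r1)%N.
  have -> : (a * (g * r2) = g * X)%N by rewrite /X; lia.
  have -> : (b * (g * r1) = g * Y)%N by rewrite /Y; lia.
  clearbody X Y; rewrite !natrM -mulrBr normrM [`|g%:R|]ger0_norm// eqn_pmul2l//.
  case: (boolP (X != Y)) => XY /=; last by case: ifP.
  case: (boolP (_ <= H)) => hH; last by case: ifP.
  suff -> : (0 < X - Y + (Y - X) <= V)%N by [].
  have -> : (0 < X - Y + (Y - X))%N by lia.
  rewrite /V truncn_ge_nat// ler_pdivlMr// mulrC; apply: le_trans hH.
  rewrite ler_wpM2l//; case: (leqP X Y) => h.
    have -> : (X - Y + (Y - X) = Y - X)%N by lia.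
    by rewrite natrB// distrC ler_norm.
  have -> : (X - Y + (Y - X) = X - Y)%N by lia.
  by rewrite natrB ?ler_norm// ltnW.
apply: (@le_trans _ _ (g * (V + V))%:R).
  by rewrite ler_nat; exact: count_close_nat.
have := card_le_real Hg0; rewrite -/V => HV.
have := ler_wpM2l (ltW gR) HV.
have -> : g%:R * (H / g%:R) = H by field; rewrite gt_eqF.
by rewrite natrM natrD; lra.
Qed.

End CloseFractions.

(** * The covering by windows around fractions *)

Section Fractions.
Context {R : realType}.
Implicit Types N K x y z s : R.

(** The pairs (d, a) that index the fractions a / d^k used in [twist], for
    squarefree d in ]y, 2y]. *)
Definition isfrac (k : nat) (y : R) (d a : nat) : bool :=
  [&& y < d%:R <= 2 * y, sqfree d, (a < d ^ k)%N & gcdn a (d ^ k) \in kfree k].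

Definition kfrac (k d a : nat) : R := a%:R / (d ^ k)%:R.

(** If a prime p divided d but not d', then p^k would divide both a and d^k. *)
Lemma frac_inj k y d a d' a' : (2 <= k)%N -> isfrac k y d a -> isfrac k y d' a' ->
  (a * d' ^ k = a' * d ^ k)%N -> d = d' /\ a = a'.
Proof.
move=> k2.
have H u v b b' : isfrac k y u b -> isfrac k y v b' -> (b * v ^ k = b' * u ^ k)%N -> (u %| v)%N.
  move=> /and4P[_ su _ ku] /and4P[_ sv _ _] E.
  have /sqfreeP[v0 _] := sv.
  apply: contrapT => /negP uv.
  have [p [pp pu pv]] := sqfree_prime_dvd v0 su uv.
  have : (p ^ k %| gcdn b (u ^ k))%N.
    rewrite dvdn_gcd (dvdn_exp2r _ pu) andbT.
    have : (p ^ k %| b * v ^ k)%N by rewrite E dvdn_mull// dvdn_exp2r.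
    by rewrite Gauss_dvdl// coprimeXl// coprimeXr// prime_coprime.
  by move: ku; rewrite inE => /(_ p pp) /negbTE ->.
move=> h h' E.
have dd : d = d'.
  by apply/eqP; rewrite eqn_dvd (H _ _ _ _ h h' E) (H _ _ _ _ h' h (esym E)).
split=> //; move: E; rewrite dd => /eqP; rewrite eqn_pmul2r ?expn_gt0; first by move/eqP.
by case/and4P: h' => _ /sqfreeP[-> _].
Qed.

Definition warc (h : R) k (d a : nat) (t : R) : R :=
  \1_(`[kfrac k d a - h, kfrac k d a + h]) t.

Lemma arcE h k d a t : warc h k d a t = (`|t - kfrac k d a| <= h)%R%:R.
Proof.
rewrite /warc indicE; congr ((nat_of_bool _)%:R); apply/idP/idP.
  by rewrite inE/= in_itv/= ler_norml => /andP[? ?]; lra.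
by rewrite inE/= in_itv/= ler_norml => /andP[? ?]; lra.
Qed.

Lemma nice_arc h k d a : nice (warc h k d a).
Proof. exact: nice_indic. Qed.

Definition ncover (h : R) k (y : R) (t : R) : R :=
  \sum_(d < bnd (2 * y)) \sum_(a < d ^ k) (isfrac k y d a)%:R * warc h k d a t.

Lemma nice_cover h k y : nice (ncover h k y).
Proof.
by apply: nice_sum => d _; apply: nice_sum => a _; apply: niceZ; exact: nice_arc.
Qed.

Context (k : nat) (K y : R).
Context (k2 : (2 <= k)%N) (K1 : 1 <= K) (y1 : 1 <= y) (yK : (2 * y) ^+ k <= K).
Let h := arcw K.

Let h0 : 0 < h. Proof. exact: arcw_gt0. Qed.

Lemma isfrac_pos d a : isfrac k y d a -> (1 < d)%N /\ (0 < a)%N.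
Proof.
move=> /and4P[/andP[yd _] _ _ ka].
have d1 : (1 < d)%N by rewrite -(ltr_nat R) (le_lt_trans y1).
split=> //; rewrite lt0n; apply/negP => /eqP a0; move: ka; rewrite a0 gcd0n inE.
by move=> /(_ _ (pdiv_prime d1)); rewrite dvdn_exp2r// pdiv_dvd.
Qed.

(** The fraction a / d^k is at a distance at least 1 / d^k >= h from 0 and 1, so
    that no window wraps around. *)
Lemma arc_inside d a : isfrac k y d a -> 0 <= kfrac k d a - h /\ kfrac k d a + h <= 1.
Proof.
move=> H; have [d1 a0] := isfrac_pos H; case/and4P: H => /andP[_ d2y] _ ad _.
have dk0 : 0 < (d ^ k)%:R :> R by rewrite ltr0n expn_gt0 (ltn_trans _ d1).
have hd : h <= (d ^ k)%:R^-1.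
  rewrite -[(d ^ k)%:R^-1]mul1r ler_pdivlMr//.
  apply: (@le_trans _ _ (h * K)).
    rewrite ler_wpM2l ?(ltW h0)// (le_trans _ yK)// natrX lerXn2r ?nnegrE//.
    by rewrite mulr_ge0// (le_trans ler01).
  have -> : h * K = 512^-1 by rewrite mulrC; exact: arcwM K1.
  by rewrite invf_le1; [rewrite ler1n|rewrite ltr0n].
rewrite /kfrac; split.
  rewrite subr_ge0; apply: le_trans hd _.
  by rewrite -[X in X <= _]mul1r ler_wpM2r ?invr_ge0 ?(ltW dk0)// ler1n.
apply: (@le_trans _ _ (a%:R / (d ^ k)%:R + (d ^ k)%:R^-1)); first by rewrite lerD2l.
rewrite -[X in _ + X]mul1r -mulrDl ler_pdivrMr// mul1r natr1 ler_nat//.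
Qed.

Lemma Int_arc d a (f : R -> R) : isfrac k y d a -> nice f ->
  Int 0 1 (fun t => f t * warc h k d a t) = Int (kfrac k d a - h) (kfrac k d a + h) f.
Proof. by move=> H nf; have [? ?] := arc_inside H; exact: Int_indic. Qed.

Lemma Int_arc1 d a : isfrac k y d a -> Int 0 1 (warc h k d a) = 2 * h.
Proof.
move=> H; rewrite (@eq_Int _ 0 1 _ (fun t => 1 * warc h k d a t)); last by move=> t; rewrite mul1r.
rewrite Int_arc//; last exact: nice_cst.
by rewrite Int_cst; [ring|rewrite lerD2l; have := h0; lra].
Qed.

Lemma card_bnd : \sum_(d < bnd (2 * y)) (y < d%:R <= 2 * y)%R%:R <= 2 * y :> R.
Proof.
have y0 : 0 <= 2 * y by rewrite mulr_ge0// (le_trans ler01).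
apply: le_trans (card_le_real y0); rewrite /bnd big_ord_recl/=.
have -> : (y < 0%:R <= 2 * y) = false by rewrite ltNge (le_trans ler01).
rewrite add0r; apply: (@le_trans _ _ (\sum_(d < Num.truncn (2 * y)) 1)).
  by apply: ler_sum => d _; case: (_ < _ <= _).
by rewrite sumr_const card_ord.
Qed.

Lemma dk_le d : (y < d%:R <= 2 * y) -> (d ^ k)%:R <= (2 * y) ^+ k :> R.
Proof.
move=> /andP[_ d2]; rewrite natrX lerXn2r ?nnegrE//.
by rewrite mulr_ge0// (le_trans ler01).
Qed.

Lemma Int_cover : Int 0 1 (ncover h k y) <= 2 * h * (2 * y) ^+ k.+1.
Proof.
rewrite /ncover Int_sum; last first.
  by move=> d _; apply: nice_sum => a _; apply: niceZ; exact: nice_arc.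
apply: (@le_trans _ _ (\sum_(d < bnd (2 * y)) (y < d%:R <= 2 * y)%R%:R * (2 * h * (2 * y) ^+ k))).
  apply: ler_sum => d _; rewrite Int_sum; last first.
    by move=> a _; apply: niceZ; exact: nice_arc.
  case: (boolP (y < d%:R <= 2 * y)) => hd; last first.
    rewrite mul0r big1// => a _; rewrite IntZ; last exact: nice_arc.
    by rewrite /isfrac (negbTE hd) mul0r.
  apply: (@le_trans _ _ (\sum_(a < d ^ k) 2 * h)).
    apply: ler_sum => a _; rewrite IntZ; last exact: nice_arc.
    case: (boolP (isfrac k y d a)) => ha; last by rewrite mul0r mulr_ge0// ltW.
    by rewrite mul1r Int_arc1.
  rewrite sumr_const card_ord -[_ *+ (d ^ k)]mulr_natr mul1r ler_wpM2l ?mulr_ge0 ?(ltW h0)//.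
  exact: dk_le.
have -> : 2 * h * (2 * y) ^+ k.+1 = 2 * y * (2 * h * (2 * y) ^+ k) by rewrite exprS; ring.
rewrite -mulr_suml ler_wpM2r ?card_bnd// mulr_ge0 ?mulr_ge0 ?(ltW h0)//.
by rewrite exprn_ge0// mulr_ge0// (le_trans ler01).
Qed.

(** Two distinct windows meet only if their centres differ by at most 2h, and
    the number of such pairs is bounded by [count_close]. Off the diagonal, the
    second moment is thus of the size expected for independent windows. *)
Lemma Int_cover2 : Int 0 1 (fun t => ncover h k y t * (ncover h k y t - 1)) <=
  8 * h ^+ 2 * (2 * y) ^+ (2 * k + 2).
Proof.
pose F (d a d' a' : nat) (t : R) : R :=
  (isfrac k y d a && isfrac k y d' a' && ((d, a) != (d', a')))%:R * (warc h k d a t * warc h k d' a' t).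
have nF d a d' a' : nice (F d a d' a').
  by apply: niceZ; apply: niceM; exact: nice_arc.
have E t : ncover h k y t * (ncover h k y t - 1) =
   \sum_(d < bnd (2 * y)) \sum_(a < d ^ k) \sum_(d' < bnd (2 * y)) \sum_(a' < d' ^ k) F d a d' a' t.
  rewrite {1}/ncover mulr_suml; apply: eq_bigr => d _; rewrite mulr_suml; apply: eq_bigr => a _.
  pose I (d' a' : nat) := (isfrac k y d' a')%:R * warc h k d' a' t.
  apply/eqP; rewrite -/(I d a) mulrBr mulr1 subr_eq -subr_eq0 opprD addrA subr_eq0 -/(I d a).
  have -> : I d a * ncover h k y t = \sum_(d' < bnd (2 * y)) \sum_(a' < d' ^ k) I d a * I d' a'.
    by rewrite /ncover mulr_sumr; apply: eq_bigr => d' _; rewrite mulr_sumr.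
  rewrite -sumrB.
  have FE (d' a' : nat) : I d a * I d' a' - F d a d' a' t =
      if (d == d' :> nat) && (a == a' :> nat) then I d a else 0.
    rewrite /I /F xpair_eqE; case: (boolP (isfrac k y d a)) => i1; last by rewrite !mul0r subrr if_same.
    case: (boolP (isfrac k y d' a')) => i2 /=.
      case: (boolP ((d == d' :> nat) && (a == a' :> nat))) => [/andP[/eqP <- /eqP <-]|_].
        by rewrite !mul1r mul0r subr0 arcE -natrM mulnb andbb.
      by rewrite !mul1r subrr.
    rewrite !mul0r mulr0 subrr; case: andP => // -[/eqP dE /eqP aE].
    by move: i2; rewrite -dE -aE i1.
  rewrite (bigD1 d)//= [X in _ + X]big1 ?addr0; last first.
    move=> d' dd; rewrite -sumrB big1// => a' _; rewrite FE.
    by rewrite [d == d' :> nat]eq_sym (negbTE (_ : (d' != d :> nat)))//.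
  rewrite -sumrB (bigD1 a)//= big1 ?addr0; last first.
    move=> a' aa; rewrite FE [a == a' :> nat]eq_sym (negbTE (_ : (a' != a :> nat))) ?andbF//.
  by rewrite FE !eqxx.
rewrite (eq_Int _ _ E) Int_sum; last first.
  move=> d _; apply: nice_sum => a _; apply: nice_sum => d' _; apply: nice_sum => a' _; exact: nF.
set H : R := 2 * h * (2 * y) ^+ (2 * k).
pose Cl (d a d' a' : nat) : R := ((a * d' ^ k != a' * d ^ k)%N &&
    (`|(a * d' ^ k)%:R - (a' * d ^ k)%:R| <= H)%R)%:R.
pose Y (d : nat) : R := (y < d%:R <= 2 * y)%R%:R.
have y0 : 0 <= 2 * y by rewrite mulr_ge0// (le_trans ler01).
have H0 : 0 <= H by rewrite mulr_ge0 ?exprn_ge0// mulr_ge0// ltW.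
have FG d a d' a' : Int 0 1 (F d a d' a') <= Y d * Y d' * (2 * h * Cl d a d' a').
  have R0 : 0 <= Y d * Y d' * (2 * h * Cl d a d' a').
    by rewrite !mulr_ge0// ltW.
  have Z : Int 0 1 (fun=> 0 : R) = 0 by rewrite Int_cst// mul0r.
  case: (boolP (isfrac k y d a && isfrac k y d' a' && ((d, a) != (d', a')))) => c1; last first.
    rewrite (@eq_Int _ 0 1 _ (fun=> 0)) ?Z// => t.
    by rewrite /F (negbTE c1) mul0r.
  have /andP[/andP[f1 f2] ne] := c1.
  have hd : Y d = 1 by rewrite /Y; case/and4P: f1 => ->.
  have hd' : Y d' = 1 by rewrite /Y; case/and4P: f2 => ->.
  rewrite hd hd' !mul1r.
  have [d1 _] := isfrac_pos f1; have [d'1 _] := isfrac_pos f2.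
  have dk0 : 0 < (d ^ k)%:R :> R by rewrite ltr0n expn_gt0 (ltn_trans _ d1).
  have dk0' : 0 < (d' ^ k)%:R :> R by rewrite ltr0n expn_gt0 (ltn_trans _ d'1).
  rewrite /Cl; have -> : (a * d' ^ k != a' * d ^ k)%N.
    by apply: contra ne => /eqP /(frac_inj k2 f1 f2) [-> ->].
  case: (boolP (_ <= H)) => /= hH.
    rewrite mulr1 -(Int_arc1 f1); apply: le_Int; [exact: nF|exact: nice_arc|].
    move=> t _; rewrite /F c1 mul1r !arcE.
    by case: (_ <= h); case: (_ <= h); rewrite ?mul0r ?mulr0 ?mulr1.
  rewrite mulr0 (@eq_Int _ 0 1 _ (fun=> 0)) ?Z// => t.
  rewrite /F c1 mul1r !arcE.
  case: (boolP (_ <= h)) => h1; last by rewrite mul0r.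
  case: (boolP (_ <= h)) => h2; last by rewrite mulr0.
  exfalso; move/negP: hH; apply.
  have cc : `|kfrac k d a - kfrac k d' a'| <= 2 * h.
    have -> : kfrac k d a - kfrac k d' a' = (t - kfrac k d' a') - (t - kfrac k d a) by ring.
    by apply: le_trans (ler_normB _ _) _; lra.
  have -> : (a * d' ^ k)%:R - (a' * d ^ k)%:R =
     (kfrac k d a - kfrac k d' a') * ((d ^ k)%:R * (d' ^ k)%:R) :> R.
    by rewrite !natrM /kfrac; field; rewrite !gt_eqF.
  rewrite normrM [`|_ * (d' ^ k)%:R|]ger0_norm ?mulr_ge0//.
  rewrite /H mul2n -addnn exprD ler_pM ?mulr_ge0// ler_pM//; apply: dk_le.
    by case/and4P: f1.
  by case/and4P: f2.
apply: (@le_trans _ _ (\sum_(d < bnd (2 * y)) \sum_(d' < bnd (2 * y)) Y d * Y d' * (2 * h * (2 * H)))).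
  apply: ler_sum => d _.
  rewrite Int_sum; last by move=> a _; apply: nice_sum => d' _; apply: nice_sum => a' _; exact: nF.
  under eq_bigr => a _.
    rewrite Int_sum; last by move=> d' _; apply: nice_sum => a' _; exact: nF.
    over.
  rewrite /= exchange_big/=; apply: ler_sum => d' _.
  apply: (@le_trans _ _ (\sum_(a < d ^ k) \sum_(a' < d' ^ k) Y d * Y d' * (2 * h * Cl d a d' a'))).
    apply: ler_sum => a _; rewrite Int_sum; last by move=> a' _; exact: nF.
    by apply: ler_sum => a' _; exact: FG.
  under eq_bigr do rewrite -!mulr_sumr.
  rewrite -!mulr_sumr.
  have [d0|d0] := eqVneq (d : nat) 0%N.
    by rewrite /Y d0 ltNge (le_trans ler01 y1) !mul0r.
  have [d0'|d0'] := eqVneq (d' : nat) 0%N.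
    by rewrite /Y d0' [_ < 0%:R]ltNge (le_trans ler01 y1) mulr0 !mul0r.
  rewrite ler_wpM2l ?mulr_ge0// ler_wpM2l ?mulr_ge0 ?(ltW h0)//.
  by apply: count_close => //; rewrite expn_gt0 lt0n ?d0 ?d0'.
under eq_bigr do rewrite -mulr_suml -mulr_sumr.
rewrite -mulr_suml -mulr_suml.
have -> : 8 * h ^+ 2 * (2 * y) ^+ (2 * k + 2) = (2 * y) * (2 * y) * (2 * h * (2 * H)).
  by rewrite /H exprD; ring.
have YB : \sum_(d < bnd (2 * y)) Y d <= 2 * y by exact: card_bnd.
have Y0 : 0 <= \sum_(d < bnd (2 * y)) Y d by rewrite sumr_ge0.
apply: ler_wpM2r; first exact: mulr_ge0 (mulr_ge0 (ler0n _ 2) (ltW h0)) (mulr_ge0 (ler0n _ 2) H0).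
by rewrite ler_pM.
Qed.

(** The twist of g is the twist of S minus that of f. On |t| <= h the former is
    of size K by [major_arc], the latter smaller by [twist_f]; summing over the
    squarefree d in ]y, 2y] gives a factor y. *)
Lemma Int_cover_tail N x : K <= N -> 0 <= x -> x <= y -> 200 <= y ->
  4 * x * (2 * y) ^+ k <= K / 64 ->
  K / 16 <= \sum_(n < bnd N) cS k N K n ->
  h * K * y / 256 <= Int 0 1 (fun t => absg k N K x t * ncover h k y t).
Proof.
move=> KN x0 xy y200 xK HS.
have N0 : 0 <= N by rewrite (le_trans _ KN)// (le_trans ler01).
have K0 : 0 < K by rewrite (lt_le_trans ltr01).
have y0 : 0 <= 2 * y by rewrite mulr_ge0// (le_trans ler01).
pose g := absg k N K x.
have ng : nice g by exact: nice_absg.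
have cg' : continuous g by exact: continuous_cabs_tp.
have g0 t : 0 <= g t by exact: absg_ge0.
have nt d a : nice (fun t => (isfrac k y d a)%:R * (g t * warc h k d a t)).
  by apply: niceZ; apply: niceM => //; exact: nice_arc.
have E t : g t * ncover h k y t = \sum_(d < bnd (2 * y)) \sum_(a < d ^ k)
    (isfrac k y d a)%:R * (g t * warc h k d a t).
  rewrite /ncover mulr_sumr; apply: eq_bigr => d _; rewrite mulr_sumr.
  by apply: eq_bigr => a _; ring.
rewrite (eq_Int _ _ E) Int_sum; last by move=> d _; apply: nice_sum => a _; exact: nt.
pose Z (d : nat) : R := ((y < d%:R <= 2 * y) && sqfree d)%:R.
apply: (@le_trans _ _ (\sum_(d < bnd (2 * y)) Z d * (h * K / 32))).
  rewrite -mulr_suml; have := @sqfree_count R y (bnd (2 * y)) y200 (truncnS_gt _).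
  rewrite -/Z => HZ.
  have hK0 : 0 <= h * K / 32 by rewrite divr_ge0// (mulr_ge0 (ltW h0) (ltW K0)).
  apply: le_trans (ler_wpM2r hK0 HZ).
  by rewrite le_eqVlt; apply/orP; left; apply/eqP; field.
apply: ler_sum => d _; rewrite Int_sum; last by move=> a _; exact: nt.
case: (boolP ((y < d%:R <= 2 * y) && sqfree d)) => hd; last first.
  rewrite /Z (negbTE hd) mul0r; apply: sumr_ge0 => a _; apply: Int_ge0 => t.
  by rewrite !mulr_ge0// arcE.
rewrite /Z hd mul1r.
have /andP[yd sf] := hd; have d0 : (0 < d)%N by case/andP: sf.
have twg t : `|t| <= h -> K / 64 <= cabs (twist k d (tp (bnd N) (cg k N K x)) t).
  move=> th.
  have -> : twist k d (tp (bnd N) (cg k N K x)) t =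
     twist k d (tp (bnd N) (cS k N K)) t - twist k d (tp (bnd N) (cf k N K x)) t.
    rewrite /twist -sumrB; apply: eq_bigr => a _; rewrite -mulrBr; congr (_ * _).
    by rewrite (tpS_split _ k2 N0 KN x0) addrAC subrr add0r.
  apply: le_trans _ (cabs_ge_sub _ _).
  have xd : x < d%:R by case/andP: yd => yd _; exact: le_lt_trans xy yd.
  have F := twist_f k2 sf K1 KN x0 xd th.
  have F2 : 4 * x * (d ^ k)%:R <= K / 64.
    by apply: le_trans xK; rewrite ler_wpM2l ?mulr_ge0// dk_le.
  rewrite twist_S// cabsM cabs_real -intr_norm normr_moebius sf mul1r.
  have := major_arc K1 KN HS th; rewrite /absS; lra.
apply: (@le_trans _ _ (\sum_(a < d ^ k) Int (- h) h (fun t =>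
    (isfrac k y d a)%:R * g (kfrac k d a + t)))); last first.
  apply: ler_sum => a _.
  have nsh : nice (fun t => g (kfrac k d a + t)).
    apply: (@nice_continuous_bounded _ _ (\sum_(n < bnd N) `|cg k N K x n|)).
      move=> t; apply: (@continuous_comp _ _ _ (fun t => kfrac k d a + t) g); last exact: cg'.
      by apply: cvgD; [exact: cvg_cst|exact: cvg_id].
    by move=> t; rewrite ger0_norm// cabs_tp_le.
  rewrite [X in X <= _]IntZ// [X in _ <= X]IntZ; last by apply: niceM => //; exact: nice_arc.
  case: (boolP (isfrac k y d a)) => ha; last by rewrite !mul0r.
  rewrite !mul1r Int_arc// -Int_shift//.
  by have := h0; lra.
have nsh (a : nat) : nice (fun t => (isfrac k y d a)%:R * g (kfrac k d a + t)).
  apply: niceZ; apply: (@nice_continuous_bounded _ _ (\sum_(n < bnd N) `|cg k N K x n|)).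
    move=> t; apply: (@continuous_comp _ _ _ (fun t => kfrac k d a + t) g); last exact: cg'.
    by apply: cvgD; [exact: cvg_cst|exact: cvg_id].
  by move=> t; rewrite ger0_norm// cabs_tp_le.
rewrite -Int_sum; last by move=> a _; exact: nsh.
apply: (@le_trans _ _ (Int (- h) h (fun=> K / 64))).
  rewrite Int_cst; last by have := h0; lra.
  by rewrite le_eqVlt; apply/orP; left; apply/eqP; field.
apply: le_Int; [exact: nice_cst|by apply: nice_sum => a _; exact: nsh|].
move=> t /andP[t1 t2].
have th : `|t| <= h by rewrite ler_norml t1.
apply: le_trans (twg t th) _; apply: le_trans (cabs_sum _ _ _) _.
apply: ler_sum => a _; rewrite cabsM cabs_real ger0_norm; last by have /andP[] := @indic01 R k (gcdn a (d ^ k)).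
by rewrite /isfrac yd sf ltn_ord/= indicE.
Qed.

End Fractions.

(** * The lower bound for the L1 norm *)

Section LowerBound.
Context {R : realType}.
Implicit Types N K x y z s : R.

Lemma cover_nat (h : R) k y t : exists n : nat, ncover h k y t = n%:R.
Proof.
pose P (d a : nat) : bool := isfrac k y d a && (`|t - kfrac k d a| <= h).
exists (\sum_(d < bnd (2 * y)) \sum_(a < d ^ k) nat_of_bool (P d a))%N.
rewrite natr_sum; apply: eq_bigr => d _; rewrite natr_sum; apply: eq_bigr => a _.
by rewrite arcE /P -mulnb natrM.
Qed.

(** Where exactly one window covers, g <= S + f is used directly and f is
    interpolated with the threshold l; where the covering overlaps, the
    excess n - 1 of the multiplicity is separated from g by the inequality of the
    arithmetic and geometric means. *)
Lemma cover_pointwise (g S f r l s u : R) (n : nat) :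
  0 <= g -> 0 <= S -> 0 <= f -> g <= S + f -> r = n%:R -> 0 < l -> 1 <= s -> 0 < u ->
  g * r <= S + (l * r + l `^ (1 - s) * f `^ s) +
    (u / 2 * g ^+ 2 + (2 * u)^-1 * (r * (r - 1))).
Proof.
move=> g0 S0 f0 gSf -> l0 s1 u0.
have P0 : 0 <= l `^ (1 - s) * f `^ s by rewrite mulr_ge0 ?powR_ge0.
have u20 : 0 <= (2 * u)^-1 by rewrite invr_ge0 mulr_ge0// ltW.
have G0 : 0 <= u / 2 * g ^+ 2 by rewrite mulr_ge0 ?sqr_ge0// divr_ge0// ltW.
case: n => [|n]; first by rewrite mulr0 mul0r !mulr0 add0r addr0 !addr_ge0.
have n1 : 1 <= n.+1%:R :> R by rewrite ler1n.
have F : f <= l * n.+1%:R + l `^ (1 - s) * f `^ s.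
  have := @powR_interp _ f l 0 1 s f0 l0 (lexx _) ler01 s1.
  rewrite powRr1// subr0 powRr1 ?(ltW l0)// powRr0 mulr1 => H; apply: le_trans H _.
  by rewrite lerD2r ler_peMr// ltW.
have -> : n.+1%:R = n%:R + 1 :> R by rewrite natr1.
have Q : g * n%:R <= u / 2 * g ^+ 2 + (2 * u)^-1 * n%:R ^+ 2.
  rewrite -subr_ge0.
  have -> : u / 2 * g ^+ 2 + (2 * u)^-1 * n%:R ^+ 2 - g * n%:R = u / 2 * (g - u^-1 * n%:R) ^+ 2.
    by field; rewrite gt_eqF.
  by rewrite mulr_ge0 ?sqr_ge0// divr_ge0// ltW.
have Q2 : (2 * u)^-1 * n%:R ^+ 2 <= (2 * u)^-1 * ((n%:R + 1) * (n%:R + 1 - 1)).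
  by rewrite ler_wpM2l// addrK expr2 ler_wpM2r// lerDl.
by rewrite mulrDr mulr1; move: F; rewrite -natr1; lra.
Qed.

(** The free parameters of the lower bound: [mu] scales the threshold for f, [q]
    is the ratio between the truncation point and the denominators, [tau] weighs
    the two mean squares and [p] is the ratio between the denominators and
    K^(1/(k+1)). Each one is small in terms of the previous ones. *)
Lemma lower_constants (k : nat) (s c1 Cf Cg : R) : 0 < c1 -> 0 < Cf -> 0 < Cg ->
  exists mu q tau p : R, [/\ 0 < mu, mu * 2 ^+ k.+2 = c1 / 8,
    [/\ 0 < q, q <= 1 & Cf * mu `^ (1 - s) * q `^ 2^-1 <= c1 / 8],
    0 < tau /\ tau * (Cg + 1) * (q / q ^+ k) = c1 / 4 &
    [/\ 0 < p, p <= 2^-1, p * (256 * 2 ^+ k) <= 1 & 4 * 2 ^+ (2 * k + 2) / tau * p <= c1 / 8]].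
Proof.
move=> c10 Cf0 Cg0.
pose mu := c1 / (8 * 2 ^+ k.+2).
have mu0 : 0 < mu by rewrite divr_gt0// mulr_gt0// exprn_gt0.
pose B := Cf * mu `^ (1 - s).
have B0 : 0 < B by rewrite mulr_gt0// powR_gt0.
pose q := Num.min 1 ((c1 / (8 * B)) ^+ 2).
have q0 : 0 < q by rewrite lt_min ltr01 exprn_gt0// divr_gt0// mulr_gt0.
have q1 : q <= 1 by rewrite ge_min lexx.
have qB : B * q `^ 2^-1 <= c1 / 8.
  have r0 : 0 < c1 / (8 * B) by rewrite divr_gt0// mulr_gt0.
  have h2 : 0 <= 2^-1 :> R by rewrite invr_ge0.
  apply: (@le_trans _ _ (B * (c1 / (8 * B)))).
    rewrite ler_wpM2l ?(ltW B0)//.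
    have -> : c1 / (8 * B) = ((c1 / (8 * B)) ^+ 2) `^ 2^-1.
      by rewrite -powR_mulrn ?(ltW r0)// -powRrM mulfV// powRr1// ltW.
    by rewrite ge0_ler_powR ?nnegrE ?(ltW q0) ?sqr_ge0// ge_min lexx orbT.
  by rewrite le_eqVlt; apply/orP; left; apply/eqP; field; rewrite gt_eqF.
pose qk := q / q ^+ k.
have qk0 : 0 < qk by rewrite divr_gt0// exprn_gt0.
pose tau := c1 / (4 * (Cg + 1) * qk).
have Cg1 : 0 < Cg + 1 by rewrite addr_gt0.
have tau0 : 0 < tau by rewrite divr_gt0//; exact: mulr_gt0 (mulr_gt0 (ltr0n _ 4) Cg1) qk0.
pose A := 4 * 2 ^+ (2 * k + 2) / tau.
have A0 : 0 < A by rewrite divr_gt0// mulr_gt0// exprn_gt0.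
pose p := Num.min 2^-1 (Num.min ((256 * 2 ^+ k)^-1) (c1 / (8 * A))).
have p2k : 0 < 2 ^+ k :> R by rewrite exprn_gt0.
have p0 : 0 < p.
  rewrite !lt_min invr_gt0 ltr0n/= invr_gt0 mulr_gt0 ?ltr0n//=.
  by rewrite divr_gt0// mulr_gt0.
have ph : p <= 2^-1 by rewrite ge_min lexx.
have pk : p * (256 * 2 ^+ k) <= 1.
  rewrite -ler_pdivlMr ?mulr_gt0 ?ltr0n// div1r.
  by rewrite /p !ge_min lexx !orbT.
have pA : A * p <= c1 / 8.
  have -> : c1 / 8 = A * (c1 / (8 * A)) by field; rewrite gt_eqF.
  by rewrite ler_wpM2l ?(ltW A0)// /p !ge_min lexx !orbT.
exists mu, q, tau, p; split=> //.
- by rewrite /mu; field; rewrite gt_eqF// exprn_gt0.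
- split=> //; rewrite /tau -/qk; field.
  by rewrite !gt_eqF.
Qed.

(** Integrating [cover_pointwise], the left-hand side is at least c1 y by
    [Int_cover_tail], and with the parameters of [lower_constants] each of the
    four error terms is at most c1 y / 8. *)
Lemma L1_lower k (D th c : R) : (2 <= k)%N -> variance_exponent k D ->
  0 < c -> 0 < th -> D < th * (2 / (k%:R + 1)) ->
  exists2 C, 0 < C & exists2 N0, 1 <= N0 & forall N K,
    N0 <= N -> 1 <= K -> K <= N -> c * N `^ th <= K ->
    C * K `^ (k%:R + 1)^-1 <= Int 0 1 (absS k N K).
Proof.
move=> k2 vD c0 th0 Db.
have k2R : 2 <= k%:R :> R by rewrite ler_nat.
have k0 : 0 < k%:R :> R by lra.
have k10 : 0 < k%:R + 1 :> R by lra.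
have ki0 : 0 < k%:R^-1 :> R by rewrite invr_gt0.
have ki1 : k%:R^-1 < 1 :> R by rewrite invf_lt1; lra.
have half1 : 1 - 2^-1 = 2^-1 :> R by lra.
have half2 : 2^-1 + 2^-1 = 1 :> R by lra.
(* The choice of s makes the exponent 1 - k (s - 1) of x equal to 1/2. *)
pose s : R := 1 + k%:R^-1 / 2.
have s1 : 1 < s by rewrite /s; lra.
have s2 : s < 2 by rewrite /s; lra.
have s0 : 0 < s by lra.
have sk : s <> 1 + k%:R^-1 by rewrite /s; lra.
have sE : k%:R * (s - 1) = 2^-1 by rewrite /s; field; rewrite gt_eqF.
have b1 : 2 / (k%:R + 1) <= 1 :> R by rewrite ler_pdivrMr// mul1r; lra.
have kb : k%:R^-1 < 2 / (k%:R + 1) :> R.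
  rewrite ltr_pdivlMr// mulrC ltr_pdivrMr//; lra.
have Dth : D < th by apply: lt_le_trans Db _; rewrite ler_piMr// ltW.
have [Cf Cf0 Hf] := @trunc_moment R k s k2 s1 s2 sk.
have [Cg Cg0 Hg] := tail_L2 k2 vD c0 th0 kb Db.
have [N1 N11 {}Hg] := Hg 1 ltr01.
have [N2 N21 Hc] := kfree_count k2 vD c0 th0 Dth.
(* The windows have half-width w / K. *)
pose w : R := 512^-1.
have w0 : 0 < w by rewrite /w invr_gt0 ltr0n.
have w1 : w <= 1 by rewrite /w; lra.
pose c1 := w / 256.
have c10 : 0 < c1 by apply: divr_gt0 w0 _; rewrite ltr0n.
have wE : w = 512^-1 by [].
clearbody w.
have [mu [q [tau [p [mu0 muE [q0 q1 qB] [tau0 tauE] [p0 ph pk pA]]]]]] :=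
  lower_constants k s c10 Cf0 Cg0.
have p1 : p <= 1 by apply: le_trans ph _; rewrite invf_le1 ?ler1n.
have p2k : 0 < 2 ^+ k :> R by rewrite exprn_gt0.
have c1E : c1 = w / 256 by [].
clearbody c1.
have pp : p ^+ k.+1 <= p by rewrite exprS ler_piMr ?(ltW p0)// exprn_ile1// ltW.
have pq0 : 0 < p * q by rewrite mulr_gt0.
have pq1 : p * q <= 1 by rewrite mulr_ile1// ltW.
have ep0 : 0 < p * q / 200 by apply: divr_gt0 pq0 _; rewrite ltr0n.
have ki10 : 0 <= (k%:R + 1)^-1 :> R by rewrite invr_ge0 ltW.
have tk : 0 < th * (k%:R + 1)^-1 by rewrite mulr_gt0// invr_gt0.
have [N3 N31 HY] := pow_dom c0 ki10 tk ep0.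
exists (c1 / 2 * p); first by rewrite mulr_gt0// divr_gt0.
exists (Num.max N1 (Num.max N2 N3)); first by rewrite le_max N11.
move=> N K; rewrite !ge_max => /and3P[NN1 NN2 NN3] K1 KN NK.
have N0 : 0 <= N := le_trans (le_trans ler01 K1) KN.
have K0 : 0 < K := lt_le_trans ltr01 K1.
set Y := K `^ (k%:R + 1)^-1.
have pqY : 200 <= p * q * Y.
  by have := HY N K NN3 NK; rewrite powRr0 -/Y; clear; lra.
have Y0 : 0 < Y by rewrite powR_gt0.
have KY : K = Y ^+ k.+1.
  by rewrite -powR_mulrn ?(ltW Y0)// /Y -powRrM -natr1 mulVf ?gt_eqF// powRr1// ltW.
have Y1 : 1 <= Y.
  by rewrite /Y -[X in X <= _](powRr0 K) ler_powR.
have [y yE] : exists y, y = p * Y by exists (p * Y).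
have [x xqy] : exists x, x = q * y by exists (q * y).
have xE : x = p * q * Y by rewrite xqy yE; ring.
have y0 : 0 < y by rewrite yE mulr_gt0.
have x200 : 200 <= x by rewrite xE.
have xy : x <= y by rewrite xqy ler_piMl// ltW.
have y200 : 200 <= y by apply: le_trans x200 xy.
have yY : 2 * y <= Y.
  have : p * Y <= 2^-1 * Y by rewrite ler_wpM2r// ltW.
  by rewrite -yE; clear; lra.
have x0 : 0 < x by apply: lt_le_trans x200; rewrite ltr0n.
have y20 : 0 <= 2 * y by rewrite mulr_ge0// ltW.
have yk : (2 * y) ^+ k <= K.
  apply: (@le_trans _ _ (Y ^+ k)).
    by rewrite lerXn2r ?nnegrE ?y20 ?(ltW Y0).
  by rewrite KY ler_weXn2l.
have x1 : 1 <= x by apply: le_trans x200; rewrite ler1n.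
have y1 : 1 <= y := le_trans x1 xy.
have xK : x ^+ k.+1 <= K.
  rewrite KY lerXn2r ?nnegrE ?(ltW x0) ?(ltW Y0)// (le_trans xy)// (le_trans _ yY)//.
  by rewrite ler_peMl ?(ltW y0)// ler1n.
have x4 : 4 * x * (2 * y) ^+ k <= K / 64.
  have -> : 4 * x * (2 * y) ^+ k = 4 * 2 ^+ k * q * (p ^+ k.+1 * K).
    by rewrite KY xqy yE !exprMn !exprS; ring.
  apply: (@le_trans _ _ (4 * 2 ^+ k * 1 * (p * K))).
    rewrite ler_pM ?mulr_ge0 ?exprn_ge0 ?(ltW q0) ?(ltW p0) ?(ltW K0)//.
      by rewrite ler_wpM2l ?mulr_ge0 ?(ltW p2k).
    by rewrite ler_wpM2r ?(ltW K0).
  by have := ler_wpM2r (ltW K0) pk; rewrite mul1r; clear; lra.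
have HS := Hc N K NN2 K1 KN NK.
set h := arcw K.
have h0 : 0 < h by exact: arcw_gt0.
have hK : K * h = w by rewrite wE; exact: arcwM.
have L := Int_cover_tail k2 K1 y1 yk KN (ltW x0) xy y200 x4 HS.
have R1 := Int_cover K1 y1 yk.
have R2 := Int_cover2 k2 K1 y1 yk.
rewrite -/h in L R1 R2.
have NK0 : 0 <= N - K by rewrite subr_ge0.
have Bf := Hf (N - K) K x (bnd N) NK0 x1 xK (bndP K N0).
have Bg := Hg N K x NN1 K1 KN NK x1.
rewrite mul1r in Bg.
pose l := mu * (K / y ^+ k).
have yk0 : 0 < y ^+ k by rewrite exprn_gt0.
have l0 : 0 < l by rewrite mulr_gt0// divr_gt0.
pose u := tau * p ^+ k.+1 / y.
have u0 : 0 < u by rewrite divr_gt0// mulr_gt0// exprn_gt0.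
have nS := nice_absS k N K.
have nR := nice_cover h k y.
have ng2 : nice (fun t => absg k N K x t ^+ 2) by apply: nice_sqr (nice_absg _ _ _ _).
have nf : nice (fun t => absf k N K x t `^ s) by apply: nice_powR (ltW s0) (nice_absf _ _ _ _).
have nRR : nice (fun t => ncover h k y t * (ncover h k y t - 1)).
  by apply: niceM => //; apply: niceD => //; exact: nice_cst.
have MAIN : Int 0 1 (fun t => absg k N K x t * ncover h k y t) <=
    Int 0 1 (absS k N K) + (l * Int 0 1 (ncover h k y) + l `^ (1 - s) * Int 0 1 (fun t => absf k N K x t `^ s)) +
    (u / 2 * Int 0 1 (fun t => absg k N K x t ^+ 2) +
     (2 * u)^-1 * Int 0 1 (fun t => ncover h k y t * (ncover h k y t - 1))).
  have n1 : nice (fun t => l * ncover h k y t + l `^ (1 - s) * absf k N K x t `^ s).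
    by apply: niceD; exact: niceZ.
  have n2 : nice (fun t => u / 2 * absg k N K x t ^+ 2 +
     (2 * u)^-1 * (ncover h k y t * (ncover h k y t - 1))).
    by apply: niceD; exact: niceZ.
  have n3 : nice (fun t => absS k N K t + (l * ncover h k y t + l `^ (1 - s) * absf k N K x t `^ s)).
    exact: niceD.
  apply: (@le_trans _ _ (Int 0 1 (fun t => absS k N K t + (l * ncover h k y t + l `^ (1 - s) * absf k N K x t `^ s) +
     (u / 2 * absg k N K x t ^+ 2 +
     (2 * u)^-1 * (ncover h k y t * (ncover h k y t - 1)))))).
    apply: le_Int.
    - by apply: niceM => //; exact: nice_absg.
    - exact: niceD.
    - move=> t _; have [n En] := cover_nat h k y t.
      apply: (@cover_pointwise _ _ _ _ _ _ _ n) => //; rewrite ?absg_ge0 ?absS_ge0 ?absf_ge0 ?(ltW s1)//.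
      by apply: absg_le => //; exact: ltW.
  rewrite (IntD _ _ n3 n2) (IntD _ _ nS n1) !IntD ?IntZ//; exact: niceZ.
have T1 : l * Int 0 1 (ncover h k y) <= c1 / 8 * y.
  apply: le_trans (ler_wpM2l (ltW l0) R1) _.
  have -> : l * (2 * h * (2 * y) ^+ k.+1) = mu * 2 ^+ k.+2 * w * y.
    by rewrite -hK /l exprMn !exprS; field; rewrite gt_eqF.
  have -> : mu * 2 ^+ k.+2 * w * y = c1 / 8 * (w * y) by rewrite muE mulrA.
  by rewrite ler_wpM2l ?divr_ge0 ?(ltW c10)// ler_piMl// ltW.
have T2 : l `^ (1 - s) * Int 0 1 (fun t => absf k N K x t `^ s) <= c1 / 8 * y.
  apply: le_trans (ler_wpM2l (powR_ge0 _ _) Bf) _.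
  rewrite sE half1.
  rewrite max_r; last by rewrite -[X in X <= _](powRr0 x) ler_powR// invr_ge0.
  have -> : l `^ (1 - s) * (Cf * (K `^ (s - 1) * x `^ 2^-1)) =
      Cf * mu `^ (1 - s) * q `^ 2^-1 * y.
    have yk' : (y ^+ k)^-1 `^ (1 - s) = y `^ 2^-1.
      rewrite -powR_mulrn ?(ltW y0)// -powRN -powRrM -sE; congr (_ `^ _); ring.
    rewrite /l xqy (powRM _ (ltW mu0)) ?divr_ge0 ?(ltW K0) ?(ltW yk0)//.
    rewrite (powRM _ (ltW K0)) ?invr_ge0 ?(ltW yk0)// yk' (powRM _ (ltW q0) (ltW y0)).
    have -> : K `^ (1 - s) = (K `^ (s - 1))^-1 by rewrite -powRN opprB.
    have yy : y `^ 2^-1 * y `^ 2^-1 = y.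
      by rewrite -powRDgt// half2 powRr1// ltW.
    rewrite -[in RHS]yy; field.
    by rewrite gt_eqF// powR_gt0.
  by rewrite ler_wpM2r// ltW.
have T3 : u / 2 * Int 0 1 (fun t => absg k N K x t ^+ 2) <= c1 / 8 * y.
  have pqk0 : 0 < (p * q) ^+ k by rewrite exprn_gt0.
  have qk0 : 0 < q ^+ k by rewrite exprn_gt0.
  have pk0 : 0 < p ^+ k by rewrite exprn_gt0.
  have Yk0 : 0 < Y ^+ k by rewrite exprn_gt0.
  have E1 : K * x `^ (1 - k%:R) = Y ^+ 2 * ((p * q) / (p * q) ^+ k).
    rewrite (powRBgt _ _ x0) powRr1 ?(ltW x0)// powR_mulrn ?(ltW x0)// xE KY.
    by rewrite !exprMn exprS; field; rewrite !gt_eqF.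
  have E2 : K `^ (2 / (k%:R + 1)) = Y ^+ 2.
    by rewrite -powR_mulrn ?(ltW Y0)// /Y -powRrM mulrC.
  have E3 : 1 <= (p * q) / (p * q) ^+ k.
    rewrite ler_pdivlMr// mul1r -[X in _ <= X]expr1.
    by apply: ler_wiXn2l; [exact: ltW|exact: pq1|exact: ltnW].
  have G : Int 0 1 (fun t => absg k N K x t ^+ 2) <= (Cg + 1) * (Y ^+ 2 * ((p * q) / (p * q) ^+ k)).
    apply: le_trans Bg _; rewrite E1 E2 mulrDl mul1r lerD2l.
    by rewrite ler_peMr// sqr_ge0.
  have u2 : 0 <= u / 2 by rewrite divr_ge0// ltW.
  apply: le_trans (ler_wpM2l u2 G) _.
  have -> : u / 2 * ((Cg + 1) * (Y ^+ 2 * ((p * q) / (p * q) ^+ k))) =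
     (tau * (Cg + 1) * (q / q ^+ k)) / 2 * y.
    by rewrite /u yE exprS exprMn; field; rewrite !gt_eqF.
  by rewrite tauE; have -> : c1 / 4 / 2 = c1 / 8 by field.
have T4 : (2 * u)^-1 * Int 0 1 (fun t => ncover h k y t * (ncover h k y t - 1)) <= c1 / 8 * y.
  have u2 : 0 <= (2 * u)^-1 by rewrite invr_ge0 mulr_ge0// ltW.
  have pk1 : 0 < p ^+ k.+1 by rewrite exprn_gt0.
  apply: le_trans (ler_wpM2l u2 R2) _.
  have E1 : (2 * y) ^+ (2 * k + 2) = 2 ^+ (2 * k + 2) * p ^+ k.+1 * p ^+ k.+1 * K ^+ 2.
    have -> : (2 * k + 2 = k.+1 * 2)%N by rewrite [(k.+1 * 2)%N]mulnC mulnS addnC.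
    by rewrite KY yE !exprMn !exprM; ring.
  have -> : (2 * u)^-1 * (8 * h ^+ 2 * (2 * y) ^+ (2 * k + 2)) =
     4 * 2 ^+ (2 * k + 2) / tau * p ^+ k.+1 * y * (K * h) ^+ 2.
    by rewrite E1 /u; field; rewrite !gt_eqF.
  have A0 : 0 <= 4 * 2 ^+ (2 * k + 2) / tau.
    by rewrite divr_ge0 ?(ltW tau0)// mulr_ge0// exprn_ge0.
  rewrite hK; set Z := 4 * 2 ^+ (2 * k + 2) / tau in A0 pA *.
  have z1 : Z * p ^+ k.+1 * y <= Z * p * y by rewrite ler_wpM2r ?(ltW y0)// ler_wpM2l.
  have z0 : 0 <= Z * p ^+ k.+1 * y := mulr_ge0 (mulr_ge0 A0 (ltW pk1)) (ltW y0).
  have z2 : w ^+ 2 <= 1 by rewrite exprn_ile1// ltW.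
  apply: le_trans (ler_pM z0 (sqr_ge0 w) z1 z2) _.
  by rewrite mulr1 ler_wpM2r// ltW.
have L' : c1 * y <= Int 0 1 (fun t => absg k N K x t * ncover h k y t).
  by apply: le_trans L; rewrite c1E -hK le_eqVlt; apply/orP; left; apply/eqP; ring.
move: (le_trans L' MAIN) T1 T2 T3 T4.
have -> : c1 / 2 * p * Y = c1 / 2 * y by rewrite yE; ring.
by clear; lra.
Qed.

End LowerBound.

(** * The least variance exponent *)

Section VarianceExponents.
Context {R : realType}.
Implicit Types D : R.

Lemma variance_exponent_mono k D D' : D <= D' -> variance_exponent k D -> variance_exponent k D'.
Proof.
move=> DD vD ep ep0; have [C HC] := vD ep ep0; exists `|C| => N K y z K1 KN y1 yz.
apply: le_trans (HC N K y z K1 KN y1 yz) _.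
have N1 : 1 <= N := le_trans K1 KN.
have K0 : 0 <= K by rewrite (le_trans ler01).
have P : 0 <= K * y `^ (1 - k%:R) + N `^ ep * K `^ k%:R^-1 + N `^ (D + ep).
  by rewrite !addr_ge0 ?mulr_ge0 ?powR_ge0.
apply: le_trans (ler_wpM2r P (ler_norm C)) _.
by rewrite ler_wpM2l// lerD2l ler_powR// lerD2r.
Qed.

(** For D <= 0 the last term is absorbed by the second one. *)
Lemma variance_exponent_le0 k D D' : D <= 0 -> variance_exponent k D -> variance_exponent k D'.
Proof.
move=> D0 vD ep ep0; have [C HC] := vD ep ep0; exists (2 * `|C|) => N K y z K1 KN y1 yz.
apply: le_trans (HC N K y z K1 KN y1 yz) _.
have N1 : 1 <= N := le_trans K1 KN.
have K0 : 0 <= K by rewrite (le_trans ler01).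
have k0 : 0 <= k%:R^-1 :> R by rewrite invr_ge0.
have A0 : 0 <= K * y `^ (1 - k%:R) by rewrite mulr_ge0 ?powR_ge0.
have B0 : 0 <= N `^ ep * K `^ k%:R^-1 by rewrite mulr_ge0 ?powR_ge0.
have E0 : 0 <= N `^ (D' + ep) by rewrite powR_ge0.
have F0 : 0 <= N `^ (D + ep) by rewrite powR_ge0.
have AB : N `^ (D + ep) <= N `^ ep * K `^ k%:R^-1.
  apply: (@le_trans _ _ (N `^ ep)); first by rewrite ler_powR//; lra.
  by rewrite ler_peMr ?powR_ge0// -[X in X <= _](powRr0 K) ler_powR.
have P : 0 <= K * y `^ (1 - k%:R) + N `^ ep * K `^ k%:R^-1 + N `^ (D + ep).
  by rewrite !addr_ge0.
apply: le_trans (ler_wpM2r P (ler_norm C)) _.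
rewrite [2 * _]mulrC -mulrA ler_wpM2l//.
move: AB A0 B0 E0; lra.
Qed.

(** The loss d in the exponent is absorbed in eps. *)
Lemma variance_exponent_closed k D : (forall d, 0 < d -> variance_exponent k (D + d)) ->
  variance_exponent k D.
Proof.
move=> H ep ep0; have e2 : 0 < ep / 2 by rewrite divr_gt0.
have [C HC] := H _ e2 _ e2; exists `|C| => N K y z K1 KN y1 yz.
apply: le_trans (HC N K y z K1 KN y1 yz) _.
have N1 : 1 <= N := le_trans K1 KN.
have K0 : 0 <= K by rewrite (le_trans ler01).
have P : 0 <= K * y `^ (1 - k%:R) + N `^ (ep / 2) * K `^ k%:R^-1 + N `^ (D + ep / 2 + ep / 2).
  by rewrite !addr_ge0 ?mulr_ge0 ?powR_ge0.
apply: le_trans (ler_wpM2r P (ler_norm C)) _.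
rewrite ler_wpM2l// lerD//.
  by rewrite lerD2l ler_wpM2r ?powR_ge0// ler_powR//; lra.
by rewrite ler_powR//; lra.
Qed.

Lemma cdiv_le k n (y z : R) : (2 <= k)%N -> (0 < n)%N -> `|(cdiv k n y z)%:~R : R| <= n%:R.
Proof.
move=> k2 n0; rewrite /cdiv rmorph_sum/=; apply: le_trans (ler_norm_sum _ _ _) _.
apply: (@le_trans _ _ (\sum_(1 <= d < (Num.truncn z).+1) ((d < n.+1)%N)%:R)).
  rewrite big_mkcond/= !big_nat; apply: ler_sum => d /andP[d0 _].
  case: ifP => [/andP[_ dn]|_] //; have -> : (d < n.+1)%N.
    rewrite ltnS (leq_trans _ (dvdn_leq n0 dn))// -[leqLHS]expn1.
    by case: d d0 {dn} => // d _; rewrite leq_pexp2l//; lia.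
  exact: normr_moebiusR.
rewrite -natr_sum ler_nat; elim: (Num.truncn z) => [|m IH]; first by rewrite big_geq.
have H j : (\sum_(1 <= d < j.+1) (d < n.+1) = minn j n)%N.
  elim: j => [|j IHj]; first by rewrite big_geq// min0n.
  by rewrite big_nat_recr//= IHj; case: (ltnP j.+1 n.+1); lia.
by rewrite H geq_minr.
Qed.

(** Makes the set of variance exponents nonempty, by a trivial bound. *)
Lemma variance_exponent3 k : (2 <= k)%N -> variance_exponent k (3 : R).
Proof.
move=> k2 ep ep0; exists 2 => N K y z K1 KN y1 yz.
have N1 : 1 <= N := le_trans K1 KN.
have N0 : 0 <= N := le_trans ler01 N1.
have K0 : 0 <= K by rewrite (le_trans ler01).
apply: (@le_trans _ _ (2 * K * N ^+ 2)).
  apply: (@le_trans _ _ (\sum_(n < bnd N) win (N - K) K n%:R * N ^+ 2)).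
    rewrite -(big_mkord xpredT (fun n => win (N - K) K n%:R * N ^+ 2)) [X in _ <= X]big_ltn//.
    rewrite win0 ?subr_ge0// mul0r add0r.
    rewrite big_mkcond/= !big_nat; apply: ler_sum => n /andP[n0 nb].
    rewrite winE//; case: (N - K < n%:R); rewrite ?mul1r ?mul0r//.
    rewrite ler_sqr ?nnegrE//; apply: le_trans (cdiv_le _ _ k2 n0) _.
    by rewrite -truncn_ge_nat.
  by rewrite -mulr_suml ler_wpM2r ?sqr_ge0// sum_win.
rewrite -mulrA ler_wpM2l//.
apply: (@le_trans _ _ (N `^ (3 + ep))).
  apply: (@le_trans _ _ (N ^+ 3)); first by rewrite exprS ler_wpM2r ?sqr_ge0.
  by rewrite -powR_mulrn// ler_powR//; lra.
by rewrite lerDr addr_ge0 ?mulr_ge0 ?powR_ge0.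
Qed.

(** Either a least variance exponent exists, or, since they form an up-set
    closed under limits from above, they are not bounded below; then all real
    numbers are variance exponents, including the default value 0. A negative
    least exponent is impossible by [variance_exponent_le0]. *)
Lemma Delta_spec k : (2 <= k)%N -> variance_exponent k (Delta k : R) /\ 0 <= (Delta k : R).
Proof.
move=> k2; set E := [set D : R | variance_exponent k D].
rewrite /Delta -/E; have [[D [ED LD]]|H] := pselect (exists D, (E `&` lbound E) D).
  have [EX LX] := xgetPex 0 (ex_intro (E `&` lbound E) D (conj ED LD)).
  split=> //; rewrite leNgt; apply/negP => X0.
  set X := xget _ _ in EX LX X0.
  have := LX (X - 1) (variance_exponent_le0 (X - 1) (ltW X0) EX); lra.
rewrite xgetPN; last by move=> D ED; apply: H; exists D.
split=> //; apply: contrapT => n0; apply: H.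
have Epos D : E D -> 0 < D.
  move=> ED; rewrite ltNge; apply/negP => D0; apply: n0.
  exact: variance_exponent_mono D0 ED.
have Einf : has_inf E.
  by split; [exists 3; exact: variance_exponent3|exists 0 => D /Epos/ltW].
exists (inf E); split; last exact: inf_lbound Einf.2.
apply: variance_exponent_closed => d d0.
have [D ED DI] := inf_adherent d0 Einf.
exact: variance_exponent_mono (ltW DI) ED.
Qed.

End VarianceExponents.

(** * Admissible exponents *)

Section Admissible.
Context {R : realType}.
Implicit Types N K s : R.

(** The two halves of admissibility, for a fixed threshold constant c. *)
Definition upper_bd k s (c th : R) := exists2 C : R, 0 < C & exists2 N0 : R, 1 <= N0 &
  forall N K, N0 <= N -> 1 <= K -> K <= N -> c * N `^ th <= K ->
    Int 0 1 (fun t => absS k N K t `^ s) <= C * moment_order k s K.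
Definition lower_bd k s (c th : R) := exists2 C : R, 0 < C & exists2 N0 : R, 1 <= N0 &
  forall N K, N0 <= N -> 1 <= K -> K <= N -> c * N `^ th <= K ->
    C * moment_order k s K <= Int 0 1 (fun t => absS k N K t `^ s).

Lemma admissible_of_bounds k s th : 0 < s ->
  (forall c : R, 0 < c -> upper_bd k s c th /\ lower_bd k s c th) -> admissible k s th.
Proof.
move=> s0 H c c0; have [[C2 C20 [N2 N21 H2]] [C1 C10 [N1 N11 H1]]] := H c c0.
exists C1, C2, (Num.max N1 N2); split=> // N K.
rewrite ge_max => /andP[NN1 NN2] K1 cK KN.
have N0 : 0 <= N by rewrite (le_trans _ KN)// (le_trans ler01).
rewrite momentE ?(ltW s0)// !lee_fin; split; [exact: H1|exact: H2].
Qed.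

(** For s >= 1 the L1 norm is at most l + l^(1-s) times the sth moment, with l
    half of its lower bound. For s < 1 it is interpolated between the sth moment
    and an upper bound for the qth one, with q in ]1, 1 + 1/k[. *)
Lemma lower_of_L1 k s (c th D : R) : (2 <= k)%N -> variance_exponent k D ->
  0 < c -> 0 < th -> 0 < s -> s < 1 + k%:R^-1 -> D < th * (2 / (k%:R + 1)) ->
  lower_bd k s c th.
Proof.
move=> k2 vD c0 th0 s0 sk Db.
have k2R : 2 <= k%:R :> R by rewrite ler_nat.
have ki0 : 0 < k%:R^-1 :> R by rewrite invr_gt0; lra.
have ki1 : k%:R^-1 < 1 :> R by rewrite invf_lt1; lra.
have k10 : 0 < k%:R + 1 :> R by lra.
have MO (K : R) : moment_order k s K = (K `^ (k%:R + 1)^-1) `^ s.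
  by rewrite /moment_order sk -powRrM mulrC.
have [C1 C10 [N1 N11 H1]] := L1_lower k2 vD c0 th0 Db.
have nS N K (q : R) : 0 <= q -> nice (fun t => absS k N K t `^ q).
  by move=> q0; apply: nice_powR q0 (nice_absS _ _ _).
have [s1|s1] := leP 1 s.
  exists ((C1 / 2) `^ s); first by rewrite powR_gt0// divr_gt0.
  exists N1 => // N K NN K1 KN NK; have := H1 N K NN K1 KN NK.
  rewrite MO; set Y := K `^ _ => HY.
  have Y0 : 0 < Y by rewrite powR_gt0// (lt_le_trans ltr01).
  set l := C1 / 2 * Y; have l0 : 0 < l by rewrite mulr_gt0// divr_gt0.
  have C20 : 0 <= C1 / 2 by rewrite divr_ge0// ltW.
  rewrite -(powRM _ C20 (ltW Y0)) -/l.
  have J : Int 0 1 (absS k N K) <= l + l `^ (1 - s) * Int 0 1 (fun t => absS k N K t `^ s).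
    apply: (@le_trans _ _ (Int 0 1 (fun t => l + l `^ (1 - s) * absS k N K t `^ s))).
      apply: le_Int; first exact: nice_absS.
        by apply: niceD; [exact: nice_cst|apply: niceZ; exact: nS (ltW s0)].
      move=> t _; have := @powR_interp _ (absS k N K t) l 0 1 s (absS_ge0 _ _ _ _) l0 (lexx _) ler01 s1.
      by rewrite subr0 powRr0 mulr1 !powRr1 ?absS_ge0 ?(ltW l0).
    rewrite IntD; [|exact: nice_cst|apply: niceZ; exact: nS (ltW s0)].
    by rewrite IntZ ?Int_cst ?subr0 ?mulr1//; exact: nS (ltW s0).
  have J2 : l <= l `^ (1 - s) * Int 0 1 (fun t => absS k N K t `^ s).
    have E : C1 * Y = l + l by rewrite /l; field.
    by move: (le_trans HY J); rewrite E lerD2l.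
  have -> : l `^ s = (l `^ (1 - s))^-1 * l.
    by rewrite -powRN -[X in _ = _ * X]powRr1 ?(ltW l0)// -powRDgt//; congr (_ `^ _); ring.
  by rewrite ler_pdivrMl// powR_gt0.
set q : R := 1 + k%:R^-1 / 2.
have q0 : 0 < q by rewrite /q; lra.
have q1 : 1 < q by rewrite /q; lra.
have q2 : q < 2 by rewrite /q; lra.
have qk : q < 1 + k%:R^-1 by rewrite /q; lra.
have qk' : q <> 1 + k%:R^-1 by rewrite /q; lra.
have mq : mu_exp k q = q / (k%:R + 1) by rewrite /mu_exp qk.
have qD : D < th * (2 * mu_exp k q / q).
  by rewrite mq; have -> : 2 * (q / (k%:R + 1)) / q = 2 / (k%:R + 1) by field; rewrite !gt_eqF.
have [C C0 [N2 N21 H2]] := upper_12 k2 vD c0 th0 q1 q2 qk' qD.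
clearbody q.
have C1C : 0 < 2 * C / C1 by rewrite divr_gt0// mulr_gt0.
have qm : 0 < q - 1 by lra.
(* The threshold B Y is chosen so high that the qth moment accounts for at most
   half of the L1 norm. *)
pose B := (2 * C / C1) `^ (q - 1)^-1.
have B0 : 0 < B by rewrite powR_gt0.
have BE : B `^ (1 - q) * C = C1 / 2.
  have -> : B `^ (1 - q) = (2 * C / C1)^-1.
    rewrite /B -powRrM -[RHS]powR_inv1 ?(ltW C1C)//; congr (_ `^ _); field.
    by rewrite gt_eqF.
  by field; rewrite !gt_eqF.
clearbody B.
exists (C1 / 2 * B `^ (s - 1)); first by rewrite mulr_gt0 ?powR_gt0// divr_gt0.
exists (Num.max N1 N2); first by rewrite le_max N11.
move=> N K; rewrite ge_max => /andP[NN1 NN2] K1 KN NK.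
have := H1 N K NN1 K1 KN NK; have := H2 N K NN2 K1 KN NK.
have -> : K `^ mu_exp k q = (K `^ (k%:R + 1)^-1) `^ q by rewrite mq -powRrM mulrC.
rewrite MO; set Y := K `^ _ => HQ HY.
have Y0 : 0 < Y by rewrite powR_gt0// (lt_le_trans ltr01).
set l := B * Y; have l0 : 0 < l by rewrite mulr_gt0.
have n1 := nS N K s (ltW s0); have n2 := nS N K q (ltW q0).
have J : Int 0 1 (absS k N K) <= l `^ (1 - s) * Int 0 1 (fun t => absS k N K t `^ s) +
    l `^ (1 - q) * Int 0 1 (fun t => absS k N K t `^ q).
  apply: (@le_trans _ _ (Int 0 1 (fun t => l `^ (1 - s) * absS k N K t `^ s +
     l `^ (1 - q) * absS k N K t `^ q))).
    apply: le_Int; [exact: nice_absS|by apply: niceD; exact: niceZ|].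
    move=> t _; have := @powR_interp _ (absS k N K t) l s 1 q (absS_ge0 _ _ _ _) l0 (ltW s0) (ltW s1) (ltW q1).
    by rewrite powRr1// absS_ge0.
  by rewrite IntD ?IntZ//; exact: niceZ.
have J2 : l `^ (1 - q) * Int 0 1 (fun t => absS k N K t `^ q) <= C1 / 2 * Y.
  apply: le_trans (ler_wpM2l (powR_ge0 _ _) HQ) _.
  rewrite /l (powRM _ (ltW B0) (ltW Y0)) mulrACA BE -(powRDgt _ _ Y0).
  have -> : 1 - q + q = 1 by ring.
  by rewrite (powRr1 (ltW Y0)).
have J3 : C1 / 2 * Y <= l `^ (1 - s) * Int 0 1 (fun t => absS k N K t `^ s).
  have E : C1 * Y = C1 / 2 * Y + C1 / 2 * Y by field.
  move: (le_trans HY J); rewrite E => H; rewrite -(lerD2r (C1 / 2 * Y)).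
  by apply: le_trans H _; rewrite lerD2l.
have -> : C1 / 2 * B `^ (s - 1) * Y `^ s = (l `^ (1 - s))^-1 * (C1 / 2 * Y).
  rewrite -powRN opprB /l (powRM _ (ltW B0) (ltW Y0)).
  have -> : Y `^ s = Y `^ (s - 1) * Y.
    by rewrite -[X in _ = _ * X]powRr1 ?(ltW Y0)// -powRDgt//; congr (_ `^ _); ring.
  by rewrite [in RHS]mulrACA [X in _ = X * _]mulrC.
by rewrite ler_pdivrMl// powR_gt0.
Qed.

Lemma lower_of_major k s (c th D : R) : (2 <= k)%N -> variance_exponent k D ->
  0 < c -> 0 < th -> 0 < s -> 1 + k%:R^-1 < s -> D < th -> lower_bd k s c th.
Proof.
move=> k2 vD c0 th0 s0 sk Dth.
have [N0 N01 H] := kfree_count k2 vD c0 th0 Dth.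
exists (512 * 32 `^ s)^-1.
  by rewrite invr_gt0; apply: mulr_gt0; [rewrite ltr0n|rewrite powR_gt0 ?ltr0n].
exists N0 => // N K NN K1 KN NK; rewrite /moment_order ifN; last by rewrite -leNgt ltW.
by apply: lower_major => //; exact: H.
Qed.

(** For s < 2 the hypothesis on theta is the condition of the upper bound and
    implies that of the lower bound; for s >= 2 it is the latter. *)
Lemma admissible_above k s (th : R) : (2 <= k)%N -> 0 < s -> s <> 1 + k%:R^-1 ->
  (if s < 1 + k%:R^-1 then (k%:R + 1) / 2 * Delta k
   else if s < 2 then (2^-1 + (2 * (s - 1))^-1) * Delta k else Delta k) < th ->
  admissible k s th.
Proof.
move=> k2 s0 sk Hth; have [vD D0] := @Delta_spec R k k2.
set D := Delta k in Hth vD D0.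
have k2R : 2 <= k%:R :> R by rewrite ler_nat.
have k10 : 0 < k%:R + 1 :> R by lra.
have ki0 : 0 < k%:R^-1 :> R by rewrite invr_gt0; lra.
apply: admissible_of_bounds => // c c0.
have [sl|sg] := ltP s (1 + k%:R^-1).
  rewrite sl in Hth.
  have th0 : 0 < th by apply: le_lt_trans Hth; rewrite mulr_ge0// divr_ge0// ltW.
  have Db : D < th * (2 / (k%:R + 1)).
    rewrite mulrA ltr_pdivlMr// -ltr_pdivrMr//; apply: le_lt_trans Hth.
    by rewrite le_eqVlt; apply/orP; left; apply/eqP; ring.
  split; last exact: lower_of_L1 Db.
  have [s1|s1] := leP s 1.
    have [C C0 [N0 N01 H]] := upper_le1 k2 vD c0 th0 s0 s1 Db.
    by exists C => //; exists N0 => // N K NN K1 KN NK; rewrite /moment_order sl; exact: H.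
  have ki1 : k%:R^-1 < 1 :> R by rewrite invf_lt1; lra.
  have s2 : s < 2 by lra.
  have mE : 2 * mu_exp k s / s = 2 / (k%:R + 1).
    by rewrite /mu_exp sl; field; rewrite !gt_eqF.
  rewrite -mE in Db.
  have [C C0 [N0 N01 H]] := upper_12 k2 vD c0 th0 s1 s2 sk Db.
  by exists C => //; exists N0 => // N K NN K1 KN NK; rewrite moment_orderE; exact: H.
have {}sg : 1 + k%:R^-1 < s by rewrite lt_neqAle sg andbT; apply/eqP => E; exact: sk.
have sn : (s < 1 + k%:R^-1) = false by apply/negbTE; rewrite -leNgt ltW.
rewrite sn in Hth.
have [s2|s2] := ltP s 2.
  rewrite s2 in Hth.
  have s1 : 1 < s by lra.
  have sm : 0 < s - 1 by lra.
  have cf : 2^-1 + (2 * (s - 1))^-1 = s / (2 * (s - 1)) by field; rewrite gt_eqF.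
  have cf1 : 1 <= s / (2 * (s - 1)) by rewrite ler_pdivlMr ?mulr_gt0//; lra.
  rewrite cf in Hth.
  have Dth : D < th by apply: le_lt_trans Hth; rewrite ler_peMl.
  have th0 : 0 < th by apply: le_lt_trans D0 Dth.
  split; last exact: lower_of_major vD c0 th0 s0 sg Dth.
  have Db : D < th * (2 * mu_exp k s / s).
    rewrite /mu_exp sn mulrA ltr_pdivlMr// -ltr_pdivrMr ?mulr_gt0//.
    by apply: le_lt_trans Hth; rewrite le_eqVlt; apply/orP; left; apply/eqP; ring.
  have [C C0 [N0 N01 H]] := upper_12 k2 vD c0 th0 s1 s2 sk Db.
  by exists C => //; exists N0 => // N K NN K1 KN NK; rewrite moment_orderE; exact: H.
rewrite [s < 2]ltNge s2/= in Hth.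
have th0 : 0 < th by apply: le_lt_trans D0 Hth.
split; last exact: lower_of_major vD c0 th0 s0 sg Hth.
exists (2 `^ (s - 1)); first by rewrite powR_gt0.
exists 1 => // N K NN K1 KN NK; rewrite /moment_order sn.
have K0 : 0 <= K by rewrite (le_trans ler01).
by apply: le_trans (upper_ge2 k s2 K1 KN) _; rewrite powRM.
Qed.

End Admissible.

Theorem theorem1p3 (R : realType) (k : nat) (s : R)
    (hk : (2 <= k)%N) (hs0 : 0 < s) (hs : s <> 1 + k%:R^-1) :
  (theta_inf k s <=
    (if s < 1 + k%:R^-1 then (k%:R + 1) / 2 * Delta k
     else if s < 2 then (2^-1 + (2 * (s - 1))^-1) * Delta k
     else Delta k)%:E)%E.
Proof.
apply/lee_addgt0Pr => ep ep0; rewrite -EFinD; apply: ereal_inf_lbound.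
eexists; last by [].
by apply: admissible_above => //; rewrite ltrDl.
Qed.
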